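(* Let $\Gamma$ be a group with property (T;FD). Assume $\Gamma$ has a central extension of the form $$1\longrightarrow \mathbb{Z}\longrightarrow\widetilde\Gamma\longrightarrow\Gamma\longrightarrow 1$$ where $\widetilde\Gamma$ is a group with finite abelianization. If $\Gamma$ is Hilbert--Schmidt stable, then there exists $N\in\mathbb{N}$ such that the finite central extension $$1\longrightarrow \mathbb{Z}/N\longrightarrow\widetilde\Gamma/(N\cdot\mathbb{Z})\longrightarrow\Gamma\longrightarrow 1$$ is not hyperlinear, i.e. the group $\widetilde\Gamma/(N\cdot\mathbb{Z})$ is not hyperlinear.
   Context: Groups are discrete and countable. For $x\in M_m(\mathbb{C})$ the normalized Hilbert--Schmidt norm is $\|x\|_2=\|x\|_{2,m}=(\frac1m\operatorname{tr}(x^*x))^{1/2}$. Asymptotic representation: a sequence of maps $\pi_n:\Gamma\to U(d_n)$ with $\lim_n\|\pi_n(gh)-\pi_n(g)\pi_n(h)\|_2=0$ for all $g,h\in\Gamma$. A group is hyperlinear if it admits an asymptotic representation with, in addition, $\lim_n\|\pi_n(g)-\pi_n(h)\|_2=\sqrt2$ whenever $g\neq h$. For $n\le m$, $x\in U(n)$, $y\in U(m)$ put $d_2(x,y)=\|x\oplus 0_{m-n}-y\|_{2,m}$, where $0_{m-n}$ is the $(m-n)\times(m-n)$ zero matrix. Hilbert--Schmidt stable (in the flexible sense): for every asymptotic representation $\pi_n:\Gamma\to U(d_n)$ there exist $D_n\ge d_n$ and genuine unitary representations $\rho_n:\Gamma\to U(D_n)$ such that $d_2(\pi_n(g),\rho_n(g))\to0$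 for every $g\in\Gamma$. Property (T;FD): $\Gamma$ is finitely generated and there exist a finite symmetric generating set $S$ and $\lambda>0$ such that for every finite dimensional unitary representation $\pi$ of $\Gamma$ the positive operator $1-\frac1{|S|}\sum_{s\in S}\pi(s)$ has no spectrum in $(0,\lambda)$. In the extension, $\mathbb{Z}$ is identified with its image, a central subgroup of $\widetilde\Gamma$, and $N\cdot\mathbb{Z}$ is its subgroup of multiples of $N$. *)

(* Defs.v *)
From HB Require Import structures.
From mathcomp Require Import all_boot all_order all_algebra.
From mathcomp Require Import generic_quotient finmap.
From mathcomp Require Import boolp classical_sets cardinality reals topology.
From mathcomp Require Import normedtype sequences.
From mathcomp Require Import complex.

Set Implicit Arguments.
Unset Strict Implicit.
Unset Printing Implicit Defensive.

Import Order.TTheory GRing.Theory Num.Theory.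
Import numFieldNormedType.Exports.

Local Open Scope classical_set_scope.
Local Open Scope ring_scope.
Local Open Scope sesquilinear_scope.
Local Open Scope quotient_scope.

(** * Subgroups and quotients of possibly infinite groups *)

Definition is_subgroup (G : groupType) (H : set G) : Prop :=
  [/\ H 1%g, (forall x y, H x -> H y -> H (x * y)%g) &
      (forall x, H x -> H (x^-1)%g)].

Definition subgroup_generated (G : groupType) (A : set G) : set G :=
  smallest (@is_subgroup G) A.

Record normal_subgroup (G : groupType) := NormalSubgroup {
  normal_set : set G;
  normal_is_subgroup : is_subgroup normal_set;
  normal_conj : forall x y, normal_set x -> normal_set (x ^ y)%g
}.

Section QuotientGroup.
Variables (G : groupType) (H : normal_subgroup G).
Local Open Scope group_scope.

Definition coset_equiv (x y : G) : bool := `[< normal_set H (x^-1 * y) >].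

Lemma coset_equiv_is_equiv : equiv_class_of coset_equiv.
Proof.
case: (normal_is_subgroup H) => H1 HM HV.
split=> [x|x y|y x z].
- by apply/asboolP; rewrite mulVg.
- by apply/asboolP/asboolP => /HV; rewrite invgM invgK.
- move=> /asboolP xy /asboolP yz; apply/asboolP.
  by have := HM _ _ xy yz; rewrite -mulgA mulVKg.
Qed.

Canonical coset_equiv_equiv := EquivRelPack coset_equiv_is_equiv.
Canonical coset_equiv_encModRel := defaultEncModRel coset_equiv.

Definition quotient_group := {eq_quot coset_equiv}.

HB.instance Definition _ : EqQuotient G coset_equiv quotient_group :=
  EqQuotient.on quotient_group.
HB.instance Definition _ := Choice.on quotient_group.

Definition quotient_one : quotient_group := lift_cst quotient_group 1.
Definition quotient_mul := lift_op2 quotient_group ( *%g ).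
Definition quotient_inv := lift_op1 quotient_group (fun x => x^-1).

Canonical pi_quotient_one_morph := PiConst quotient_one.

Lemma coset_eqP (x y : G) :
  normal_set H (x^-1 * y) <-> x = y %[mod quotient_group].
Proof. by split=> [?|/eqmodP/asboolP//]; apply/eqmodP/asboolP. Qed.

Lemma pi_quotient_inv :
  {morph \pi_quotient_group : x / x^-1 >-> quotient_inv x}.
Proof.
move=> x; unlock quotient_inv; apply/coset_eqP; rewrite invgK.
have /coset_eqP Hx : repr (\pi_quotient_group x) = x %[mod quotient_group].
  by rewrite reprK.
have := normal_conj (x^-1) Hx.
by rewrite conjgE invgK mulgK.
Qed.
Canonical pi_quotient_inv_morph := PiMorph1 pi_quotient_inv.

Lemma pi_quotient_mul :
  {morph \pi_quotient_group : x y / x * y >-> quotient_mul x y}.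
Proof.
move=> x y; unlock quotient_mul; apply/coset_eqP.
have /coset_eqP Hx : x = repr (\pi_quotient_group x) %[mod quotient_group].
  by rewrite reprK.
have /coset_eqP Hy : y = repr (\pi_quotient_group y) %[mod quotient_group].
  by rewrite reprK.
set x' := repr _ in Hx *; set y' := repr _ in Hy *.
case: (normal_is_subgroup H) => _ HM _.
have := HM _ _ (normal_conj y Hx) Hy.
by rewrite conjgE invgM !mulgA mulgK.
Qed.
Canonical pi_quotient_mul_morph := PiMorph2 pi_quotient_mul.

Lemma quotient_mulA : associative quotient_mul.
Proof.
by move=> x y z; rewrite -[x]reprK -[y]reprK -[z]reprK !piE mulgA.
Qed.
Lemma quotient_mul1 : left_id quotient_one quotient_mul.
Proof. by move=> x; rewrite -[x]reprK !piE mul1g. Qed.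
Lemma quotient_mulr1 : right_id quotient_one quotient_mul.
Proof. by move=> x; rewrite -[x]reprK !piE mulg1. Qed.
Lemma quotient_mulV : left_inverse quotient_one quotient_inv quotient_mul.
Proof. by move=> x; rewrite -[x]reprK !piE mulVg. Qed.
Lemma quotient_mulrV : right_inverse quotient_one quotient_inv quotient_mul.
Proof. by move=> x; rewrite -[x]reprK !piE mulgV. Qed.

HB.instance Definition _ := isGroup.Build quotient_group
  quotient_mulA quotient_mul1 quotient_mulr1 quotient_mulV quotient_mulrV.

Lemma pi_quotientM (x y : G) :
  \pi_quotient_group (x * y) =
  \pi_quotient_group x * \pi_quotient_group y :> quotient_group.
Proof. exact: pi_quotient_mul. Qed.

End QuotientGroup.

(** * Abelianization *)

Section Abelianization.
Variable G : groupType.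
Local Open Scope group_scope.

Definition commutator_set : set G :=
  subgroup_generated [set c | exists x y, c = [~ x, y]].

Lemma commutator_is_subgroup : is_subgroup commutator_set.
Proof.
split=> [K [] [] //|x y Hx Hy K HK|x Hx K HK].
- by case: (HK) => -[_ KM _] _; apply: KM; [exact: Hx | exact: Hy].
- by case: (HK) => -[_ _ KV] _; apply: KV; exact: Hx.
Qed.

Lemma commutator_conj (x y : G) : commutator_set x -> commutator_set (x ^ y).
Proof.
case: commutator_is_subgroup => _ HM _ Hx.
have -> : x ^ y = x * [~ x, y] by rewrite commgEl mulVKg.
apply: HM => // K [_]; apply.
by exists x, y.
Qed.

Definition commutator_subgroup : normal_subgroup G :=
  NormalSubgroup commutator_is_subgroup commutator_conj.

Definition abelianization : groupType := quotient_group commutator_subgroup.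

End Abelianization.

(** * Central extensions by the integers *)

(* 1 -> Z -> Gt -> G -> 1; Z is the additive group of [int], so its embedding
   turns sums into products. *)
Record central_Z_extension (Gt G : groupType) := CentralZExtension {
  ext_inj : int -> Gt;
  ext_proj : {multiplicative Gt -> G};
  ext_injD : {morph ext_inj : a b / a + b >-> (a * b)%g};
  ext_inj_injective : injective ext_inj;
  ext_inj_central : forall (a : int) (x : Gt), commute (ext_inj a) x;
  ext_proj_surjective : forall g, exists x, ext_proj x = g;
  ext_exact : forall x, ext_proj x = 1%g <-> exists a, x = ext_inj a
}.

Section Multiples.
Variables (Gt G : groupType) (E : central_Z_extension Gt G) (N : nat).

Definition multiples_set : set Gt :=
  [set x | exists k : int, x = ext_inj E (N%:Z * k)].

Lemma multiples_is_subgroup : is_subgroup multiples_set.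
Proof.
have inj0 : ext_inj E 0 = 1%g.
  by apply: (mulgI (ext_inj E 0)); rewrite -ext_injD addr0 mulg1.
split=> [|_ _ [k ->] [l ->]|_ [k ->]].
- by exists 0; rewrite mulr0.
- by exists (k + l); rewrite mulrDr ext_injD.
- exists (- k); apply: (mulgI (ext_inj E (N%:Z * k))).
  by rewrite mulgV -ext_injD -mulrDr subrr mulr0.
Qed.

Lemma multiples_conj (x y : Gt) : multiples_set x -> multiples_set (x ^ y)%g.
Proof.
case=> k ->; exists k.
by rewrite conjgE ext_inj_central mulKg.
Qed.

Definition multiples : normal_subgroup Gt :=
  NormalSubgroup multiples_is_subgroup multiples_conj.

End Multiples.

(** * Unitary and asymptotic representations *)

Section Representations.
Variable R : realType.

Definition hsnorm (m : nat) (x : 'M[R[i]]_m) : R :=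
  Num.sqrt (m%:R^-1 * complex.Re (\tr (x ^t* *m x))).

(* d_2(x, y) for x of size n and y of size m = n + k. *)
Definition d2 (n k : nat) (x : 'M[R[i]]_n) (y : 'M[R[i]]_(n + k)) : R :=
  hsnorm (block_mx x 0 0 0 - y).

Definition unitary_rep (G : groupType) (n : nat) (rho : G -> 'M[R[i]]_n) :
    Prop :=
  (forall g, rho g \is unitarymx) /\
  {morph rho : g h / (g * h)%g >-> g *m h}.

Definition asymptotic_rep (G : groupType) (d : nat -> nat)
    (pi : forall n, G -> 'M[R[i]]_(d n)) : Prop :=
  [/\ (forall n, (0 < d n)%N),
      (forall n g, pi n g \is unitarymx) &
      (forall g h : G,
         (fun n => hsnorm (pi n (g * h)%g - pi n g *m pi n h)) @ \oo
           --> (0 : R))].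

Definition hyperlinear (G : groupType) : Prop :=
  exists (d : nat -> nat) (pi : forall n, G -> 'M[R[i]]_(d n)),
    asymptotic_rep pi /\
    forall g h : G, g <> h ->
      (fun n => hsnorm (pi n g - pi n h)) @ \oo --> (Num.sqrt 2 : R).

(* The dimensions D n >= d n of the genuine representations are written
   d n + k n. *)
Definition hs_stable (G : groupType) : Prop :=
  forall (d : nat -> nat) (pi : forall n, G -> 'M[R[i]]_(d n)),
    asymptotic_rep pi ->
    exists (k : nat -> nat) (rho : forall n, G -> 'M[R[i]]_(d n + k n)),
      (forall n, unitary_rep (rho n)) /\
      forall g : G, (fun n => d2 (pi n g) (rho n g)) @ \oo --> (0 : R).

Definition property_TFD (G : groupType) : Prop :=
  exists (S : {fset G}) (lambda : R),
    [/\ {in S, forall s : G, (s^-1)%g \in S},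
        subgroup_generated [set` S] = [set: G],
        0 < lambda &
        forall (n : nat) (pi : G -> 'M[R[i]]_n), unitary_rep pi ->
          forall t : R, 0 < t < lambda ->
            ~~ eigenvalue
                 (1%:M - (#|` S |%:R)^-1 *: \sum_(s <- S) pi s) (t%:C)%C].

End Representations.

(* Main.v *)
(* Let z generate the central copy of Z and suppose that all the quotients of
   Gammat by N.Z are hyperlinear. Since the abelianization is finite, some z^M
   with M > 0 is a product of commutators. For N large, cutting an asymptotic
   representation of Gammat / N.Z by an approximate spectral projection of z
   gives an almost representation pi of Gammat in which z acts as a root of unity
   zeta close to 1 with zeta^M <> 1. Along a section s of the extension, pi is
   then a (rather poor) almost representation of Gamma, so it is close to a genuine
   representation rho of Gamma: j rho ~ pi j for a coisometry j. In
   pi (x) conj pi the phases cancel, so this is an almost representation of Gamma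
   of arbitrarily good quality, close to a genuine representation tau.

   The squared moduli of the inner products of the vectors
   v_g = pi(s g)^* j rho(g) are therefore nearly matrix coefficients of the genuine
   finite dimensional representation Y |-> tau^* Y (rho (x) conj rho). The
   spectral gap shows that an average T of the rank one projections on the v_g stays
   near the projection on j while being almost invariant under the operators
   X |-> pi(x)^* X rho(p x), where p is the projection Gammat -> Gamma. The top
   eigenvector of T is then almost an eigenvector of all these operators, and the
   eigenvalues form an approximate character chi of Gammat with chi(z^M) close to
   the conjugate of zeta^M. But approximate characters are close to 1 on products
   of commutators. *)
Require Import Defs.
From HB Require Import structures.
From mathcomp Require Import all_boot all_order all_algebra.
From mathcomp Require Import finmap boolp classical_sets cardinality reals.
From mathcomp Require Import topology normedtype sequences trigo.
From mathcomp Require Import complex mxtens.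
From mathcomp Require Import ring lra.

Set Implicit Arguments.
Unset Strict Implicit.
Unset Printing Implicit Defensive.

Import Order.TTheory GRing.Theory Num.Theory.
Import numFieldNormedType.Exports.

Local Open Scope ring_scope.
Local Open Scope sesquilinear_scope.

(** Two qualities of approximation must be kept apart. Along the section s, the map pi fails to be
    multiplicative by phases zeta^a, with a the cocycle of the extension. This defect is governed by
    the distance from zeta to 1 and cannot be improved once zeta is fixed. So the closeness of rho
    to pi is only asked to be as good as the spectral gap requires, and this tolerance is fixed
    before zeta. The target |zeta^M - 1|, the finite set on which characters are tested and the
    length of the random walk all come after zeta; the precision that they demand is supplied by
    tau, for which the phases do not exist. Passing from tensor squares to rank one operators loses
    nothing: equal combinations of the X tensor conj X and of the rank one operators on the X have
    equal Frobenius norm, because the Gram matrices agree. Stability is flexible, so genuine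
    representations live in larger dimensions and all comparisons go through coisometries. *)

(** * The Frobenius norm *)

(* The field [R[i]] is used only through this interface: an abstract
   [numClosedFieldType] keeps conversion tests on matrices cheap. *)
Record complexes (R : realType) := Complexes {
  cfield :> numClosedFieldType;
  re : cfield -> R;
  toC : {rmorphism R -> cfield};
  reD : {morph re : x y / x + y};
  reZ : forall a x, re (toC a * x) = a * re x;
  re1 : re 1 = 1;
  re_conj : forall x, re x^* = re x;
  conj_toC : forall a, (toC a)^* = toC a;
  re_real : forall x, x \is Num.real -> toC (re x) = x;
  re_mulconj_ge0 : forall x, 0 <= re (x * x^*);
  sqr_re_le : forall x, re x ^+ 2 <= re (x * x^*)
}.

Notation "a %:K" := (toC _ a) (at level 2, format "a %:K").

Definition nrm (R : realType) (C : complexes R) (x : C) : R :=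
  Num.sqrt (re (x * x^*)).

HB.lock Definition ip (R : realType) (C : complexes R) m n (A B : 'M[C]_(m, n)) : C :=
  \tr (A *m B ^t*).
(** Unnormalized, since rectangular matrices and several dimensions occur together; the factor sqrt
    d of the normalized Hilbert-Schmidt norm is written out in each estimate. *)
HB.lock Definition fnorm (R : realType) (C : complexes R) m n (A : 'M[C]_(m, n)) : R :=
  Num.sqrt (re (ip A A)).

Section Frobenius.
Variables (R : realType) (C : complexes R).

Lemma re0 : re (0 : C) = 0.
Proof. by rewrite -[0 in LHS](mul0r 1) -(rmorph0 (toC C)) reZ mul0r. Qed.
Lemma reN (x : C) : re (- x) = - re x.
Proof. by apply/eqP; rewrite -addr_eq0 -reD addNr re0. Qed.
Lemma reB (x y : C) : re (x - y) = re x - re y.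
Proof. by rewrite reD reN. Qed.
Lemma re_toC (a : R) : re (a%:K : C) = a.
Proof. by rewrite -[_%:K]mulr1 reZ re1 mulr1. Qed.
Lemma re_sum I (r : seq I) (P : pred I) (F : I -> C) :
  re (\sum_(i <- r | P i) F i) = \sum_(i <- r | P i) re (F i).
Proof. by apply: (big_morph (@re R C)) => [x y|]; rewrite ?reD ?re0. Qed.
Lemma toC_inj : injective (toC C).
Proof. by move=> a b /(congr1 (@re R C)); rewrite !re_toC. Qed.
Lemma nrm_sqr (x : C) : nrm x ^+ 2 = re (x * x^*).
Proof. by rewrite sqr_sqrtr ?re_mulconj_ge0. Qed.
Lemma mulconj (x : C) : x * x^* = (nrm x ^+ 2)%:K.
Proof. by rewrite nrm_sqr re_real // ger0_real // mul_conjC_ge0. Qed.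
Lemma nrm_ge0 (x : C) : 0 <= nrm x.
Proof. exact: sqrtr_ge0. Qed.
Lemma nrm_toC (a : R) : nrm (a%:K : C) = `|a|.
Proof. by rewrite /nrm conj_toC reZ re_toC -expr2 sqrtr_sqr. Qed.
Lemma nrm0 : nrm (0 : C) = 0.
Proof. by rewrite -(rmorph0 (toC C)) nrm_toC normr0. Qed.
Lemma nrm1 : nrm (1 : C) = 1.
Proof. by rewrite -(rmorph1 (toC C)) nrm_toC normr1. Qed.
Lemma nrm_eq0 (x : C) : nrm x = 0 -> x = 0.
Proof.
move=> x0; apply/eqP; rewrite -mul_conjC_eq0 mulconj x0 expr0n /=.
by rewrite rmorph0.
Qed.
Lemma nrm_conj (x : C) : nrm x^* = nrm x.
Proof. by rewrite /nrm conjCK mulrC. Qed.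
Lemma nrmM (x y : C) : nrm (x * y) = nrm x * nrm y.
Proof.
apply/eqP; rewrite -(eqrXn2 (n := 2)) ?mulr_ge0 ?nrm_ge0 //; apply/eqP.
by apply: toC_inj; rewrite exprMn [RHS]rmorphM /= -!mulconj rmorphM mulrACA.
Qed.
Lemma nrmN (x : C) : nrm (- x) = nrm x.
Proof. by rewrite /nrm rmorphN mulrNN. Qed.
Lemma re_le_nrm (x : C) : `|re x| <= nrm x.
Proof. by rewrite -sqrtr_sqr ler_sqrt ?re_mulconj_ge0 ?sqr_re_le. Qed.
Lemma nrmD (x y : C) : nrm (x + y) <= nrm x + nrm y.
Proof.
rewrite -(ler_pXn2r (n := 2)) ?nnegrE ?addr_ge0 ?nrm_ge0 //.
rewrite nrm_sqr rmorphD /= mulrDl !mulrDr !reD -!nrm_sqr.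
have -> : re (y * x^*) = re (x * y^*).
  by rewrite -re_conj rmorphM /= conjCK mulrC.
have := ler_normlW (re_le_nrm (x * y^*)); rewrite nrmM nrm_conj.
by rewrite sqrrD; lra.
Qed.

Lemma trmxCD m n (A B : 'M[C]_(m, n)) : (A + B)^t* = A^t* + B^t*.
Proof. by rewrite linearD /= map_mxD. Qed.
Lemma trmxCN m n (A : 'M[C]_(m, n)) : (- A)^t* = - A^t*.
Proof. by rewrite linearN /= map_mxN. Qed.
Lemma trmxCB m n (A B : 'M[C]_(m, n)) : (A - B)^t* = A^t* - B^t*.
Proof. by rewrite trmxCD trmxCN. Qed.
Lemma trmxCZ m n a (A : 'M[C]_(m, n)) : (a *: A)^t* = a^* *: A^t*.
Proof. by rewrite linearZ /= map_mxZ. Qed.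
Lemma trmxCM m n p (A : 'M[C]_(m, n)) (B : 'M[C]_(n, p)) :
  (A *m B)^t* = B^t* *m A^t*.
Proof. by rewrite trmx_mul map_mxM. Qed.
Lemma trmxC1 n : (1%:M : 'M[C]_n)^t* = 1%:M.
Proof. by rewrite trmx1 map_mx1. Qed.
Lemma trmxC0 m n : (0 : 'M[C]_(m,n))^t* = 0.
Proof. by rewrite trmx0 map_mx0. Qed.
Lemma trmxC_sum m n I (r : seq I) (P : pred I) (F : I -> 'M[C]_(m, n)) :
  (\sum_(i <- r | P i) F i)^t* = \sum_(i <- r | P i) (F i)^t*.
Proof. by apply: (big_morph _ (@trmxCD m n) (@trmxC0 m n)). Qed.

Lemma ipT m n (A B : 'M[C]_(m, n)) : ip A B = \tr (A *m B ^t*).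
Proof. by rewrite ip.unlock. Qed.
Lemma ipDl m n (A B X : 'M[C]_(m, n)) : ip (A + B) X = ip A X + ip B X.
Proof. by rewrite !ipT mulmxDl mxtraceD. Qed.
Lemma ipZl m n a (A X : 'M[C]_(m, n)) : ip (a *: A) X = a * ip A X.
Proof. by rewrite !ipT -scalemxAl mxtraceZ. Qed.
Lemma ip_conj m n (A B : 'M[C]_(m, n)) : (ip A B)^* = ip B A.
Proof.
rewrite !ipT -(trace_map_mx Num.conj) -mxtrace_tr map_trmx.
by rewrite trmxCM trmxCK.
Qed.
Lemma ipNl m n (A X : 'M[C]_(m, n)) : ip (- A) X = - ip A X.
Proof. by rewrite -scaleN1r ipZl mulN1r. Qed.
Lemma ipBl m n (A B X : 'M[C]_(m, n)) : ip (A - B) X = ip A X - ip B X.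
Proof. by rewrite ipDl ipNl. Qed.
Lemma ipDr m n (A B X : 'M[C]_(m, n)) : ip X (A + B) = ip X A + ip X B.
Proof. by rewrite !ipT trmxCD mulmxDr mxtraceD. Qed.
Lemma ipNr m n (A X : 'M[C]_(m, n)) : ip X (- A) = - ip X A.
Proof. by rewrite !ipT trmxCN mulmxN raddfN. Qed.
Lemma ipBr m n (A B X : 'M[C]_(m, n)) : ip X (A - B) = ip X A - ip X B.
Proof. by rewrite ipDr ipNr. Qed.
Lemma ipZr m n a (A X : 'M[C]_(m, n)) : ip X (a *: A) = a^* * ip X A.
Proof. by rewrite !ipT trmxCZ -scalemxAr mxtraceZ. Qed.
Lemma ip_suml m n I (r : seq I) (P : pred I) (F : I -> 'M[C]_(m, n)) X :
  ip (\sum_(i <- r | P i) F i) X = \sum_(i <- r | P i) ip (F i) X.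
Proof. by rewrite ipT mulmx_suml raddf_sum; apply: eq_bigr => i _; rewrite ipT. Qed.
Lemma ip_sumr m n I (r : seq I) (P : pred I) (F : I -> 'M[C]_(m, n)) X :
  ip X (\sum_(i <- r | P i) F i) = \sum_(i <- r | P i) ip X (F i).
Proof. by rewrite ipT trmxC_sum mulmx_sumr raddf_sum; apply: eq_bigr => i _; rewrite ipT. Qed.

Lemma ipE m n (A B : 'M[C]_(m, n)) : ip A B = \sum_i \sum_j A i j * (B i j)^*.
Proof.
rewrite !ipT /mxtrace; apply: eq_bigr => i _; rewrite mxE.
by apply: eq_bigr => j _; rewrite !mxE.
Qed.

Lemma ip_selfE m n (A : 'M[C]_(m, n)) :
  ip A A = (\sum_i \sum_j nrm (A i j) ^+ 2)%:K.
Proof.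
rewrite ipE rmorph_sum; apply: eq_bigr => i _.
by rewrite rmorph_sum; apply: eq_bigr => j _; rewrite mulconj.
Qed.

Lemma re_ip_ge0 m n (A : 'M[C]_(m, n)) : 0 <= re (ip A A).
Proof.
by rewrite ip_selfE re_toC; do 2!apply: sumr_ge0 => ? _; rewrite sqr_ge0.
Qed.
Lemma fnorm_ge0 m n (A : 'M[C]_(m, n)) : 0 <= fnorm A.
Proof. by rewrite fnorm.unlock sqrtr_ge0. Qed.
Lemma fnorm_sqr m n (A : 'M[C]_(m, n)) : fnorm A ^+ 2 = re (ip A A).
Proof. by rewrite fnorm.unlock sqr_sqrtr ?re_ip_ge0. Qed.
Lemma ip_fn m n (A : 'M[C]_(m, n)) : ip A A = (fnorm A ^+ 2)%:K.
Proof. by rewrite fnorm_sqr ip_selfE re_toC. Qed.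
Lemma fnorm_sqrE m n (A : 'M[C]_(m, n)) :
  fnorm A ^+ 2 = \sum_i \sum_j nrm (A i j) ^+ 2.
Proof. by rewrite fnorm_sqr ip_selfE re_toC. Qed.

Lemma fnorm0 m n : fnorm (0 : 'M[C]_(m, n)) = 0.
Proof. by rewrite fnorm.unlock ipT mul0mx mxtrace0 re0 sqrtr0. Qed.

Lemma fnorm0_eq0 m n (A : 'M[C]_(m, n)) : fnorm A = 0 -> A = 0.
Proof.
move=> A0; have := fnorm_sqrE A; rewrite A0 expr0n /= => /esym/eqP.
rewrite psumr_eq0; last by move=> i _; apply: sumr_ge0 => j _; rewrite sqr_ge0.
move=> /allP H; apply/matrixP => i j; rewrite mxE.
have := H i (mem_index_enum _); rewrite psumr_eq0 => [/allP H'|k _].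
  have := H' j (mem_index_enum _); rewrite implyTb sqrf_eq0 => /eqP.
  exact: nrm_eq0.
by rewrite sqr_ge0.
Qed.

Lemma fnorm_eqP m n m' n' (A : 'M[C]_(m, n)) (B : 'M[C]_(m', n')) :
  re (ip A A) = re (ip B B) -> fnorm A = fnorm B.
Proof. by rewrite fnorm.unlock => ->. Qed.

Lemma fnormZ m n a (A : 'M[C]_(m, n)) : fnorm (a *: A) = nrm a * fnorm A.
Proof.
rewrite fnorm.unlock ipZl ipZr mulrA mulconj reZ sqrtrM ?sqr_ge0 // sqrtr_sqr.
by rewrite ger0_norm ?nrm_ge0.
Qed.
Lemma fnormZR m n (a : R) (A : 'M[C]_(m, n)) : fnorm (a%:K *: A) = `|a| * fnorm A.
Proof. by rewrite fnormZ nrm_toC. Qed.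
Lemma fnormN m n (A : 'M[C]_(m, n)) : fnorm (- A) = fnorm A.
Proof. by rewrite fnorm.unlock ipNl ipNr opprK. Qed.
Lemma fnormBC m n (A B : 'M[C]_(m, n)) : fnorm (A - B) = fnorm (B - A).
Proof. by rewrite -opprB fnormN. Qed.

Lemma fnormD_sqr m n (A B : 'M[C]_(m, n)) :
  fnorm (A + B) ^+ 2 = fnorm A ^+ 2 + 2 * re (ip A B) + fnorm B ^+ 2.
Proof.
rewrite !fnorm_sqr ipDl !ipDr !reD -(ip_conj A B) re_conj; ring.
Qed.

Lemma cauchy_re m n (A B : 'M[C]_(m, n)) : re (ip A B) <= fnorm A * fnorm B.
Proof.
have [/fnorm0_eq0 ->|A0] := eqVneq (fnorm A) 0.
  by rewrite fnorm0 ipT mul0mx mxtrace0 re0 mul0r.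
have [/fnorm0_eq0 ->|B0] := eqVneq (fnorm B) 0.
  by rewrite fnorm0 ipT trmxC0 mulmx0 mxtrace0 re0 mulr0.
have a0 : 0 < fnorm A by rewrite lt_def A0 fnorm_ge0.
have b0 : 0 < fnorm B by rewrite lt_def B0 fnorm_ge0.
have := sqr_ge0 (fnorm ((fnorm B)%:K *: A + - ((fnorm A)%:K *: B))).
rewrite fnormD_sqr fnormN !fnormZR ipNr ipZl ipZr conj_toC reN !reZ.
rewrite !ger0_norm ?fnorm_ge0 // => H.
have : 0 <= (2 * fnorm A * fnorm B) * (fnorm A * fnorm B - re (ip A B)).
  by move: H; congr (0 <= _); ring.
by rewrite pmulr_rge0 ?subr_ge0 // !mulr_gt0.
Qed.

(** Multiplying [B] by the scalar [ip A B] makes the inner product real and nonnegative, which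
    reduces the claim to [cauchy_re]. *)
Lemma cauchy_ip m n (A B : 'M[C]_(m, n)) : nrm (ip A B) <= fnorm A * fnorm B.
Proof.
have [->|x0] := eqVneq (ip A B) 0.
  by rewrite nrm0 mulr_ge0 ?fnorm_ge0.
have p0 : 0 < nrm (ip A B).
  rewrite lt_def nrm_ge0 andbT; apply: contraNneq x0 => /nrm_eq0 ->.
  by [].
have := cauchy_re A (ip A B *: B).
rewrite ipZr mulrC mulconj re_toC fnormZ => H.
rewrite -(ler_pM2l p0) -expr2; apply: (le_trans H).
by rewrite mulrCA.
Qed.

Lemma fnormD m n (A B : 'M[C]_(m, n)) : fnorm (A + B) <= fnorm A + fnorm B.
Proof.
rewrite -(ler_pXn2r (n := 2)) ?nnegrE ?addr_ge0 ?fnorm_ge0 //.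
rewrite fnormD_sqr; have := cauchy_re A B; lra.
Qed.
Lemma fnormB m n (A B : 'M[C]_(m, n)) : fnorm (A - B) <= fnorm A + fnorm B.
Proof. by rewrite -(fnormN B); exact: fnormD. Qed.
Lemma fnorm_dist m n (X A B : 'M[C]_(m, n)) : fnorm (A - B) <= fnorm (A - X) + fnorm (X - B).
Proof. by have := fnormD (A - X) (X - B); rewrite addrA subrK. Qed.
Lemma fnorm_sum m n I (r : seq I) (P : pred I) (F : I -> 'M[C]_(m, n)) :
  fnorm (\sum_(i <- r | P i) F i) <= \sum_(i <- r | P i) fnorm (F i).
Proof.
apply: (big_ind2 (fun A a => fnorm A <= a)) => //; first by rewrite fnorm0.
by move=> A a B b Aa Bb; apply: le_trans (fnormD _ _) (lerD Aa Bb).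
Qed.

Lemma fnorm_trC m n (A : 'M[C]_(m, n)) : fnorm (A^t*) = fnorm A.
Proof. by apply: fnorm_eqP; rewrite !ipT trmxCK mxtrace_mulC. Qed.

Lemma fnorm_mulr m n p (A : 'M[C]_(m, n)) (U : 'M[C]_(n, p)) :
  U *m U^t* = 1%:M -> fnorm (A *m U) = fnorm A.
Proof.
by move=> UU; apply: fnorm_eqP; rewrite !ipT trmxCM mulmxA -(mulmxA A) UU mulmx1.
Qed.
Lemma fnorm_mull m n p (A : 'M[C]_(m, n)) (U : 'M[C]_(p, m)) :
  U^t* *m U = 1%:M -> fnorm (U *m A) = fnorm A.
Proof.
by move=> UU; rewrite -fnorm_trC trmxCM fnorm_mulr ?trmxCK // fnorm_trC.
Qed.
(** The rows of [B] are the orthogonal projections of the rows of [A] onto the row space of [e], so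
    Pythagoras applies to A = B + (A - B). *)
Lemma fnorm_compr m n p (A : 'M[C]_(m, n)) (e : 'M[C]_(p, n)) :
  e *m e^t* = 1%:M -> fnorm (A *m e^t*) <= fnorm A.
Proof.
move=> ee; set B := A *m e^t* *m e.
have Be : fnorm B = fnorm (A *m e^t*) by rewrite /B (fnorm_mulr _ ee).
have orth : ip B (A - B) = 0.
  rewrite !ipT trmxCB mulmxBr /B !trmxCM trmxCK.
  by rewrite -!mulmxA (mulmxA e (e^t*)) ee mul1mx subrr mxtrace0.
rewrite -Be -(ler_pXn2r (n := 2)) ?nnegrE ?fnorm_ge0 //.
by rewrite -[in leRHS](subrK B A) addrC fnormD_sqr orth re0 mulr0 addr0 lerDl sqr_ge0.
Qed.
Lemma fnorm_compl m n p (A : 'M[C]_(m, n)) (e : 'M[C]_(p, m)) :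
  e *m e^t* = 1%:M -> fnorm (e *m A) <= fnorm A.
Proof.
by move=> ee; rewrite -fnorm_trC trmxCM -(fnorm_trC A); apply: fnorm_compr.
Qed.

Lemma fnorm1 n : fnorm (1%:M : 'M[C]_n) = Num.sqrt n%:R.
Proof.
rewrite fnorm.unlock ipT trmxC1 mulmx1 mxtrace1; congr Num.sqrt.
by rewrite -(rmorph_nat (toC C)) re_toC.
Qed.

Lemma fnorm_coiso m n (e : 'M[C]_(m, n)) : e *m e^t* = 1%:M -> fnorm e = Num.sqrt m%:R.
Proof. by move=> ee; rewrite -[e]mul1mx fnorm_mulr // fnorm1. Qed.

Lemma uniP n (U : 'M[C]_n) : U \is unitarymx ->
  U *m U^t* = 1%:M /\ U^t* *m U = 1%:M.
Proof. by move=> /unitarymxP UU; split=> //; apply: mulmx1C. Qed.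

Lemma fnorm_tens m n p q (A : 'M[C]_(m, n)) (B : 'M[C]_(p, q)) :
  fnorm (A *t B) = fnorm A * fnorm B.
Proof.
apply/eqP; rewrite -(eqrXn2 (n := 2)) ?mulr_ge0 ?fnorm_ge0 //; apply/eqP.
rewrite exprMn !fnorm_sqrE mulr_sum; apply: eq_bigr => i _.
rewrite mulr_sum; apply: eq_bigr => j _.
by rewrite mxE nrmM exprMn.
Qed.

Lemma trmxC_tens m n p q (A : 'M[C]_(m, n)) (B : 'M[C]_(p, q)) :
  (A *t B)^t* = A^t* *t B^t*.
Proof. by rewrite trmx_tens map_mxT. Qed.

End Frobenius.

(** * Hermitian matrices and polar decomposition *)

HB.lock Definition dg (R : realType) (C : complexes R) n (t : 'I_n -> R) : 'M[C]_n :=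
  diag_mx (\row_i (t i)%:K).

Section Spectral.
Variables (R : realType) (C : complexes R).

Lemma dgE n (t : 'I_n -> R) i j : (dg C t) i j = (t i)%:K *+ (i == j).
Proof. by rewrite dg.unlock !mxE; case: eqP => [->|]. Qed.

Lemma dg_tr n (t : 'I_n -> R) : (dg C t)^t* = dg C t.
Proof.
apply/matrixP=> i j; rewrite !mxE !dgE eq_sym; case: eqP => [->|_].
  by rewrite !mulr1n conj_toC.
by rewrite !mulr0n conjC0.
Qed.

Lemma dgM n (s t : 'I_n -> R) : dg C s *m dg C t = dg C (fun i => s i * t i).
Proof.
rewrite dg.unlock mulmx_diag; congr diag_mx; apply/rowP => i.
by rewrite !mxE rmorphM.
Qed.

Lemma dgB n (s t : 'I_n -> R) : dg C s - dg C t = dg C (fun i => s i - t i).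
Proof.
rewrite dg.unlock -linearB; congr diag_mx; apply/rowP => i.
by rewrite !mxE rmorphB.
Qed.

Lemma dg1 n : @dg R C n (fun=> 1) = 1%:M.
Proof.
by apply/matrixP => i j; rewrite dgE !mxE rmorph1.
Qed.

Lemma dgZ n a (t : 'I_n -> R) : a%:K *: dg C t = dg C (fun i => a * t i).
Proof.
rewrite dg.unlock -linearZ; congr diag_mx; apply/rowP => i.
by rewrite !mxE rmorphM.
Qed.

Lemma fnorm_dg_sqr n (t : 'I_n -> R) : fnorm (dg C t) ^+ 2 = \sum_i t i ^+ 2.
Proof.
rewrite fnorm_sqrE; apply: eq_bigr => i _; rewrite (bigD1 i) //= big1.
  by rewrite dgE eqxx mulr1n nrm_toC real_normK ?num_real // addr0.
by move=> j ji; rewrite dgE eq_sym (negPf ji) mulr0n nrm0 expr0n.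
Qed.

Lemma fnorm_dg_le n k (s t : 'I_n -> R) : 0 <= k ->
  (forall i, `|s i| <= k * `|t i|) -> fnorm (dg C s) <= k * fnorm (dg C t).
Proof.
move=> k0 H; rewrite -(ler_pXn2r (n := 2)) ?nnegrE ?mulr_ge0 ?fnorm_ge0 //.
rewrite exprMn !fnorm_dg_sqr mulr_sumr; apply: ler_sum => i _.
rewrite -exprMn -(real_normK (num_real (s i))) -(real_normK (num_real (_ * _))).
by rewrite ler_pXn2r ?nnegrE ?normr_ge0 // normrM (ger0_norm k0).
Qed.

Lemma spectral_herm n (h : 'M[C]_n) : h^t* = h ->
  exists (V : 'M[C]_n) (t : 'I_n -> R), V \is unitarymx /\ h = V^t* *m dg C t *m V.
Proof.
move=> hh.
have hs : h \is hermsymmx by rewrite qualifE /= expr0 scale1r hh.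
have /orthomx_spectralP := hermitian_normalmx hs.
have Vu := spectral_unitarymx h.
rewrite (invmx_unitary Vu) => hE.
have rd := hermitian_spectral_diag_real hs.
exists (spectralmx h), (fun i => re (spectral_diag h 0 i)); split=> //.
rewrite {1}hE dg.unlock.
suff -> : \row_i (re (spectral_diag h 0 i))%:K = spectral_diag h by [].
apply/rowP => i; rewrite mxE re_real //.
by move/mxOverP: rd.
Qed.

Lemma fnorm_conjV n (V h : 'M[C]_n) : V \is unitarymx -> fnorm (V^t* *m h *m V) = fnorm h.
Proof.
by move=> /uniP [VV VV']; rewrite fnorm_mulr // fnorm_mull // trmxCK.
Qed.

(** [U] is the unitary factor of the polar decomposition of [A]. In terms of the singular values r >
    0 the bound is |r - 1| <= |r^2 - 1|. *)
Lemma polar_unit n (A : 'M[C]_n) : A \in unitmx ->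
  exists2 U : 'M[C]_n, U \is unitarymx & fnorm (U - A) <= fnorm (A *m A^t* - 1%:M).
Proof.
move=> Au.
have [|V [s [Vu AAE]]] := @spectral_herm _ (A *m A^t*).
  by rewrite trmxCM trmxCK.
have [VV VV'] := uniP Vu.
set B := V *m A.
have BB : B *m B^t* = dg C s.
  rewrite /B trmxCM -mulmxA (mulmxA A) AAE.
  by rewrite !mulmxA VV mul1mx -mulmxA VV mulmx1.
have Bu : B *m B^t* \in unitmx.
  rewrite unitmx_mul /B unitmx_mul (unitarymx_unit Vu) Au /=.
  by rewrite map_unitmx unitmx_tr unitmx_mul (unitarymx_unit Vu) Au.
have s0 i : 0 < s i.
  have sE : s i = fnorm (row i B) ^+ 2.
    apply: (@toC_inj R C); rewrite -ip_fn ipE big_ord1.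
    have := congr1 (fun M : 'M[C]_n => M i i) BB.
    rewrite dgE eqxx mulr1n mxE => <-.
    by apply: eq_bigr => j _; rewrite !mxE.
  rewrite lt_def {2}sE sqr_ge0 andbT.
  move: Bu; rewrite BB dg.unlock unitmxE det_diag unitfE prodf_seq_neq0.
  move=> /allP/(_ i); rewrite mem_index_enum implyTb mxE => /(_ isT).
  by apply: contra_neq => ->; rewrite rmorph0.
pose r i := Num.sqrt (s i).
have r0 i : 0 < r i by rewrite sqrtr_gt0.
have rs i : r i ^+ 2 = s i by rewrite sqr_sqrtr ?ltW.
pose U0 := dg C (fun i => (r i)^-1) *m B.
have U0u : U0 *m U0^t* = 1%:M.
  rewrite /U0 trmxCM dg_tr -mulmxA (mulmxA B) BB !dgM -dg1; congr dg.
  by apply/funext => i; rewrite -rs; field; rewrite lt0r_neq0.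
have BE : B = dg C r *m U0.
  rewrite /U0 mulmxA dgM -[LHS]mul1mx -dg1; congr (dg C _ *m _).
  by apply/funext => i; rewrite divff // lt0r_neq0.
exists (V^t* *m U0).
  by apply/unitarymxP; rewrite trmxCM trmxCK -mulmxA (mulmxA U0) U0u mul1mx.
have -> : V^t* *m U0 - A = V^t* *m (U0 - B).
  by rewrite mulmxBr /B (mulmxA _ V) VV' mul1mx.
have -> : A *m A^t* - 1%:M = V^t* *m (dg C s - 1%:M) *m V.
  by rewrite AAE mulmxBr mulmx1 mulmxBl VV'.
rewrite fnorm_conjV // fnorm_mull ?trmxCK //.
rewrite BE -{1}[U0]mul1mx -mulmxBl fnorm_mulr // -dg1 !dgB -[leRHS]mul1r.
apply: fnorm_dg_le => // i; rewrite mul1r -rs.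
rewrite -opprB normrN (_ : r i ^+ 2 - 1 = (r i - 1) * (r i + 1)); last by ring.
rewrite normrM ler_peMr // ger0_norm; have := r0 i; lra.
Qed.

(** In the rank normal form of [A], the zero entries of the diagonal are replaced by a small number
    t. *)
Lemma unit_approx n (A : 'M[C]_n) (eta : R) : 0 < eta ->
  exists2 A' : 'M[C]_n, A' \in unitmx & fnorm (A' - A) <= eta.
Proof.
move=> eta0; set r := \rank A.
set X := col_ebase A *m copid_mx r *m row_ebase A.
pose t := eta / (fnorm X + 1).
have f0 := fnorm_ge0 X.
have t0 : 0 < t by apply: divr_gt0 => //; lra.
have tn0 : t%:K != 0 :> C by rewrite fmorph_eq0 lt0r_neq0.
exists (A + t%:K *: X); last first.
  rewrite addrC addKr fnormZR gtr0_norm // /t mulrAC ler_pdivrMr; last by lra.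
  by rewrite ler_pM2l //; lra.
have -> : A + t%:K *: X =
    col_ebase A *m (pid_mx r + t%:K *: copid_mx r) *m row_ebase A.
  by rewrite mulmxDr mulmxDl -{1}(mulmx_ebase A) -scalemxAr -scalemxAl.
rewrite !unitmx_mul col_ebase_unit row_ebase_unit andbT.
have : (pid_mx r + t%:K *: copid_mx r) *m
       (pid_mx r + (t%:K)^-1 *: copid_mx r) = 1%:M :> 'M[C]_n.
  have rn : (r <= n)%N by exact: rank_leq_row.
  rewrite mulmxDl !mulmxDr -!scalemxAl -!scalemxAr !pid_mx_id //.
  rewrite mul_pid_mx_copid // mul_copid_mx_pid // copid_mx_id //.
  by rewrite !scaler0 addr0 add0r scalerA divff // scale1r /copid_mx addrC subrK.
by case/mulmx1_unit => -> _.
Qed.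

Lemma fnorm_sqr_rows m n (A : 'M[C]_(m, n)) :
  fnorm A ^+ 2 = \sum_i fnorm (row i A) ^+ 2.
Proof.
rewrite fnorm_sqrE; apply: eq_bigr => i _; rewrite fnorm_sqrE big_ord1.
by apply: eq_bigr => j _; rewrite mxE.
Qed.

Lemma fnormM m n p (A : 'M[C]_(m, n)) (B : 'M[C]_(n, p)) :
  fnorm (A *m B) <= fnorm A * fnorm B.
Proof.
rewrite -(ler_pXn2r (n := 2)) ?nnegrE ?mulr_ge0 ?fnorm_ge0 //.
rewrite exprMn -(fnorm_trC B) fnorm_sqrE !fnorm_sqr_rows mulr_suml.
apply: ler_sum => i _; rewrite mulr_sumr; apply: ler_sum => j _.
rewrite -exprMn ler_pXn2r ?nnegrE ?mulr_ge0 ?fnorm_ge0 ?nrm_ge0 //.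
suff -> : (A *m B) i j = ip (row i A) (row j (B^t*)) by exact: cauchy_ip.
rewrite ipE big_ord1 mxE; apply: eq_bigr => k _.
by rewrite !mxE conjCK.
Qed.

(** The invertible case extends by density; [eta] pays for the perturbation. *)
Lemma polar_approx n (A : 'M[C]_n) (eta : R) : 0 < eta ->
  exists2 U : 'M[C]_n, U \is unitarymx &
    fnorm (U - A) <= fnorm (A *m A^t* - 1%:M) + eta.
Proof.
move=> eta0; have f0 := fnorm_ge0 A.
pose k : R := 2 + 2 * fnorm A.
have k0 : 0 < k by rewrite /k; lra.
(* Moving [A] by [e] moves A A^* by at most k e, and [A] itself by e: together (k + 1) e <= eta. The
   bound e <= 1 keeps the norm of [A'] below that of [A] plus 1. *)
pose e := Num.min 1 (eta / (k + 1)).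
have e0 : 0 < e by rewrite lt_min ltr01 divr_gt0 //; lra.
have e1 : e <= 1 by rewrite ge_min lexx.
have eeta : e * (k + 1) <= eta.
  by rewrite -ler_pdivlMr ?ge_min ?lexx ?orbT //; lra.
have [A' A'u A'A] := unit_approx A e0.
have [U Uu UA] := polar_unit A'u; exists U => //.
apply: le_trans (fnorm_dist A' _ _) _.
have H : fnorm (A' *m A'^t* - 1%:M) <=
    fnorm (A *m A^t* - 1%:M) + fnorm (A' *m A'^t* - A *m A^t*).
  have := fnorm_dist (A *m A^t*) (A' *m A'^t*) 1%:M; lra.
suff : fnorm (A' *m A'^t* - A *m A^t*) <= k * e.
  by rewrite mulrDr mulr1 mulrC in eeta; lra.
set D := A' - A.
have -> : A' *m A'^t* - A *m A^t* = D *m A'^t* + A *m D^t*.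
  by rewrite /D trmxCB mulmxBl mulmxBr addrA subrK.
have D'A : fnorm A' <= fnorm A + 1.
  rewrite -[A'](subrK A) addrC; apply: le_trans (fnormD _ _) _.
  by rewrite lerD2l (le_trans A'A).
apply: le_trans (fnormD _ _) _.
have := fnormM D (A'^t*); have := fnormM A (D^t*); rewrite !fnorm_trC => H1 H2.
have : fnorm D * fnorm A' <= e * (fnorm A + 1) by apply: ler_pM; rewrite ?fnorm_ge0.
have : fnorm A * fnorm D <= fnorm A * e by rewrite ler_wpM2l.
by rewrite /k; lra.
Qed.

End Spectral.

(** * Spectral cut-offs and top eigenvectors *)

Section Coisometry.
Variables (R : realType) (C : complexes R).

(** Rounding the spectrum at 1/2: the rows of [e] are the eigenvectors with eigenvalue at least 1/2.
    Rounding an eigenvalue t to 0 or 1 in this way costs at most 2 |t (t - 1)|. *)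
Lemma near_projection n (h : 'M[C]_n) : h^t* = h ->
  exists r (e : 'M[C]_(r, n)),
    e *m e^t* = 1%:M /\ fnorm (e^t* *m e - h) <= 2 * fnorm (h *m h - h).
Proof.
move=> /spectral_herm [V [t [Vu hE]]]; have [VV VV'] := uniP Vu.
pose I := [pred i | 2^-1 <= t i].
pose e : 'M[C]_(#|I|, n) := rowsub (@enum_val _ I) V.
exists #|I|, e; split.
  apply/matrixP => i j; rewrite !mxE.
  have := congr1 (fun M : 'M[C]_n => M (enum_val i) (enum_val j)) VV.
  rewrite !mxE (inj_eq enum_val_inj) => <-.
  by apply: eq_bigr => k _; rewrite !mxE.
have -> : e^t* *m e = V^t* *m dg C (fun i => (I i)%:R) *m V.
  apply/matrixP => i j; rewrite !mxE.
  transitivity (\sum_(k in I) (V k i)^* * V k j).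
    by rewrite [RHS]big_enum_val; apply: eq_bigr => k _; rewrite !mxE.
  rewrite big_mkcond; apply: eq_bigr => k _.
  rewrite !mxE (bigD1 k) //= big1 => [|l lk]; last first.
    by rewrite !(mxE, dgE) (negPf lk) mulr0n mulr0.
  rewrite !(mxE, dgE) eqxx mulr1n addr0 inE; case: ifP => _.
    by rewrite rmorph1 mulr1.
  by rewrite rmorph0 mulr0 mul0r.
have -> : h *m h - h = V^t* *m dg C (fun i => t i * t i - t i) *m V.
  have -> : h *m h = V^t* *m (dg C t *m dg C t) *m V.
    by rewrite {1 2}hE -!mulmxA (mulmxA V) VV mul1mx.
  by rewrite [X in _ - X]hE -mulmxBl -mulmxBr dgM dgB.
rewrite [X in _ - X]hE -mulmxBl -mulmxBr dgB !fnorm_conjV //.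
apply: fnorm_dg_le => // i; rewrite /I /=.
rewrite (_ : t i * t i - t i = t i * (t i - 1)); last by ring.
rewrite normrM mulrA; case: (leP 2^-1 (t i)) => ti.
  rewrite distrC ler_peMl ?normr_ge0 // ger0_norm; lra.
rewrite sub0r normrN mulrAC ler_peMl ?normr_ge0 // distrC ger0_norm; lra.
Qed.

(** A perturbation of size 1/20 of a rank one projection keeps one eigenvalue above 9/10, while the
    form of [T] stays below 1/5 on the orthogonal complement of its eigenvector. The last clause is
    this gap in quantitative form. *)
Lemma top_eigenvector n (T : 'M[C]_n) (v : 'rV[C]_n) : T^t* = T -> fnorm v = 1 ->
  fnorm (T - v^t* *m v) <= 20^-1 ->
  exists (xi : 'rV[C]_n) (t : R),
    [/\ fnorm xi = 1, 2^-1 <= t, xi *m T = t%:K *: xi &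
        forall f : 'rV[C]_n, ip f xi = 0 ->
          fnorm f <= 2 * fnorm (f *m T - t%:K *: f)].
Proof.
move=> /spectral_herm [V [t [Vu TE]]] v1 Tv; have [VV VV'] := uniP Vu.
set E := T - v^t* *m v.
have TvE (x : 'rV[C]_n) :
    re (ip (x *m T) x) = nrm (ip x v) ^+ 2 + re (ip (x *m E) x).
  rewrite (_ : T = v^t* *m v + E); last by rewrite /E addrC subrK.
  have xv : x *m v^t* = (ip x v)%:M by rewrite ipT trace_mx11 -mx11_scalar.
  rewrite mulmxDr ipDl reD mulmxA xv mul_scalar_mx ipZl -(ip_conj x v).
  by rewrite mulconj re_toC.
have cE (x : 'rV[C]_n) : `|re (ip (x *m E) x)| <= 20^-1 * fnorm x ^+ 2.
  apply: le_trans (re_le_nrm _) _; apply: le_trans (cauchy_ip _ _) _.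
  rewrite expr2 mulrA ler_wpM2r ?fnorm_ge0 //; apply: le_trans (fnormM _ _) _.
  by rewrite mulrC ler_wpM2r ?fnorm_ge0.
have rowV i j : ip (row i V) (row j V) = (i == j)%:R.
  have := congr1 (fun M : 'M[C]_n => M i j) VV; rewrite !mxE => <-.
  by rewrite ipE big_ord1; apply: eq_bigr => k _; rewrite !mxE.
have rowT i : row i V *m T = (t i)%:K *: row i V.
  rewrite TE !mulmxA -!row_mul VV mul1mx.
  apply/rowP => j; rewrite !mxE (bigD1 i) //= big1 => [|k ki].
    by rewrite dgE eqxx mulr1n addr0.
  by rewrite dgE eq_sym (negPf ki) mulr0n mul0r.
(* Otherwise the form of [T] at [v] would be at most 9/10, whereas it is at least 1 - 1/20. *)
have [i ti] : exists i, 9 / 10 <= t i.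
  apply: contrapT => /forallNP H.
  have H' i : t i <= 9 / 10 by have /negP := H i; rewrite -ltNge => /ltW.
  have : re (ip (v *m T) v) <= 9 / 10 * fnorm v ^+ 2.
    pose w := v *m V^t*.
    have -> : ip (v *m T) v = ip (w *m dg C t) w.
      by rewrite !ipT TE /w trmxCM trmxCK !mulmxA.
    rewrite -(fnorm_mulr v (U := V^t*)) ?trmxCK // -/w fnorm_sqrE big_ord1.
    rewrite ipE big_ord1 re_sum mulr_sumr; apply: ler_sum => j _.
    rewrite mxE (bigD1 j) //= big1 => [|k kj]; last first.
      by rewrite dgE (negPf kj) mulr0n mulr0.
    rewrite dgE eqxx mulr1n addr0 -mulrA mulrCA mulconj reZ re_toC.
    by rewrite ler_wpM2r ?sqr_ge0.
  rewrite TvE v1 ip_fn nrm_toC v1; have := cE v; rewrite v1 !expr1n normr1 ?expr1n.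
  by rewrite ler_norml => /andP[H1 H2] H3; clear -H1 H2 H3; lra.
have xi1 : fnorm (row i V) = 1.
  apply/eqP; rewrite -(eqrXn2 (n := 2)) ?fnorm_ge0 // fnorm_sqr rowV eqxx expr1n.
  by rewrite re1.
exists (row i V), (t i); split=> //; first by lra.
move=> f fxi; have := rowT i; set xi := row i V in xi1 fxi * => xiT.
have xiv : 17 / 20 <= nrm (ip xi v) ^+ 2.
  have := TvE xi; rewrite xiT ipZl ip_fn xi1 expr1n reZ re_toC mulr1.
  by have := cE xi; rewrite xi1 expr1n ler_norml => /andP[? ?]; lra.
(* Since [f] is orthogonal to [xi], it only sees the component [u] of [v] orthogonal to [xi], whose
   squared norm is at most 1 - 17/20. *)
have fv : nrm (ip f v) ^+ 2 <= 3 / 20 * fnorm f ^+ 2.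
  pose u := v - (ip v xi) *: xi.
  have -> : ip f v = ip f u by rewrite /u ipBr ipZr fxi mulr0 subr0.
  have uu : fnorm u ^+ 2 <= 3 / 20.
    have := fnormD_sqr v (- ((ip v xi) *: xi)).
    rewrite -/u fnormN ipNr ipZr [_^* * _]mulrC mulconj reN re_toC fnormZ xi1 v1 mulr1 => ->.
    by rewrite expr1n; move: xiv; rewrite -ip_conj nrm_conj; lra.
  have /(lerXn2r 2) := cauchy_ip f u.
  rewrite !nnegrE mulr_ge0 ?fnorm_ge0 ?nrm_ge0 // => /(_ isT isT) H.
  by apply: le_trans H _; rewrite exprMn mulrC ler_wpM2r ?sqr_ge0.
(* The constant is 9/10 - (3/20 + 1/20). *)
have H1 : 7 / 10 * fnorm f ^+ 2 <= re (ip ((t i)%:K *: f - f *m T) f).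
  rewrite ipBl ipZl reB reZ -fnorm_sqr TvE.
  have := cE f; rewrite ler_norml => /andP[_ ?].
  have := ler_wpM2r (sqr_ge0 (fnorm f)) ti; lra.
have := cauchy_re ((t i)%:K *: f - f *m T) f; rewrite fnormBC => H2.
have [f0|f0] := eqVneq (fnorm f) 0; first by rewrite f0 mulr_ge0 ?fnorm_ge0.
have f1 : 0 < fnorm f by rewrite lt_def f0 fnorm_ge0.
rewrite -(ler_pM2r f1) -expr2 -mulrA.
have := sqr_ge0 (fnorm f); lra.
Qed.
End Coisometry.

(** * Tensor squares *)

Section TensorSquare.
Variables (R : realType) (C : complexes R).

Definition tsq m n (A : 'M[C]_(m, n)) : 'M[C]_(m * m, n * n) :=
  A *t map_mx Num.conj A.

Lemma tsqM m n p (A : 'M[C]_(m, n)) (B : 'M[C]_(n, p)) :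
  tsq (A *m B) = tsq A *m tsq B.
Proof. by rewrite /tsq tensmx_mul map_mxM. Qed.

Lemma tsq_tr m n (A : 'M[C]_(m, n)) : tsq (A^t*) = (tsq A)^t*.
Proof. by rewrite /tsq trmxC_tens -map_trmx. Qed.

Lemma tsq1 n : tsq (1%:M : 'M[C]_n) = 1%:M.
Proof.
rewrite /tsq map_mx1; apply/matrixP => i j.
case: (mxtens_indexP i) => i1 i2; case: (mxtens_indexP j) => j1 j2.
rewrite tensmxE !mxE (inj_eq (can_inj (@mxtens_indexK n n))) xpair_eqE.
by rewrite -natrM mulnb.
Qed.

Lemma tsqZ m n a (A : 'M[C]_(m, n)) : tsq (a *: A) = (nrm a ^+ 2)%:K *: tsq A.
Proof.
apply/matrixP => i j; rewrite /tsq !mxE rmorphM -mulconj /=.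
by rewrite mulrACA.
Qed.

Lemma fnorm_conj m n (A : 'M[C]_(m, n)) : fnorm (map_mx Num.conj A) = fnorm A.
Proof.
apply/eqP; rewrite -(eqrXn2 (n := 2)) ?fnorm_ge0 //; apply/eqP.
rewrite !fnorm_sqrE; apply: eq_bigr => i _; apply: eq_bigr => j _.
by rewrite mxE nrm_conj.
Qed.

Lemma fnorm_tsq m n (A : 'M[C]_(m, n)) : fnorm (tsq A) = fnorm A ^+ 2.
Proof. by rewrite /tsq fnorm_tens fnorm_conj. Qed.

Lemma fnorm_tsqB m n (A B : 'M[C]_(m, n)) :
  fnorm (tsq A - tsq B) <= fnorm (A - B) * (fnorm A + fnorm B).
Proof.
have -> : tsq A - tsq B =
    (A - B) *t map_mx Num.conj A + B *t map_mx Num.conj (A - B).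
  by apply/matrixP => i j; rewrite /tsq !mxE rmorphB; ring.
apply: le_trans (fnormD _ _) _; rewrite !fnorm_tens !fnorm_conj.
by rewrite mulrDr (mulrC (fnorm B)).
Qed.

Lemma tr_tens m n (A : 'M[C]_m) (B : 'M[C]_n) : \tr (A *t B) = \tr A * \tr B.
Proof. by rewrite /mxtrace mulr_sum; apply: eq_bigr => i _; rewrite mxE. Qed.

Lemma ip_tsq m n (A B : 'M[C]_(m, n)) :
  ip (tsq A) (tsq B) = ip A B * (ip A B)^*.
Proof.
rewrite !ipT -tsq_tr -tsqM /tsq tr_tens; congr (_ * _).
by rewrite trace_map_mx.
Qed.

Lemma ip_mxvec m n (A B : 'M[C]_(m, n)) : ip (mxvec A) (mxvec B) = ip A B.
Proof.
rewrite !ipE big_ord1 pair_bigA /=.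
rewrite (reindex _ (curry_mxvec_bij m n)) /=.
by apply: eq_bigr => -[i j] _; rewrite !mxvecE.
Qed.

Definition outer n (x : 'rV[C]_n) : 'M[C]_n := x^t* *m x.

Lemma ip_outer n (x y : 'rV[C]_n) :
  ip (outer x) (outer y) = ip x y * (ip x y)^*.
Proof.
have e (a b : 'rV[C]_n) : a *m b^t* = (ip a b)%:M.
  by rewrite ipT trace_mx11 -mx11_scalar.
rewrite ipT /outer trmxCM trmxCK -mulmxA (mulmxA x) e mul_scalar_mx.
rewrite -scalemxAr mxtraceZ mxtrace_mulC e mxtrace_scalar mulr1n.
by rewrite ip_conj.
Qed.

(** The norm of a linear combination depends only on the coefficients and the Gram matrix, even when
    the two families live in different matrix spaces. *)
Lemma fnorm_gram (I : Type) (r : seq I) (c : I -> C) m n m' n'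
    (X : I -> 'M[C]_(m, n)) (Y : I -> 'M[C]_(m', n')) :
  (forall i j, ip (X i) (X j) = ip (Y i) (Y j)) ->
  fnorm (\sum_(i <- r) c i *: X i) = fnorm (\sum_(i <- r) c i *: Y i).
Proof.
move=> XY; apply: fnorm_eqP; congr re; rewrite !ip_suml; apply: eq_bigr => i _.
by rewrite !ip_sumr; apply: eq_bigr => j _; rewrite !ipZl !ipZr XY.
Qed.

(* Both families have the Gram matrix [|ip (X i) (X j)|^2], which ignores the
   phases of the [X i]. *)
Lemma fnorm_tsq_outer (I : Type) (r : seq I) (c : I -> C) m n
    (X : I -> 'M[C]_(m, n)) :
  fnorm (\sum_(i <- r) c i *: tsq (X i)) =
  fnorm (\sum_(i <- r) c i *: outer (mxvec (X i))).
Proof. by apply: fnorm_gram => i j; rewrite ip_tsq ip_outer ip_mxvec. Qed.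

Lemma outer_tr n (x : 'rV[C]_n) : (outer x)^t* = outer x.
Proof. by rewrite /outer trmxCM trmxCK. Qed.

Lemma outerZ n a (x : 'rV[C]_n) : outer (a *: x) = (nrm a ^+ 2)%:K *: outer x.
Proof.
by rewrite /outer trmxCZ -scalemxAl -scalemxAr scalerA mulrC mulconj.
Qed.

Lemma mul_outer n (x y : 'rV[C]_n) : y *m outer x = ip y x *: x.
Proof.
by rewrite /outer mulmxA [y *m _]mx11_scalar mul_scalar_mx ipT trace_mx11.
Qed.

End TensorSquare.

(** * Random walks and the spectral gap *)

Section Walk.
Variables (R : realType) (C : complexes R) (G : groupType).

Definition urep n (W : G -> 'M[C]_n) : Prop :=
  (forall g, W g \is unitarymx) /\ forall g h, W (g * h)%g = W g *m W h.

Lemma urep1 n (W : G -> 'M[C]_n) : urep W -> W 1%g = 1%:M.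
Proof.
move=> [Wu WM]; have [_ H] := uniP (Wu 1%g).
by rewrite -[W 1%g]mul1mx -{1}H -mulmxA -WM mulg1 H.
Qed.

Lemma urepV n (W : G -> 'M[C]_n) g : urep W -> W (g^-1)%g = (W g)^t*.
Proof.
move=> Wr; have [Wu WM] := Wr; have [_ H] := uniP (Wu g).
by rewrite -[LHS]mul1mx -H -mulmxA -WM mulgV urep1 // mulmx1.
Qed.

Definition spectral_gap (S : seq G) (lambda : R) : Prop :=
  forall n (W : G -> 'M[C]_n), urep W -> forall t : R, 0 < t < lambda ->
    ~~ eigenvalue (1%:M - (size S)%:R^-1 *: \sum_(s <- S) W s) t%:K.

Variables (S : seq G) (lambda : R).
Hypotheses (S_uniq : uniq S) (S_sym : forall s, s \in S -> (s^-1)%g \in S).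
Hypotheses (lambda_gt0 : 0 < lambda) (S_gap : spectral_gap S lambda).

(** The gap of 1 - (1/q) sum W(s) is a gap [mu] for the Laplacian L = sum (1 - W(s)), whose spectrum
    lies in [0, 2q]. With c = 2q + 1 the step 1 - L/c is a positive contraction, and c > 0 even if
    [S] is empty, where [mu] defaults to 1. The cap mu <= 1 guarantees mu <= c. *)
Let q : R := (size S)%:R.
Let c : R := 2 * q + 1.
Let mu : R := Num.min 1 (if S is [::] then 1 else lambda * q).

Let q0 : 0 <= q. Proof. exact: ler0n. Qed.
Let c0 : 0 < c. Proof. by have := q0; rewrite /c; lra. Qed.
Let mu0 : 0 < mu.
Proof.
by rewrite lt_min ltr01 /q; case: S => //= s S'; rewrite mulr_gt0 ?ltr0n.
Qed.

Definition laplacian n (W : G -> 'M[C]_n) : 'M[C]_n :=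
  \sum_(s <- S) (1%:M - W s).
Definition step n (W : G -> 'M[C]_n) : 'M[C]_n :=
  1%:M - (c^-1)%:K *: laplacian W.

Lemma laplacianE n (W : G -> 'M[C]_n) :
  laplacian W = q%:K *: 1%:M - \sum_(s <- S) W s.
Proof.
rewrite /laplacian sumrB; congr (_ - _).
by rewrite big_const_seq count_predT iter_addr_0 /q rmorph_nat scaler_nat.
Qed.

Lemma laplacian_tr n (W : G -> 'M[C]_n) : urep W ->
  (laplacian W)^t* = laplacian W.
Proof.
move=> Wr; rewrite laplacianE trmxCB trmxCZ trmxC1 conj_toC trmxC_sum.
congr (_ - _); under eq_bigr do rewrite -urepV //.
rewrite -(big_map (fun s => s^-1)%g predT W); apply: perm_big.
apply: uniq_perm => //; first by rewrite map_inj_uniq //; apply: invg_inj.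
move=> x; apply/mapP/idP => [[y yS ->]|xS]; first exact: S_sym.
by exists (x^-1)%g; rewrite ?invgK ?S_sym.
Qed.

(** The Dirichlet form of the walk: it makes the Laplacian positive, and bounds each single
    displacement by [y] by the Laplacian. *)
Lemma laplacian_form n (W : G -> 'M[C]_n) (y : 'rV[C]_n) : urep W ->
  \sum_(s <- S) fnorm (y - y *m W s) ^+ 2 = 2 * re (ip (y *m laplacian W) y).
Proof.
move=> [Wu _]; rewrite /laplacian mulmx_sumr ip_suml re_sum mulr_sumr.
apply: eq_bigr => s _; have [WW _] := uniP (Wu s).
rewrite mulmxBr mulmx1 ipBl reB -fnorm_sqr fnormD_sqr fnormN ipNr reN fnorm_mulr //.
by rewrite -(ip_conj y) re_conj; ring.
Qed.

Lemma laplacian_le n (W : G -> 'M[C]_n) (y : 'rV[C]_n) : urep W ->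
  fnorm (y *m laplacian W) <= 2 * q * fnorm y.
Proof.
move=> [Wu _]; rewrite /laplacian mulmx_sumr; apply: le_trans (fnorm_sum _ _ _) _.
under eq_bigr do rewrite mulmxBr.
have -> : 2 * q * fnorm y = \sum_(s <- S) (2 * fnorm y).
  by rewrite big_const_seq count_predT iter_addr_0 -[RHS]mulr_natr /q mulrAC.
apply: ler_sum => s _; have [WW _] := uniP (Wu s).
by apply: le_trans (fnormB _ _) _; rewrite mulmx1 fnorm_mulr //; lra.
Qed.

Lemma fnorm_mul_dg_le m n k (x : 'M[C]_(m, n)) (s t : 'I_n -> R) : 0 <= k ->
  (forall i, `|s i| <= k * `|t i|) -> fnorm (x *m dg C s) <= k * fnorm (x *m dg C t).
Proof.
move=> k0 H; rewrite -(ler_pXn2r (n := 2)) ?nnegrE ?mulr_ge0 ?fnorm_ge0 //.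
have e (u : 'I_n -> R) i j : nrm ((x *m dg C u) i j) = nrm (x i j) * `|u j|.
  rewrite mxE (bigD1 j) //= big1 => [|l lj]; last first.
    by rewrite dgE (negPf lj) mulr0n mulr0.
  by rewrite dgE eqxx mulr1n addr0 nrmM nrm_toC.
rewrite exprMn !fnorm_sqrE mulr_sumr; apply: ler_sum => i _.
rewrite mulr_sumr; apply: ler_sum => j _; rewrite !e -exprMn.
rewrite ler_pXn2r ?nnegrE ?mulr_ge0 ?nrm_ge0 ?normr_ge0 //.
by rewrite mulrCA ler_wpM2l ?nrm_ge0.
Qed.

(** Positivity comes from the Dirichlet form, the bound 2q from the norm. An eigenvalue in (0, mu)
    would, divided by q, be an eigenvalue forbidden by the gap. *)
Lemma laplacian_spectrum n (W : G -> 'M[C]_n) : urep W ->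
  exists (V : 'M[C]_n) (t : 'I_n -> R),
    [/\ V \is unitarymx, laplacian W = V^t* *m dg C t *m V &
        forall i, t i = 0 \/ mu <= t i <= 2 * q].
Proof.
move=> Wr; have [V [t [Vu LE]]] := spectral_herm (laplacian_tr Wr).
exists V, t; split=> // i; have [VV VV'] := uniP Vu.
have rowL : row i V *m laplacian W = (t i)%:K *: row i V.
  rewrite LE !mulmxA -!row_mul VV mul1mx.
  apply/rowP => j; rewrite !mxE (bigD1 i) //= big1 => [|k ki].
    by rewrite dgE eqxx mulr1n addr0.
  by rewrite dgE eq_sym (negPf ki) mulr0n mul0r.
have row1 : ip (row i V) (row i V) = 1.
  have := congr1 (fun M : 'M[C]_n => M i i) VV; rewrite !mxE eqxx mulr1n => <-.
  by rewrite ipE big_ord1; apply: eq_bigr => k _; rewrite !mxE.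
have tE : re (ip (row i V *m laplacian W) (row i V)) = t i.
  by rewrite rowL ipZl row1 reZ re1 mulr1.
have t0 : 0 <= t i.
  have := laplacian_form (row i V) Wr; rewrite tE => H.
  have : 0 <= \sum_(s <- S) fnorm (row i V - row i V *m W s) ^+ 2.
    by apply: sumr_ge0 => s _; exact: sqr_ge0.
  by rewrite H; lra.
have f1 : fnorm (row i V) = 1.
  by apply/eqP; rewrite -(eqrXn2 (n := 2)) ?fnorm_ge0 // fnorm_sqr row1 re1 expr1n.
have t2 : t i <= 2 * q.
  have := laplacian_le (row i V) Wr.
  by rewrite rowL fnormZ nrm_toC f1 !mulr1 ger0_norm.
have [->|tn0] := eqVneq (t i) 0; [by left|right].
rewrite t2 andbT leNgt; apply/negP => tmu.
have tp : 0 < t i by rewrite lt_def tn0.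
have qp : 0 < q by lra.
move: tmu; rewrite lt_min => /andP[_ tl].
have tq : 0 < t i / q < lambda.
  rewrite divr_gt0 //= ltr_pdivrMr //; move: tl qp; rewrite /q.
  by case: S => //=; rewrite ltxx.
apply/negP: (S_gap Wr tq); rewrite negbK.
apply/eigenvalueP; exists (row i V); last first.
  by apply/eqP => v0; move: f1; rewrite v0 fnorm0 => /eqP; rewrite eq_sym oner_eq0.
have -> : 1%:M - (size S)%:R^-1 *: \sum_(s <- S) W s =
    (q^-1)%:K *: laplacian W.
  rewrite laplacianE scalerBr scalerA -rmorphM /= mulVf ?lt0r_neq0 //.
  by rewrite (rmorph1 (toC C)) scale1r /q fmorphV rmorph_nat.
by rewrite -scalemxAr rowL scalerA -rmorphM mulrC.
Qed.

Definition walk_vec n (W : G -> 'M[C]_n) k (y : 'rV[C]_n) : 'rV[C]_n :=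
  iter k (fun z => z *m step W) y.

Let damp (t : R) : R := 1 - c^-1 * t.
Let r : R := damp mu.

Let damp_bounds t : 0 <= t <= 2 * q -> 0 <= damp t <= 1.
Proof.
move=> /andP[t0 t2]; rewrite /damp subr_ge0 lerBlDr lerDl.
rewrite mulr_ge0 ?invr_ge0 ?(ltW c0) // andbT mulrC ler_pdivrMr // mul1r.
by rewrite /c; lra.
Qed.

Let r_bounds : 0 <= r < 1.
Proof.
have q0' := q0; have c0' := c0; have mu0' := mu0.
have mu1 : mu <= 1 by rewrite ge_min lexx.
rewrite /r /damp subr_ge0 ltrBlDr ltrDl mulr_gt0 ?invr_gt0 // andbT.
by rewrite mulrC ler_pdivrMr // mul1r /c; lra.
Qed.

Section Spectrum.
Variables (n : nat) (W : G -> 'M[C]_n) (y : 'rV[C]_n) (k : nat).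
Hypothesis Wr : urep W.
Variables (V : 'M[C]_n) (t : 'I_n -> R).
Hypothesis Vu : V \is unitarymx.
Hypothesis LE : laplacian W = V^t* *m dg C t *m V.
Hypothesis tP : forall i, t i = 0 \/ mu <= t i <= 2 * q.

Lemma walk_vec_diag :
  walk_vec W k y = y *m V^t* *m dg C (fun i => damp (t i) ^+ k) *m V.
Proof.
have [VV VV'] := uniP Vu.
have stepE : step W = V^t* *m dg C (fun i => damp (t i)) *m V.
  have -> : dg C (fun i => damp (t i)) = 1%:M - (c^-1)%:K *: dg C t.
    by rewrite dgZ -dg1 dgB.
  rewrite mulmxBr mulmxBl mulmx1 VV' -scalemxAr -scalemxAl -LE.
  by [].
elim: k => [|m IH] /=.
  have -> : dg C (fun i : 'I_n => damp (t i) ^+ 0) = 1%:M by rewrite -dg1.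
  by rewrite mulmx1 -mulmxA VV' mulmx1.
rewrite IH stepE !mulmxA -[_ *m V *m V^t*]mulmxA VV mulmx1.
congr (_ *m V); rewrite -mulmxA dgM; congr (_ *m dg C _).
by apply/funext => i; rewrite exprSr.
Qed.

Let bounds i : 0 <= damp (t i) <= 1.
Proof.
apply: damp_bounds; case: (tP i) => [->|/andP[H ->]].
  by rewrite lexx mulr_ge0 ?q0.
by rewrite andbT (le_trans (ltW mu0)).
Qed.

Let fnormV (x : 'rV[C]_n) : fnorm (x *m V) = fnorm x.
Proof. by have [VV _] := uniP Vu; rewrite fnorm_mulr. Qed.

Let fny : fnorm (y *m V^t* *m dg C (fun=> 1)) = fnorm y.
Proof.
by have [VV VV'] := uniP Vu; rewrite dg1 mulmx1 fnorm_mulr // trmxCK.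
Qed.

(** On the spectrum, |1 - damp(t)^k| is 0 at t = 0 and at most 1 <= t/mu elsewhere. The bound does
    not depend on [k]: the walk can be run as long as desired without drifting away from an almost
    invariant vector. *)
Lemma walk_vec_near_diag :
  fnorm (y - walk_vec W k y) <= mu^-1 * fnorm (y *m laplacian W).
Proof.
have [VV VV'] := uniP Vu; rewrite walk_vec_diag LE !mulmxA fnormV.
have {1}-> : y = y *m V^t* *m dg C (fun=> 1) *m V.
  by rewrite dg1 mulmx1 -mulmxA VV' mulmx1.
rewrite -mulmxBl -mulmxBr dgB fnormV.
apply: fnorm_mul_dg_le => [|i]; first by rewrite invr_ge0 ltW ?mu0.
have /andP[b0 b1] := bounds i; have p0 := exprn_ge0 k b0.
have p1 : damp (t i) ^+ k <= 1 by apply: exprn_ile1.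
case: (tP i) => [->|/andP[H _]].
  by rewrite /damp mulr0 subr0 expr1n subrr normr0 mulr0.
rewrite ger0_norm ?subr_ge0 // ger0_norm; last by rewrite (le_trans (ltW mu0)).
apply: (@le_trans _ _ 1); first by rewrite gerBl.
by rewrite mulrC ler_pdivlMr ?mu0 // mul1r.
Qed.

Lemma walk_vec_le_diag : fnorm (walk_vec W k y) <= fnorm y.
Proof.
rewrite walk_vec_diag fnormV -[leRHS]mul1r -fny.
apply: fnorm_mul_dg_le => // i; rewrite mul1r normr1.
have /andP[b0 b1] := bounds i.
by rewrite ger0_norm ?exprn_ge0 // exprn_ile1.
Qed.

(** Away from t = 0 one has t >= mu, so each step contracts by at least r = damp(mu) < 1. *)
Lemma walk_vec_flat_diag :
  fnorm (walk_vec W k y *m laplacian W) <= 2 * q * r ^+ k * fnorm y.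
Proof.
have [VV VV'] := uniP Vu; have /andP[r0 _] := r_bounds.
rewrite walk_vec_diag LE !mulmxA -[_ *m V *m V^t*]mulmxA VV mulmx1 fnormV.
rewrite -(mulmxA _ (dg C _)) dgM -fny.
have K0 : 0 <= 2 * q * r ^+ k.
  by rewrite mulr_ge0 ?exprn_ge0 // mulr_ge0 ?q0.
apply: fnorm_mul_dg_le => // i; rewrite normr1 mulr1.
have /andP[b0 b1] := bounds i.
case: (tP i) => [->|/andP[H H2]]; first by rewrite mulr0 normr0.
have ti0 : 0 <= t i by rewrite (le_trans (ltW mu0)).
rewrite ger0_norm ?mulr_ge0 ?exprn_ge0 // mulrC.
apply: ler_pM; rewrite ?exprn_ge0 //.
rewrite lerXn2r ?nnegrE // /r /damp lerD2l lerN2 ler_wpM2l //.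
by rewrite invr_ge0 ltW ?c0.
Qed.

End Spectrum.

Lemma walk_vec_near n (W : G -> 'M[C]_n) y k : urep W ->
  fnorm (y - walk_vec W k y) <= mu^-1 * \sum_(s <- S) fnorm (y - y *m W s).
Proof.
move=> Wr; have [V [t [Vu LE tP]]] := laplacian_spectrum Wr.
apply: le_trans (walk_vec_near_diag y k Vu LE tP) _.
rewrite ler_wpM2l ?invr_ge0 ?(ltW mu0) // /laplacian mulmx_sumr.
apply: le_trans (fnorm_sum _ _ _) _; apply: ler_sum => s _.
by rewrite mulmxBr mulmx1.
Qed.

Lemma walk_vec_le n (W : G -> 'M[C]_n) y k : urep W ->
  fnorm (walk_vec W k y) <= fnorm y.
Proof.
move=> Wr; have [V [t [Vu LE tP]]] := laplacian_spectrum Wr.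
exact: walk_vec_le_diag Vu LE tP.
Qed.

Lemma walk_vec_step n (W : G -> 'M[C]_n) y k s : urep W -> s \in S ->
  fnorm (walk_vec W k y - walk_vec W k y *m W s) ^+ 2 <= 4 * q * r ^+ k * fnorm y ^+ 2.
Proof.
move=> Wr sS; have [V [t [Vu LE tP]]] := laplacian_spectrum Wr.
set z := walk_vec W k y.
have H1 : fnorm (z - z *m W s) ^+ 2 <= 2 * re (ip (z *m laplacian W) z).
  rewrite -laplacian_form // (big_rem s) //= lerDl.
  by apply: sumr_ge0 => u _; exact: sqr_ge0.
have H2 := cauchy_re (z *m laplacian W) z.
have H3 := walk_vec_flat_diag y k Vu LE tP; rewrite -/z in H3.
have H4 := walk_vec_le y k Wr; rewrite -/z in H4.
have H5 : fnorm (z *m laplacian W) * fnorm z <= (2 * q * r ^+ k * fnorm y) * fnorm y.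
  by apply: ler_pM; rewrite ?fnorm_ge0.
by lra.
Qed.

Lemma expr_small (e : R) : 0 < e -> exists k0, forall k, (k0 <= k)%N -> r ^+ k <= e.
Proof.
move=> e0; have /andP[r0 r1] := r_bounds.
have := @cvg_expr R r; rewrite ger0_norm // => /(_ r1) r_cvg.
have [k0 _ H] := (cvgrPdist_le _ _).1 r_cvg e e0; exists k0 => k kk; have := H k kk.
by rewrite sub0r normrN ger0_norm // exprn_ge0.
Qed.

Hypothesis S_gen : forall P : G -> Prop, P 1%g ->
  (forall x z, P x -> P z -> P (x * z)%g) -> (forall x, P x -> P (x^-1)%g) ->
  (forall s, s \in S -> P s) -> forall g, P g.

Lemma walk_vec_invariant g (eta : R) : 0 < eta ->
  exists k0, forall k, (k0 <= k)%N -> forall n (W : G -> 'M[C]_n) y, urep W ->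
    fnorm (walk_vec W k y - walk_vec W k y *m W g) <= eta * fnorm y.
Proof.
move: g eta; apply: S_gen.
- move=> eta eta0; exists 0%N => k _ n W y Wr.
  by rewrite urep1 // mulmx1 subrr fnorm0 mulr_ge0 ?fnorm_ge0 // ltW.
- move=> g h IHg IHh eta eta0.
  have e2 : 0 < eta / 2 by lra.
  have [k1 H1] := IHg _ e2; have [k2 H2] := IHh _ e2.
  exists (maxn k1 k2) => k; rewrite geq_max => /andP[kk1 kk2] n W y Wr.
  have := H1 k kk1 n W y Wr; have := H2 k kk2 n W y Wr.
  set z := walk_vec W k y => Hh Hg; have [Wu WM] := Wr.
  apply: le_trans (fnorm_dist (z *m W h) _ _) _.
  rewrite WM mulmxA -mulmxBl fnorm_mulr; last by have [] := uniP (Wu h).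
  by lra.
- move=> g IH eta eta0; have [k0 H] := IH _ eta0.
  exists k0 => k kk n W y Wr; have := H k kk n W y Wr.
  set z := walk_vec W k y; have [Wu WM] := Wr.
  have [WW _] := uniP (Wu g).
  rewrite -[in fnorm (z - z *m W (g^-1)%g)](fnorm_mulr _ WW) mulmxBl -mulmxA -WM.
  by rewrite mulVg urep1 // mulmx1 fnormBC.
move=> s sS eta eta0.
have q0' := q0.
(* Chosen so that 4 q r^k <= 2 c r^k <= eta^2. *)
have d0 : 0 < eta ^+ 2 / c by rewrite divr_gt0 ?exprn_gt0 ?c0.
have [k0 H] := expr_small (divr_gt0 d0 (ltr0n _ 2)).
exists k0 => k kk n W y Wr.
rewrite -(ler_pXn2r (n := 2)) ?nnegrE ?mulr_ge0 ?fnorm_ge0 ?(ltW eta0) //.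
apply: le_trans (walk_vec_step y k Wr sS) _; rewrite exprMn.
rewrite ler_wpM2r ?sqr_ge0 //.
have Hk := H k kk; rewrite ler_pdivlMr ?ltr0n // in Hk.
have : c * (r ^+ k * 2) <= eta ^+ 2 by rewrite mulrC -ler_pdivlMr ?c0.
have /andP[r0 _] := r_bounds; have := exprn_ge0 k r0.
by rewrite /c; lra.
Qed.

(** The operator 1 - L/c read as a probability law: mass 1/c on each generator and the rest at the
    identity. Laws are weighted lists; entries with equal group elements are not merged. *)
Definition walk1 : seq (R * G) := (1 - c^-1 * q, 1%g) :: [seq (c^-1, s) | s <- S].

Fixpoint walk k : seq (R * G) :=
  if k is m.+1 then [seq (x.1 * z.1, (x.2 * z.2)%g) | x <- walk m, z <- walk1]
  else [:: (1, 1%g)].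

Lemma walkS k : walk k.+1 =
  [seq (x.1 * z.1, (x.2 * z.2)%g) | x <- walk k, z <- walk1].
Proof. by []. Qed.

Lemma walk_ge0 k x : x \in walk k -> 0 <= x.1.
Proof.
elim: k x => [|k IH] x; first by rewrite inE => /eqP ->.
rewrite walkS => /allpairsP[[a b] /= [aw bw ->]] /=; rewrite mulr_ge0 ?(IH _ aw) //.
move: bw; rewrite inE => /orP[/eqP -> /=|/mapP[s _ -> /=]].
  by rewrite subr_ge0 mulrC ler_pdivrMr ?c0 // mul1r /c; have := q0; lra.
by rewrite invr_ge0 ltW ?c0.
Qed.

Lemma walk_sum k : \sum_(x <- walk k) x.1 = 1.
Proof.
elim: k => [|k IH]; first by rewrite big_seq1.
rewrite walkS big_allpairs_dep /=.
under eq_bigr => x _ do rewrite -mulr_sumr.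
rewrite -mulr_suml IH mul1r big_cons big_map /= big_const_seq count_predT.
by rewrite iter_addr_0 -[X in _ + X]mulr_natr subrK.
Qed.

Lemma walkE n (W : G -> 'M[C]_n) k y : urep W ->
  \sum_(x <- walk k) (x.1)%:K *: (y *m W x.2) = walk_vec W k y.
Proof.
move=> Wr; have [Wu WM] := Wr; elim: k => [|k IH].
  by rewrite big_seq1 /= urep1 // mulmx1 rmorph1 scale1r.
rewrite walkS big_allpairs_dep /= -IH mulmx_suml; apply: eq_bigr => x _.
rewrite -scalemxAl.
transitivity ((x.1)%:K *: \sum_(z <- walk1) (z.1)%:K *: (y *m W x.2 *m W z.2)).
  by rewrite scaler_sumr; apply: eq_bigr => z _; rewrite scalerA rmorphM WM mulmxA.
congr (_ *: _); rewrite big_cons big_map /= urep1 // mulmx1 -scaler_sumr.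
rewrite /step mulmxBr mulmx1 -scalemxAr laplacianE mulmxBr -scalemxAr mulmx1.
rewrite scalerBr scalerA opprB addrA mulmx_sumr rmorphB rmorphM rmorph1.
by rewrite scalerBl scale1r addrAC.
Qed.

End Walk.

(** * Approximate characters *)

Section ApproximateCharacters.
Variables (R : realType) (C : complexes R) (G : groupType).

(** The lower bound 1/2 on [F] is what allows division by the values of [chi]. *)
Definition approx_char (F : seq G) (eta : R) (chi : G -> C) : Prop :=
  [/\ forall x, nrm (chi x) <= 1,
      forall x, x \in F -> 2^-1 <= nrm (chi x) &
      forall x y, x \in F -> y \in F ->
        nrm (chi (x * y)%g - chi x * chi y) <= eta].

Lemma approx_charW F F' eta eta' chi : {subset F' <= F} -> eta <= eta' ->
  approx_char F eta chi -> approx_char F' eta' chi.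
Proof.
move=> sF ee [H1 H2 H3]; split=> // [x /sF|x y /sF xF /sF yF]; first exact: H2.
exact: le_trans (H3 x y xF yF) ee.
Qed.

(** The value at 1 is almost idempotent, and its modulus is at least 1/2. *)
Lemma approx_char1 F eta chi : 1%g \in F -> approx_char F eta chi ->
  nrm (chi 1%g - 1) <= 2 * eta.
Proof.
move=> F1 [_ H2 H3]; have := H3 _ _ F1 F1; rewrite mulg1.
have -> : chi 1%g - chi 1%g * chi 1%g = - (chi 1%g * (chi 1%g - 1)) by ring.
rewrite nrmN nrmM; have := H2 _ F1; have := nrm_ge0 (chi 1%g - 1); nra.
Qed.

(** Formulated for a single element so that these elements form a subgroup; the commutator subgroup,
    being the smallest one containing the commutators, is then covered without writing its elements
    as products. *)
Definition forced_trivial (x : G) : Prop := forall eta : R, 0 < eta ->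
  exists (F : seq G) (eta' : R), 0 < eta' /\
    forall chi, approx_char F eta' chi -> nrm (chi x - 1) <= eta.

Lemma forced_trivial_subgroup : is_subgroup forced_trivial.
Proof.
split.
- move=> eta eta0; exists [:: 1%g], (eta / 2); split; first by lra.
  move=> chi H; have := approx_char1 _ H; rewrite inE eqxx => /(_ isT); lra.
- move=> x y Hx Hy eta eta0; have e3 : 0 < eta / 3 by lra.
  have [Fx [ex [ex0 HFx]]] := Hx _ e3; have [Fy [ey [ey0 HFy]]] := Hy _ e3.
  exists (x :: y :: Fx ++ Fy), (Num.min (eta / 3) (Num.min ex ey)).
  split; first by rewrite !lt_min e3 ex0.
  move=> chi H; have Hchi := H.
  have cx : nrm (chi x - 1) <= eta / 3.
    apply: HFx; apply: approx_charW H => [z zF|].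
      by rewrite !inE mem_cat zF !orbT.
    by rewrite !ge_min lexx orbT.
  have cy : nrm (chi y - 1) <= eta / 3.
    apply: HFy; apply: approx_charW H => [z zF|].
      by rewrite !inE mem_cat zF !orbT.
    by rewrite !ge_min lexx !orbT.
  have [H1 _ /(_ x y)] := Hchi; rewrite !inE !eqxx orbT => /(_ isT isT).
  rewrite le_min => /andP[cxy _].
  have -> : chi (x * y)%g - 1 = (chi (x * y)%g - chi x * chi y) +
     ((chi x - 1) * chi y + (chi y - 1)) by ring.
  have HB : nrm ((chi x - 1) * chi y) <= eta / 3.
    by rewrite nrmM; have := H1 y; have := nrm_ge0 (chi x - 1); nra.
  apply: le_trans (nrmD _ _) _; have := nrmD ((chi x - 1) * chi y) (chi y - 1).
  by lra.
- move=> x Hx eta eta0; have e4 : 0 < eta / 4 by lra.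
  have [Fx [ex [ex0 HFx]]] := Hx _ e4.
  exists (1%g :: x :: (x^-1)%g :: Fx), (Num.min (eta / 4) ex).
  split; first by rewrite !lt_min e4 ex0.
  move=> chi H; have Hchi := H.
  have cx : nrm (chi x - 1) <= eta / 4.
    apply: HFx; apply: approx_charW H => [z zF|].
      by rewrite !inE zF !orbT.
    by rewrite !ge_min lexx orbT.
  have c1 : nrm (chi 1%g - 1) <= 2 * (eta / 4).
    apply: (@approx_char1 [:: 1%g]); first by rewrite inE.
    apply: approx_charW H => [z|]; last by rewrite !ge_min lexx.
    by rewrite !inE => /eqP ->; rewrite eqxx.
  have [H1 _ /(_ (x^-1)%g x)] := Hchi; rewrite !inE !eqxx !orbT => /(_ isT isT).
  rewrite le_min mulVg => /andP[cxV _].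
  have -> : chi (x^-1)%g - 1 = - (chi (x^-1)%g * (chi x - 1)) -
     ((chi 1%g - chi (x^-1)%g * chi x) - (chi 1%g - 1)) by ring.
  have HB : nrm (chi (x^-1)%g * (chi x - 1)) <= eta / 4.
    by rewrite nrmM; have := H1 (x^-1)%g; have := nrm_ge0 (chi x - 1); nra.
  apply: le_trans (nrmD _ _) _; rewrite !nrmN.
  have := nrmD (chi 1%g - chi (x^-1)%g * chi x) (- (chi 1%g - 1)).
  by rewrite nrmN; lra.
Qed.

(** Apply [chi] to y x [x, y] = x y: since the values of [chi] commute, chi(x) chi(y) (chi([x, y]) -
    1) is at most three errors, and the factor in front has modulus at least 1/4. Hence the 12. *)
Lemma forced_trivial_comm x y : forced_trivial [~ x, y]%g.
Proof.
move=> eta eta0; exists [:: x; y; (y * x)%g; [~ x, y]%g], (eta / 12).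
split=> [|chi [H1 H2 H3]]; first by lra.
have comm : (y * x * [~ x, y])%g = (x * y)%g.
  by rewrite commgEl conjgE -!mulgA !mulVKg.
have := H3 x y; have := H3 y x; have := H3 (y * x)%g [~ x, y]%g.
rewrite comm !inE !eqxx !orbT => /(_ isT isT) Ha /(_ isT isT) Hb /(_ isT isT) Hc.
have := H2 x; have := H2 y; rewrite !inE !eqxx !orbT => /(_ isT) cy /(_ isT) cx.
set c := chi [~ x, y]%g in Ha *.
have : nrm (chi x * chi y * (c - 1)) <= 3 * (eta / 12).
  have -> : chi x * chi y * (c - 1) =
     (chi (x * y)%g - chi x * chi y) - ((chi (x * y)%g - chi (y * x)%g * c) +
     (chi (y * x)%g - chi y * chi x) * c) by ring.
  apply: le_trans (nrmD _ _) _; rewrite nrmN.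
  have := nrmD (chi (x * y)%g - chi (y * x)%g * c)
     ((chi (y * x)%g - chi y * chi x) * c).
  have : nrm ((chi (y * x)%g - chi y * chi x) * c) <= eta / 12.
    rewrite nrmM; have := H1 [~ x, y]%g; rewrite -/c.
    by have := nrm_ge0 (chi (y * x)%g - chi y * chi x); nra.
  by lra.
rewrite !nrmM => H; have c0 := nrm_ge0 (c - 1).
have xy : 4^-1 <= nrm (chi x) * nrm (chi y) by nra.
by nra.
Qed.

Lemma commutator_forced_trivial x : commutator_set x -> forced_trivial x.
Proof.
move=> /(_ forced_trivial); apply; split; first exact: forced_trivial_subgroup.
by move=> _ [y [z ->]]; apply: forced_trivial_comm.
Qed.

End ApproximateCharacters.

(** * The approximate character of an almost representation *)

Section Sandwich.
Variables (R : realType) (C : complexes R).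

(** The matrix of X |-> P X Q on vectorized matrices, so that statements about row vectors apply to
    spaces of matrices. *)
Definition sandwich m n (P : 'M[C]_m) (Q : 'M[C]_n) : 'M[C]_(m * n) :=
  lin_mx (mulmxr Q \o mulmx P).

Lemma mxvec_sandwich m n P Q (X : 'M[C]_(m, n)) :
  mxvec X *m sandwich P Q = mxvec (P *m X *m Q).
Proof. by rewrite /sandwich mul_vec_lin. Qed.

Lemma fnorm_mxvec m n (X : 'M[C]_(m, n)) : fnorm (mxvec X) = fnorm X.
Proof. by apply: fnorm_eqP; rewrite ip_mxvec. Qed.

Lemma rowmx_ext m n (A B : 'M[C]_(m, n)) :
  (forall u : 'rV[C]_m, u *m A = u *m B) -> A = B.
Proof. by move=> AB; apply/row_matrixP => i; rewrite !rowE. Qed.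

Lemma sandwichM m n (P P' : 'M[C]_m) (Q Q' : 'M[C]_n) :
  sandwich P Q *m sandwich P' Q' = sandwich (P' *m P) (Q *m Q').
Proof.
apply: rowmx_ext => u; rewrite -(vec_mxK u) mulmxA !mxvec_sandwich.
by rewrite !mulmxA.
Qed.

Lemma sandwich_unitary m n (P : 'M[C]_m) (Q : 'M[C]_n) :
  P \is unitarymx -> Q \is unitarymx -> sandwich P Q \is unitarymx.
Proof.
move=> /uniP[PP PP'] /uniP[QQ QQ']; apply/unitarymxP/matrixP => i k.
have ipS (u v : 'rV[C]_(m * n)) :
    ip (u *m sandwich P Q) (v *m sandwich P Q) = ip u v.
  rewrite -(vec_mxK u) -(vec_mxK v) !mxvec_sandwich !ip_mxvec !ipT.
  rewrite !trmxCM !mulmxA -[_ *m Q *m Q^t*]mulmxA QQ mulmx1.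
  by rewrite mxtrace_mulC !mulmxA PP' mul1mx.
have e (A : 'M[C]_(m * n)) : (A *m A^t*) i k = ip (row i A) (row k A).
  by rewrite ipE big_ord1 mxE; apply: eq_bigr => l _; rewrite !mxE.
have := ipS (delta_mx 0 i) (delta_mx 0 k); rewrite -!rowE -e => ->.
by rewrite -[delta_mx 0 i]mulmx1 -[delta_mx 0 k]mulmx1 -!rowE -e trmxC1 mulmx1.
Qed.

(** Row vectors are acted on from the right, so the left factor of a product is applied first; the
    adjoint of [tau] restores the order of multiplication. *)
Lemma sandwich_urep (G : groupType) m n (tau : G -> 'M[C]_m) (om : G -> 'M[C]_n) :
  urep tau -> urep om -> urep (fun g => sandwich ((tau g)^t*) (om g)).
Proof.
move=> [tu tM] [ou oM]; split=> [g|g h].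
  by rewrite sandwich_unitary // trmxC_unitary.
by rewrite sandwichM tM oM trmxCM.
Qed.

Lemma tsq_unitary n (U : 'M[C]_n) : U \is unitarymx -> tsq U \is unitarymx.
Proof.
by move=> /unitarymxP UU; apply/unitarymxP; rewrite -tsq_tr -tsqM UU tsq1.
Qed.

Lemma tsq_urep (G : groupType) n (rho : G -> 'M[C]_n) : urep rho ->
  urep (fun g => tsq (rho g)).
Proof.
by move=> [ru rM]; split=> [g|g h]; rewrite ?tsq_unitary // rM tsqM.
Qed.

(** Both families are joined over the disjoint sum of their index types, with the coefficients of
    the second negated. *)
Lemma fnorm_tsq_outerB (I I' : Type) (r : seq I) (r' : seq I') c c' m n
    (X : I -> 'M[C]_(m, n)) (X' : I' -> 'M[C]_(m, n)) :
  fnorm (\sum_(i <- r) c i *: tsq (X i) - \sum_(i <- r') c' i *: tsq (X' i)) =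
  fnorm (\sum_(i <- r) c i *: outer (mxvec (X i)) -
      \sum_(i <- r') c' i *: outer (mxvec (X' i))).
Proof.
pose cc k := match k with inl i => c i | inr i => - c' i end.
pose XX k := match k with inl i => X i | inr i => X' i end.
have := fnorm_tsq_outer (map inl r ++ map inr r') cc XX.
rewrite !big_cat !big_map /=.
under [X in fnorm (_ + X) = _]eq_bigr do rewrite scaleNr.
under [X in _ = fnorm (_ + X)]eq_bigr do rewrite scaleNr.
by rewrite !sumrN.
Qed.

Lemma fnorm_convex (I : eqType) (r : seq I) (c : I -> R) m n
    (X : I -> 'M[C]_(m, n)) (e : R) :
  (forall i, i \in r -> 0 <= c i) -> \sum_(i <- r) c i = 1 ->
  (forall i, i \in r -> fnorm (X i) <= e) ->
  fnorm (\sum_(i <- r) (c i)%:K *: X i) <= e.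
Proof.
move=> c0 c1 H; apply: le_trans (fnorm_sum _ _ _) _.
rewrite -[leRHS]mul1r -c1 mulr_suml !big_seq; apply: ler_sum => i ir.
by rewrite fnormZR ger0_norm ?c0 // ler_wpM2l ?c0 ?H.
Qed.

Lemma fnorm_convexB (I : eqType) (r : seq I) (c : I -> R) m n
    (X Y : I -> 'M[C]_(m, n)) (e : R) :
  (forall i, i \in r -> 0 <= c i) -> \sum_(i <- r) c i = 1 ->
  (forall i, i \in r -> fnorm (X i - Y i) <= e) ->
  fnorm (\sum_(i <- r) (c i)%:K *: X i - \sum_(i <- r) (c i)%:K *: Y i) <= e.
Proof.
move=> c0 c1 H; rewrite -sumrB; under eq_bigr do rewrite -scalerBr.
exact: fnorm_convex.
Qed.

End Sandwich.

(** * The orbit of the coisometry and its average over the random walk *)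

Section Local.
Variables (R : realType) (C : complexes R) (Gt G : groupType).
Variables (p : Gt -> G) (s : G -> Gt).

Variables (d D D' : nat) (pi : Gt -> 'M[C]_d) (rho : G -> 'M[C]_D).
Variables (tau : G -> 'M[C]_D') (j : 'M[C]_(d, D)) (j2 : 'M[C]_(d * d, D')).
Hypotheses (d_gt0 : (0 < d)%N) (pi_u : forall x, pi x \is unitarymx).
Hypotheses (rho_r : urep rho) (tau_r : urep tau).
Hypotheses (jj : j *m j^t* = 1%:M) (jj2 : j2 *m j2^t* = 1%:M).

Let sd : R := Num.sqrt d%:R.
Let sd0 : 0 < sd. Proof. by rewrite sqrtr_gt0 ltr0n. Qed.
Let sd2 : sd * sd = d%:R. Proof. by rewrite -expr2 sqr_sqrtr ?ler0n. Qed.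

Definition act x (X : 'M[C]_(d, D)) : 'M[C]_(d, D) :=
  (pi x)^t* *m X *m rho (p x).
Definition orb g : 'M[C]_(d, D) := (pi (s g))^t* *m j *m rho g.

Let rr g : rho g *m (rho g)^t* = 1%:M.
Proof. by have [ru _] := rho_r; have [] := uniP (ru g). Qed.
Let ppp x : (pi x)^t* *m pi x = 1%:M.
Proof. by have [] := uniP (pi_u x). Qed.
Let pppC x : ((pi x)^t*)^t* *m (pi x)^t* = 1%:M.
Proof. by rewrite trmxCK; have [] := uniP (pi_u x). Qed.

Lemma fnorm_act x X : fnorm (act x X) = fnorm X.
Proof. by rewrite /act fnorm_mulr // fnorm_mull. Qed.

Lemma fnorm_mul_orb (A : 'M[C]_d) g : fnorm (A *m orb g) = fnorm A.
Proof.
rewrite /orb !mulmxA fnorm_mulr // fnorm_mulr // fnorm_mulr //.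
by rewrite trmxCK ppp.
Qed.

Lemma fnorm_orb g : fnorm (orb g) = sd.
Proof. by rewrite -[orb g]mul1mx fnorm_mul_orb fnorm1. Qed.

(* Genuine counterpart of [tsq (orb g)]: [corb] is an orbit of the representation
   [Y |-> tau^* Y (rho (x) conj rho)], to which the spectral gap applies. *)
Definition corb g : 'M[C]_(D', D * D) :=
  (tau g)^t* *m (j2^t* *m tsq j) *m tsq (rho g).

(** The adjoint of the intertwining relation for [tau] is multiplied on the right by the coisometry
    tsq(j) and a unitary, which preserves the norm. *)
Lemma corb_near (e : R) g :
  fnorm (j2 *m tau g - tsq (pi (s g)) *m j2) <= e * d%:R ->
  fnorm (corb g - j2^t* *m tsq (orb g)) <= e * d%:R.
Proof.
rewrite -[X in X <= _ -> _]fnorm_trC trmxCB !trmxCM => H.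
have -> : corb g - j2^t* *m tsq (orb g) =
    ((tau g)^t* *m j2^t* - j2^t* *m (tsq (pi (s g)))^t*) *m tsq j *m tsq (rho g).
  by rewrite /corb /orb !tsqM tsq_tr !mulmxBl !mulmxA.
by rewrite fnorm_mulr ?fnorm_mulr // -tsq_tr -tsqM ?jj ?rr tsq1.
Qed.

Lemma fnorm_j2 m (X : 'M[C]_(d * d, m)) : fnorm (j2^t* *m X) = fnorm X.
Proof. by rewrite fnorm_mull // trmxCK jj2. Qed.

Lemma orb_near (e : R) g : fnorm (j *m rho g - pi (s g) *m j) <= e ->
  fnorm (orb g - j) <= e.
Proof.
have -> : orb g - j = (pi (s g))^t* *m (j *m rho g - pi (s g) *m j).
  by rewrite mulmxBr /orb !mulmxA ppp mul1mx.
by rewrite fnorm_mull.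
Qed.

Lemma tsq_orbB (e : R) (X Y : 'M[C]_(d, D)) : fnorm X = sd -> fnorm Y = sd ->
  fnorm (X - Y) <= e * sd -> fnorm (tsq X - tsq Y) <= 2 * e * d%:R.
Proof.
move=> X1 Y1 H; apply: le_trans (fnorm_tsqB _ _) _; rewrite X1 Y1 -sd2.
have := sd0; nra.
Qed.

Lemma fnorm_corb1 : fnorm (corb 1%g) = d%:R.
Proof.
rewrite /corb !urep1 // ?trmxC1 ?mul1mx ?tsq1 ?mulmx1.
by rewrite fnorm_j2 fnorm_tsq fnorm_coiso // sqr_sqrtr ?ler0n.
Qed.

Variables (S F : seq G) (Ft : seq Gt) (l : seq (R * G)).
(** [e0] and [e1] are the errors of [rho] and [tau], [ec] that of [pi] along the section up to
    phases, [eta] the defect of invariance of the walk, and [kap] the resulting defect of the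
    averaged orbit. *)
Variables (K0 e0 e1 eta ec kap : R).

Hypotheses (l_ge0 : forall x, x \in l -> 0 <= x.1) (l_sum : \sum_(x <- l) x.1 = 1).
Hypothesis l_near : forall n (W : G -> 'M[C]_n) (y : 'rV[C]_n), urep W ->
  fnorm (y - \sum_(x <- l) (x.1)%:K *: (y *m W x.2)) <=
    K0 * \sum_(g <- S) fnorm (y - y *m W g).
Hypothesis l_flat : forall n (W : G -> 'M[C]_n) (y : 'rV[C]_n) g, urep W ->
  g \in F -> fnorm (\sum_(x <- l) (x.1)%:K *: (y *m W (x.2 * g)%g) -
                 \sum_(x <- l) (x.1)%:K *: (y *m W x.2)) <= eta * fnorm y.
Hypothesis K0_ge0 : 0 <= K0.
Hypothesis Ft_F : forall x, x \in Ft -> p x \in F.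
Hypothesis rho_near : forall g, g \in 1%g :: S ->
  fnorm (j *m rho g - pi (s g) *m j) <= e0 * sd.
Hypothesis tau_near : forall g,
  g \in 1%g :: S \/ (exists2 x, x \in l & g = x.2 \/
                     exists2 y, y \in Ft & g = (x.2 * p y)%g) ->
  fnorm (j2 *m tau g - tsq (pi (s g)) *m j2) <= e1 * d%:R.
Hypothesis pi_cocycle : forall x y, x \in l -> y \in Ft ->
  exists2 c : C, nrm c = 1 &
    fnorm (pi (s x.2) *m pi y - c *: pi (s (x.2 * p y)%g)) <= ec * sd.
Hypothesis small1 : K0 * (size S)%:R * (2 * e1 + 4 * e0) + 2 * e1 <= 20^-1.
Hypothesis kapE : eta + 2 * e1 + 2 * ec <= kap.

Let comb m n (X : G -> 'M[C]_(m, n)) : 'M[C]_(m, n) :=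
  \sum_(x <- l) (x.1)%:K *: X x.2.

Let tau1 : fnorm (corb 1%g - j2^t* *m tsq (orb 1%g)) <= e1 * d%:R.
Proof. by apply: corb_near; apply: tau_near; left; rewrite inE eqxx. Qed.

(** The orbit moves by at most 2 e0 under a generator, which doubles in the tensor square; each of
    the two passages to the genuine orbit costs e1. *)
Lemma corb_gen g : g \in S ->
  fnorm (corb 1%g - corb g) <= (2 * e1 + 4 * e0) * d%:R.
Proof.
move=> gS.
have taug : fnorm (corb g - j2^t* *m tsq (orb g)) <= e1 * d%:R.
  by apply: corb_near; apply: tau_near; left; rewrite inE gS orbT.
have o1 := orb_near (rho_near (mem_head 1%g S)).
have gS' : g \in 1%g :: S by rewrite inE gS orbT.
have og := orb_near (rho_near gS').
have o1g : fnorm (orb 1%g - orb g) <= (2 * e0) * sd.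
  by have := fnorm_dist j (orb 1%g) (orb g); rewrite (fnormBC j); lra.
have := tsq_orbB (fnorm_orb 1%g) (fnorm_orb g) o1g.
rewrite -fnorm_j2 mulmxBr => H.
have := fnorm_dist (j2^t* *m tsq (orb 1%g)) (corb 1%g) (corb g).
have := fnorm_dist (j2^t* *m tsq (orb g)) (j2^t* *m tsq (orb 1%g)) (corb g).
rewrite (fnormBC (j2^t* *m tsq (orb g)) (corb g)); have := tau1; lra.
Qed.

Let W g := sandwich ((tau g)^t*) (tsq (rho g)).
Let Wr : urep W. Proof. by apply: sandwich_urep => //; apply: tsq_urep. Qed.
Let y0 := mxvec (j2^t* *m tsq j).

Let yW g : y0 *m W g = mxvec (corb g).
Proof. by rewrite /y0 /W mxvec_sandwich. Qed.

Let y0E : y0 = mxvec (corb 1%g).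
Proof. by rewrite -yW urep1 // mulmx1. Qed.

Let comb_mxvec m n (X : G -> 'M[C]_(m, n)) :
  \sum_(x <- l) (x.1)%:K *: mxvec (X x.2) = mxvec (comb X).
Proof. by rewrite /comb linear_sum; apply: eq_bigr => x _; rewrite linearZ. Qed.

Lemma corb_near_comb : fnorm (corb 1%g - comb corb) <=
  K0 * (size S)%:R * (2 * e1 + 4 * e0) * d%:R.
Proof.
have := l_near y0 Wr; under eq_bigr do rewrite yW.
rewrite comb_mxvec y0E -linearB fnorm_mxvec => H; apply: le_trans H _.
rewrite -!mulrA ler_wpM2l //.
have -> : (size S)%:R * ((2 * e1 + 4 * e0) * d%:R) =
    \sum_(g <- S) ((2 * e1 + 4 * e0) * d%:R).
  by rewrite big_const_seq count_predT iter_addr_0 -[RHS]mulr_natr mulrC.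
rewrite !big_seq; apply: ler_sum => g gS.
by rewrite -y0E yW y0E -linearB fnorm_mxvec corb_gen.
Qed.

Lemma corb_flat g : g \in F ->
  fnorm (comb (fun h => corb (h * g)%g) - comb corb) <= eta * d%:R.
Proof.
move=> gF; have := l_flat y0 Wr gF.
under [X in fnorm (X - _)]eq_bigr do rewrite yW.
under [X in fnorm (_ - X)]eq_bigr do rewrite yW.
rewrite comb_mxvec (comb_mxvec (fun h => corb (h * g)%g)) -linearB fnorm_mxvec.
by rewrite y0E fnorm_mxvec fnorm_corb1.
Qed.

Let corb_l x : x \in l -> fnorm (corb x.2 - j2^t* *m tsq (orb x.2)) <= e1 * d%:R.
Proof. by move=> xl; apply: corb_near; apply: tau_near; right; exists x; auto. Qed.

Let corb_lF x y : x \in l -> y \in Ft ->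
  fnorm (corb (x.2 * p y)%g - j2^t* *m tsq (orb (x.2 * p y)%g)) <= e1 * d%:R.
Proof.
move=> xl yF; apply: corb_near; apply: tau_near; right; exists x => //.
by right; exists y.
Qed.

Let comb_j2 m (X : G -> 'M[C]_(d * d, m)) :
  comb (fun g => j2^t* *m X g) = j2^t* *m comb X.
Proof. by rewrite /comb mulmx_sumr; apply: eq_bigr => x _; rewrite scalemxAr. Qed.

(** The spectral gap applies only to the genuine orbit [corb]. As [j2^t*] preserves norms, the
    estimate is transferred there and back at a cost of e1 each way. *)
Lemma comb_orb_near : fnorm (comb (fun g => tsq (orb g)) - tsq (orb 1%g)) <= d%:R / 20.
Proof.
rewrite -fnorm_j2 mulmxBr -comb_j2.
have H1 := corb_near_comb.
have H2 : fnorm (comb corb - comb (fun g => j2^t* *m tsq (orb g))) <= e1 * d%:R.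
  by apply: fnorm_convexB.
have H3 := tau1; set A := comb _; set B := j2^t* *m _.
have H4 := fnorm_dist (comb corb) A B; have H5 := fnorm_dist (corb 1%g) (comb corb) B.
rewrite (fnormBC A (comb corb)) in H4; rewrite (fnormBC (comb corb) (corb 1%g)) in H5.
have : (K0 * (size S)%:R * (2 * e1 + 4 * e0) + 2 * e1) * d%:R <= 20^-1 * d%:R.
  by rewrite ler_wpM2r ?ler0n.
by rewrite -/A in H2; rewrite -/B in H3; lra.
Qed.

(** [act y] sends [orb g] to [orb (g * p y)] up to a phase and an error; the phase disappears in the
    tensor square. What remains is a right translation of the walk, under which its average is
    almost invariant. *)
Lemma comb_orb_flat y : y \in Ft ->
  fnorm (comb (fun g => tsq (act y (orb g))) - comb (fun g => tsq (orb g))) <=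
  kap * d%:R.
Proof.
move=> yF; set A := comb _; set B := comb _.
pose A' := comb (fun g => tsq (orb (g * p y)%g)).
have H1 : fnorm (A - A') <= 2 * ec * d%:R.
  apply: fnorm_convexB => // x xl.
  have [c c1 H] := pi_cocycle xl yF.
  have -> : tsq (orb (x.2 * p y)%g) = tsq (c^* *: orb (x.2 * p y)%g).
    by rewrite tsqZ nrm_conj c1 expr1n rmorph1 scale1r.
  apply: tsq_orbB; rewrite ?fnorm_act ?fnormZ ?nrm_conj ?c1 ?mul1r ?fnorm_orb //.
  rewrite -fnorm_trC in H.
  have -> : act y (orb x.2) - c^* *: orb (x.2 * p y)%g =
      (pi (s x.2) *m pi y - c *: pi (s (x.2 * p y)%g))^t* *m j *m rho (x.2 * p y)%g.
    have [_ rM] := rho_r.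
    rewrite trmxCB trmxCM trmxCZ /act /orb !mulmxBl rM !mulmxA.
    by rewrite -!scalemxAl.
  by rewrite fnorm_mulr // fnorm_mulr.
have H2 : fnorm (comb (fun h => corb (h * p y)%g) - j2^t* *m A') <= e1 * d%:R.
  by rewrite -comb_j2; apply: fnorm_convexB => // x xl; apply: corb_lF.
have H3 : fnorm (comb corb - j2^t* *m B) <= e1 * d%:R.
  by rewrite -comb_j2; apply: fnorm_convexB.
have H4 := corb_flat (Ft_F yF).
have H5 : fnorm (A' - B) <= (eta + 2 * e1) * d%:R.
  rewrite -fnorm_j2 mulmxBr; set U := comb (fun h => _) in H2 H4.
  have := fnorm_dist U (j2^t* *m A') (j2^t* *m B).
  have := fnorm_dist (comb corb) U (j2^t* *m B).
  by rewrite (fnormBC (j2^t* *m A') U); lra.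
have := fnorm_dist A' A B.
have : (eta + 2 * e1 + 2 * ec) * d%:R <= kap * d%:R by rewrite ler_wpM2r ?ler0n.
by lra.
Qed.

End Local.

(** * From an almost invariant average to an approximate character *)

Section Eigencharacter.
Variables (R : realType) (C : complexes R) (Gt G : groupType) (p : Gt -> G).
Hypothesis pM : forall x y, p (x * y)%g = (p x * p y)%g.
Variables (d D : nat) (pi : Gt -> 'M[C]_d) (rho : G -> 'M[C]_D).
Hypotheses (d_gt0 : (0 < d)%N) (pi_u : forall x, pi x \is unitarymx).
Hypothesis rho_r : urep rho.

Let sd : R := Num.sqrt d%:R.
Let sd0 : 0 < sd. Proof. by rewrite sqrtr_gt0 ltr0n. Qed.
Let sd2 : sd * sd = d%:R. Proof. by rewrite -expr2 sqr_sqrtr ?ler0n. Qed.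

Variables (I : eqType) (l : seq I) (c : I -> R) (v : I -> 'M[C]_(d, D)).
Variables (v0 : 'M[C]_(d, D)) (Ft : seq Gt) (z : Gt) (zeta : C) (del kap : R).
Hypotheses (c_ge0 : forall i, i \in l -> 0 <= c i) (c_sum : \sum_(i <- l) c i = 1).
Hypothesis fnorm_mul_v : forall i (A : 'M[C]_d), fnorm (A *m v i) = fnorm A.
Hypothesis fnorm_v0 : fnorm v0 = sd.
Hypothesis v_near : fnorm (\sum_(i <- l) (c i)%:K *: tsq (v i) - tsq v0) <= d%:R / 20.
Hypothesis v_flat : forall y, y \in Ft ->
  fnorm (\sum_(i <- l) (c i)%:K *: tsq (act p pi rho y (v i)) -
      \sum_(i <- l) (c i)%:K *: tsq (v i)) <= kap * d%:R.
Hypothesis pi_mul : forall x y, x \in Ft -> y \in Ft ->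
  fnorm (pi (x * y)%g - pi x *m pi y) <= del * sd.
Hypothesis pi_z : fnorm (pi z - zeta%:M) <= del * sd.
Hypothesis p_z : p z = 1%g.
Hypothesis kap4 : kap <= 4^-1.

Let u (X : 'M[C]_(d, D)) : 'rV[C]_(d * D) := (sd^-1)%:K *: mxvec X.
Let A y : 'M[C]_(d * D) := sandwich ((pi y)^t*) (rho (p y)).
Let T : 'M[C]_(d * D) := \sum_(i <- l) (c i)%:K *: outer (u (v i)).

Let A_u y : A y \is unitarymx.
Proof.
by have [ru _] := rho_r; apply: sandwich_unitary; rewrite ?trmxC_unitary.
Qed.

Let outer_u X : outer (u X) = (d%:R^-1)%:K *: outer (mxvec X).
Proof.
by rewrite /u outerZ nrm_toC real_normK ?num_real // exprVn expr2 sd2.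
Qed.

Let sum_u (X : I -> 'M[C]_(d, D)) :
  \sum_(i <- l) (c i)%:K *: outer (u (X i)) =
  (d%:R^-1)%:K *: \sum_(i <- l) (c i)%:K *: outer (mxvec (X i)).
Proof.
rewrite scaler_sumr; apply: eq_bigr => i _.
by rewrite outer_u !scalerA mulrC.
Qed.

Let dV (X : 'M[C]_(d * D)) e : fnorm X <= e * d%:R ->
  fnorm ((d%:R^-1)%:K *: X) <= e.
Proof.
move=> H; rewrite fnormZR ger0_norm ?invr_ge0 ?ler0n //.
by rewrite mulrC ler_pdivrMr ?ltr0n.
Qed.

(** The hypothesis concerns tensor squares; equality of the Gram matrices turns it into the same
    bound for rank one operators, here normalized to unit vectors. *)
Lemma orbit_average_near : fnorm (T - outer (u v0)) <= 20^-1.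
Proof.
rewrite /T sum_u outer_u -scalerBr; apply: dV.
have := v_near.
have {1}-> : tsq v0 = \sum_(i <- [:: tt]) 1 *: tsq v0.
  by rewrite big_seq1 scale1r.
rewrite fnorm_tsq_outerB big_seq1 scale1r mulrC; apply: le_trans.
by [].
Qed.

Lemma orbit_average_flat y : y \in Ft -> fnorm ((A y)^t* *m T *m A y - T) <= kap.
Proof.
move=> yF; have -> : (A y)^t* *m T *m A y =
    \sum_(i <- l) (c i)%:K *: outer (u (act p pi rho y (v i))).
  rewrite /T mulmx_sumr mulmx_suml; apply: eq_bigr => i _.
  rewrite -scalemxAr -scalemxAl; congr (_ *: _).
  rewrite /u /act -mxvec_sandwich -/(A y) scalemxAl /outer trmxCM.
  by rewrite !mulmxA.
have H := v_flat yF; rewrite fnorm_tsq_outerB in H.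
by rewrite /T (sum_u v) (sum_u (fun i => act p pi rho y (v i))) -scalerBr; exact: dV H.
Qed.

Lemma orbit_average_tr : T^t* = T.
Proof.
rewrite /T trmxC_sum; apply: eq_bigr => i _.
by rewrite trmxCZ conj_toC outer_tr.
Qed.

Lemma eigencharacter : exists chi : Gt -> C,
  approx_char Ft (2 * del + 2 * kap) chi /\
  nrm (chi z - zeta^* ) <= 2 * del.
Proof.
have u0 : fnorm (u v0) = 1.
  by rewrite /u fnormZR fnorm_mxvec fnorm_v0 gtr0_norm ?invr_gt0 // mulVf ?lt0r_neq0.
have [xi [t [xi1 t2 xiT xi_gap]]] := top_eigenvector orbit_average_tr u0 orbit_average_near.
have t0 : 0 < t by lra.
have AA y : A y *m (A y)^t* = 1%:M by have [] := uniP (A_u y).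
pose chi y := ip (xi *m A y) xi.
have xiA y : fnorm (xi *m A y) = 1 by rewrite fnorm_mulr.
(* The eigenvector is a combination of the [v i], so that left multiplication
   by a matrix [B] contracts it by the normalized Hilbert-Schmidt norm of [B]. *)
have mul_xi (B : 'M[C]_d) (e : R) : fnorm B <= e * sd -> fnorm (B *m vec_mx xi) <= 2 * e.
  move=> Be.
  have xiE : vec_mx xi = (t^-1)%:K *:
      \sum_(i <- l) (c i)%:K *: ((ip xi (u (v i)) * (sd^-1)%:K) *: v i).
    apply: (can_inj mxvecK); rewrite vec_mxK linearZ linear_sum /=.
    rewrite -[LHS]scale1r -(rmorph1 (toC C)) -(mulVf (lt0r_neq0 t0)) rmorphM.
    rewrite -scalerA -xiT /T mulmx_sumr; congr (_ *: _); apply: eq_bigr => i _.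
    rewrite -scalemxAr mul_outer [RHS]linearZ /= [mxvec (_ *: v i)]linearZ /=.
    by rewrite /u scalerA.
  rewrite xiE -scalemxAr mulmx_sumr fnormZR gtr0_norm ?invr_gt0 //.
  rewrite mulrC ler_pdivrMr //.
  under eq_bigr do rewrite -scalemxAr.
  have e0 : 0 <= e by rewrite -(pmulr_lge0 _ sd0) (le_trans (fnorm_ge0 B)).
  apply: (@le_trans _ _ e); last by nra.
  apply: fnorm_convex => // i il; rewrite -scalemxAr fnormZ nrmM nrm_toC fnorm_mul_v.
  have H : nrm (ip xi (u (v i))) <= 1.
    apply: le_trans (cauchy_ip _ _) _;  rewrite xi1 mul1r /u fnormZR fnorm_mxvec.
    by rewrite -[v i]mul1mx fnorm_mul_v fnorm1 gtr0_norm ?invr_gt0 // mulVf ?lt0r_neq0.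
  rewrite gtr0_norm ?invr_gt0 // mulrAC ler_pdivrMr //; apply: le_trans Be.
  by rewrite ler_piMl ?fnorm_ge0.
(* [f] is the component of [xi A(y)] orthogonal to [xi]. Almost invariance of [T] makes [xi A(y)] an
   approximate eigenvector for the eigenvalue [t], and the gap below [t] forces [f] to be small. *)
have eig y : y \in Ft -> fnorm (xi *m A y - chi y *: xi) <= 2 * kap.
  move=> yF; set f := xi *m A y - _.
  have fxi : ip f xi = 0.
    by rewrite /f ipBl ipZl ip_fn xi1 expr1n rmorph1 mulr1 subrr.
  apply: le_trans (xi_gap f fxi) _; rewrite ler_pM2l ?ltr0n //.
  have -> : f *m T - t%:K *: f =
      - (xi *m A y *m ((A y)^t* *m T *m A y - T)).
    rewrite mulmxBr !mulmxA -[xi *m A y *m (A y)^t*]mulmxA AA mulmx1 xiT.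
    rewrite -scalemxAl opprB /f mulmxBl -scalemxAl xiT scalerBr !scalerA.
    by rewrite (mulrC t%:K) opprB addrA subrK.
  rewrite fnormN; apply: le_trans (fnormM _ _) _; rewrite xiA mul1r; exact: orbit_average_flat.
have AE y : xi *m A y = mxvec ((pi y)^t* *m vec_mx xi *m rho (p y)).
  by rewrite -[in LHS](vec_mxK xi) mxvec_sandwich.
have [ru rM] := rho_r.
have rr g : rho g *m (rho g)^t* = 1%:M by have [] := uniP (ru g).
exists chi; split; first split.
- by move=> x; apply: le_trans (cauchy_ip _ _) _; rewrite xiA xi1 mulr1.
(* The modulus is at least 1 - 2 kap, and kap <= 1/4. *)
- move=> x xF; have := fnorm_dist (chi x *: xi) (xi *m A x) 0.
  rewrite !subr0 xiA fnormZ xi1 mulr1; have := eig x xF; have := kap4.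
  move: (fnorm _) (nrm _) => a b; lra.
- move=> x y xF yF.
  have -> : chi (x * y)%g - chi x * chi y =
      ip (xi *m A (x * y)%g - xi *m A x *m A y) xi +
      ip ((xi *m A x - chi x *: xi) *m A y) xi.
    rewrite mulmxBl -scalemxAl !ipBl ipZl addrA subrK.
    by [].
  apply: le_trans (nrmD _ _) _; apply: lerD.
    apply: le_trans (cauchy_ip _ _) _; rewrite xi1 mulr1 !AE mxvec_sandwich.
    rewrite -linearB fnorm_mxvec pM rM !mulmxA -2!mulmxBl fnorm_mulr // fnorm_mulr //.
    rewrite -mulmxBl -trmxCM -trmxCB; apply: mul_xi.
    by rewrite fnorm_trC pi_mul.
  apply: le_trans (cauchy_ip _ _) _; rewrite xi1 mulr1 fnorm_mulr //; exact: eig.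
(* Since [p z] is trivial, [A z] is left multiplication by the adjoint of [pi z]; this is where the
   conjugate of [zeta] comes from. *)
have -> : chi z - zeta^* = ip (xi *m A z - zeta^* *: xi) xi.
  by rewrite ipBl ipZl ip_fn xi1 expr1n rmorph1 mulr1.
apply: le_trans (cauchy_ip _ _) _; rewrite xi1 mulr1 AE p_z urep1 // mulmx1.
rewrite -{2}(vec_mxK xi) -linearZ -linearB fnorm_mxvec.
rewrite -mul_scalar_mx -mulmxBl; apply: mul_xi.
have -> : (pi z)^t* - (zeta^* )%:M = (pi z - zeta%:M)^t*.
  by rewrite trmxCB; congr (_ - _); rewrite tr_scalar_mx map_scalar_mx.
by rewrite fnorm_trC.
Qed.

End Eigencharacter.

(** * Finitary forms of the hypotheses *)

Section Averaging.
Variables (R : realType) (C : complexes R) (G : groupType).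

(* Uniform in the representation [W]: the weights [l] are the law of a lazy
   random walk on [G], whose length depends only on [F] and [eta]. *)
Definition averaging : Prop := exists (K0 : R) (S : seq G), 0 <= K0 /\
  forall (F : seq G) (eta : R), 0 < eta -> exists l : seq (R * G),
    [/\ forall x, x \in l -> 0 <= x.1, \sum_(x <- l) x.1 = 1,
      forall n (W : G -> 'M[C]_n) (y : 'rV[C]_n), urep W ->
        fnorm (y - \sum_(x <- l) (x.1)%:K *: (y *m W x.2)) <=
          K0 * \sum_(g <- S) fnorm (y - y *m W g) &
      forall n (W : G -> 'M[C]_n) (y : 'rV[C]_n) g, urep W -> g \in F ->
        fnorm (\sum_(x <- l) (x.1)%:K *: (y *m W (x.2 * g)%g) -
            \sum_(x <- l) (x.1)%:K *: (y *m W x.2)) <= eta * fnorm y].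

Lemma gap_averaging (S : seq G) (lambda : R) :
  uniq S -> (forall s, s \in S -> (s^-1)%g \in S) -> 0 < lambda ->
  spectral_gap C S lambda ->
  (forall P : G -> Prop, P 1%g -> (forall x z, P x -> P z -> P (x * z)%g) ->
    (forall x, P x -> P (x^-1)%g) -> (forall s, s \in S -> P s) ->
    forall g, P g) ->
  averaging.
Proof.
move=> Su Ss l0 Sgap Sgen.
pose K0 := (Num.min 1 (if S is [::] then 1 else lambda * (size S)%:R) : R)^-1.
have K00 : 0 <= K0.
  rewrite invr_ge0 le_min ler01 /=; case: (S) => // s S'.
  by rewrite mulr_ge0 ?ler0n // ltW.
have near k n (W : G -> 'M[C]_n) y : urep W ->
    fnorm (y - walk_vec S W k y) <= K0 * \sum_(s <- S) fnorm (y - y *m W s).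
  by move=> Wr; have := walk_vec_near Su Ss l0 Sgap y k Wr.
exists K0, S; split=> // F eta eta0.
have [k kP] : exists k, forall g, g \in F -> forall n (W : G -> 'M[C]_n) y,
    urep W -> fnorm (walk_vec S W k y - walk_vec S W k y *m W g) <= eta * fnorm y.
  suff [k0 H] : exists k0, forall k, (k0 <= k)%N -> forall g, g \in F ->
      forall n (W : G -> 'M[C]_n) y, urep W ->
      fnorm (walk_vec S W k y - walk_vec S W k y *m W g) <= eta * fnorm y.
    by exists k0; apply: H.
  elim: F => [|g F [k1 IH]]; first by exists 0%N.
  have [k2 H] := walk_vec_invariant Su Ss l0 Sgap Sgen g eta0.
  exists (maxn k1 k2) => k; rewrite geq_max => /andP[kk1 kk2] h.
  by rewrite inE => /orP[/eqP ->|hF] n W y Wr; [apply: H | apply: IH].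
exists (walk R S k); split.
- exact: walk_ge0.
- exact: walk_sum.
- by move=> n W y Wr; rewrite walkE //; apply: near.
- move=> n W y g Wr gF; rewrite fnormBC walkE //.
  have -> : \sum_(x <- walk R S k) (x.1)%:K *: (y *m W (x.2 * g)%g) =
      walk_vec S W k y *m W g.
    rewrite -(walkE S k y Wr) mulmx_suml; apply: eq_bigr => x _.
    by rewrite (Wr.2) mulmxA scalemxAl.
  exact: kP.
Qed.

(** Stability with a finite test set and a tolerance in place of sequences. The coisometry [j] plays
    the role of the corner inclusion. *)
Definition flex_stable : Prop :=
  forall (F : seq G) (e : R), 0 < e -> exists (K : seq G) (del : R), 0 < del /\
    forall d (pi : G -> 'M[C]_d), (0 < d)%N -> (forall g, pi g \is unitarymx) ->
      (forall g h, g \in K -> h \in K ->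
        fnorm (pi (g * h)%g - pi g *m pi h) <= del * Num.sqrt d%:R) ->
      exists D (rho : G -> 'M[C]_D) (j : 'M[C]_(d, D)),
        [/\ urep rho, j *m j^t* = 1%:M &
            forall g, g \in F ->
              fnorm (j *m rho g - pi g *m j) <= e * Num.sqrt d%:R].

(* The choice between a root of unity and its conjugate cannot be avoided:
   hyperlinearity only controls real parts of traces. *)
Definition scalar_reps (iota : int -> G) (zeta : C) : Prop :=
  forall (K : seq G) (A : seq int) (del : R), 0 < del ->
  exists (zeta' : C) d (pi : G -> 'M[C]_d),
    [/\ zeta' = zeta \/ zeta' = zeta^*, (0 < d)%N, forall x, pi x \is unitarymx,
        forall x y, x \in K -> y \in K ->
          fnorm (pi (x * y)%g - pi x *m pi y) <= del * Num.sqrt d%:R &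
        forall a, a \in A ->
          fnorm (pi (iota a) - (zeta' ^ a)%:M) <= del * Num.sqrt d%:R].

End Averaging.

Section Roots.
Variables (R : realType) (C : complexes R).

Lemma nrmV (x : C) : nrm x^-1 = (nrm x)^-1.
Proof.
have [->|x0] := eqVneq x 0; first by rewrite invr0 nrm0 invr0.
have nx0 : nrm x != 0 by apply: contra_neq x0 => /nrm_eq0.
by apply: (mulfI nx0); rewrite -nrmM !divff // nrm1.
Qed.

Lemma nrmXn (x : C) n : nrm (x ^+ n) = nrm x ^+ n.
Proof. by elim: n => [|n IH]; rewrite ?expr0 ?nrm1 // !exprS nrmM IH. Qed.

Lemma nrm_expz (x : C) (a : int) : nrm x = 1 -> nrm (x ^ a) = 1.
Proof.
by case: a => n x1; rewrite ?NegzE -?exprnN ?nrmV nrmXn x1 expr1n ?invr1.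
Qed.

(** Bounds the phases zeta^a by the distance of zeta from 1, for cocycle values a of bounded
    size. *)
Lemma nrm_expz_sub1 (x : C) (a : int) : nrm x = 1 ->
  nrm (x ^ a - 1) <= `|a|%N%:R * nrm (x - 1).
Proof.
move=> x1.
have pos n : nrm (x ^+ n - 1) <= n%:R * nrm (x - 1).
  elim: n => [|n IH]; first by rewrite expr0 subrr nrm0 mul0r.
  have -> : x ^+ n.+1 - 1 = x * (x ^+ n - 1) + (x - 1).
    by rewrite exprS; ring.
  apply: le_trans (nrmD _ _) _; rewrite nrmM x1 mul1r -addn1 natrD mulrDl mul1r.
  by rewrite lerD2r.
case: a => n; first exact: pos.
rewrite -[X in X <= _]/(nrm ((x ^+ n.+1)^-1 - 1)) -[absz _]/n.+1.
have x0 : x != 0 by apply/eqP => x0; move: x1; rewrite x0 nrm0 => /eqP; rewrite eq_sym oner_eq0.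
have -> : (x ^+ n.+1)^-1 - 1 = - ((x ^+ n.+1)^-1 * (x ^+ n.+1 - 1)).
  by field; rewrite expf_neq0.
by rewrite nrmN nrmM nrmV nrmXn x1 expr1n invr1 mul1r pos.
Qed.

End Roots.

(** * Order of the constants and the contradiction *)

Section Contradiction.
Variables (R : realType) (C : complexes R) (Gt G : groupType).
Variable E : central_Z_extension Gt G.
Let iota := ext_inj E.
Let p := ext_proj E.

Let pM x y : p (x * y)%g = (p x * p y)%g. Proof. exact: gmulfM. Qed.

Let p1 : p 1%g = 1%g.
Proof. by apply: (mulgI (p 1%g)); rewrite -pM !mulg1. Qed.
Let pV x : p (x^-1)%g = (p x)^-1%g.
Proof. by apply: (mulgI (p x)); rewrite -pM !mulgV p1. Qed.

Lemma section_cocycle : exists (s : G -> Gt) (a : G -> Gt -> int),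
  (forall g, p (s g) = g) /\
  forall g x, (s g * x)%g = (iota (a g x) * s (g * p x)%g)%g.
Proof.
have [s sP] := choice (ext_proj_surjective E).
have H (gx : G * Gt) : exists a, (s gx.1 * gx.2)%g =
    (iota a * s (gx.1 * p gx.2)%g)%g.
  have : p (s gx.1 * gx.2 * (s (gx.1 * p gx.2)%g)^-1)%g = 1%g.
    by rewrite !pM pV !sP mulgV.
  by move=> /(ext_exact E) [a aE]; exists a; rewrite /iota -aE mulgVK.
have [a aP] := choice H; exists s, (fun g x => a (g, x)); split=> // g x.
exact: aP (g, x).
Qed.

Lemma scalar_reps_contradiction (M : int) :
  averaging C G -> flex_stable C G -> commutator_set (iota M) ->
  (forall del : R, 0 < del -> exists (N : nat) (zeta : C),
     [/\ (0 < N)%N, zeta ^+ N = 1, exprz zeta M != 1 & nrm (zeta - 1) <= del]) ->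
  (forall N (zeta : C), (0 < N)%N -> zeta ^+ N = 1 -> scalar_reps iota zeta) ->
  False.
Proof.
move=> [K0 [S [K00 avg]]] stab Mcomm roots reps.
have [s [a [sP aP]]] := section_cocycle.
pose k0 := K0 * (size S)%:R.
have k00 : 0 <= k0 by rewrite mulr_ge0 ?ler0n.
(* Depends only on the spectral gap. With e1 <= e0 the quantity to be kept below 1/20 is at most 6
   (k0 + 1) e0 = 6/320. *)
pose e0 := (320 * (k0 + 1))^-1.
have k1 : 0 < 320 * (k0 + 1) by lra.
have e00 : 0 < e0 by rewrite invr_gt0.
have e0E : 320 * (k0 + 1) * e0 = 1 by rewrite divff // lt0r_neq0.
have [Ka [da [da0 Pa]]] := stab (1%g :: S) e0 e00.
(* A bound for the cocycle on the finite set [Ka], so that a zeta close enough to 1 makes all phases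
   occurring there at most da / 2 away from 1. *)
pose B : nat := (\sum_(g <- Ka) \sum_(h <- Ka) `|a g (s h)|)%N.
have BP g h : g \in Ka -> h \in Ka -> (`|a g (s h)| <= B)%N.
  move=> gK hK; rewrite /B (big_rem g) //=.
  apply: leq_trans (leq_addr _ _); rewrite (big_rem h) //=.
  exact: leq_addr.
have dB0 : 0 < da / (2 * (B%:R + 1)) by rewrite divr_gt0 // mulr_gt0 ?ltr_wpDl.
have [N [zeta0 [N0 zN zM z1]]] := roots _ dB0.
have zn : nrm zeta0 = 1.
  apply/eqP; rewrite -(pexpr_eq1 N0) ?nrm_ge0 //.
  by rewrite -nrmXn zN nrm1.
(* Unchanged if [zeta0] is replaced by its conjugate, so it may be fixed before it is known which of
   the two occurs. *)
pose etaM := nrm (exprz zeta0 M - 1).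
have etaM0 : 0 < etaM.
  rewrite lt_def nrm_ge0 andbT; apply: contra zM => /eqP /nrm_eq0 /eqP.
  by rewrite subr_eq0.
have etaM2 : 0 < etaM / 2 by rewrite divr_gt0 ?ltr0n.
have [Ft [et [et0 Pt]]] := commutator_forced_trivial C Mcomm etaM2.
pose kap := Num.min 4^-1 (et / 4).
have kap0 : 0 < kap by rewrite lt_min divr_gt0 ?invr_gt0 ?ltr0n.
have kap1 : kap <= 4^-1 by rewrite ge_min lexx.
have kap2 : kap <= et / 4 by rewrite ge_min lexx orbT.
have eta0 : 0 < kap / 4 by rewrite divr_gt0 ?ltr0n.
have [l [l_ge0 l_sum l_near l_flat]] := avg (map p Ft) _ eta0.
(* The budget for [kap] is kap/4 for the walk, kap/4 for 2 e1 and kap/4 for 6 del. *)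
pose e1 := Num.min e0 (kap / 8).
have e10 : 0 < e1 by rewrite lt_min e00 divr_gt0 ?ltr0n.
have e1e0 : e1 <= e0 by rewrite ge_min lexx.
have e1k : e1 <= kap / 8 by rewrite ge_min lexx orbT.
pose Q := (1%g :: S) ++ [seq x.2 | x <- l] ++
          [seq (x.2 * p y)%g | x <- l, y <- Ft].
have [Kb [db [db0 Pb]]] := stab Q e1 e10.
pose del := Num.min (Num.min (et / 8) (etaM / 8))
  (Num.min (kap / 24) (Num.min (da / 8) (db / 8))).
have del0 : 0 < del by rewrite !lt_min !divr_gt0 ?ltr0n.
have del1 : del <= et / 8 by rewrite !ge_min lexx.
have del2 : del <= etaM / 8 by rewrite !ge_min lexx !orbT.
have del3 : del <= kap / 24 by rewrite !ge_min lexx !orbT.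
have del4 : del <= da / 8 by rewrite !ge_min lexx !orbT.
have del5 : del <= db / 8 by rewrite !ge_min lexx !orbT.
pose PL : seq (G * Gt) := [seq (g, s h) | g <- Ka, h <- Ka] ++
  [seq (g, s h) | g <- Kb, h <- Kb] ++ [seq (x.2, y) | x <- l, y <- Ft].
pose KK := Ft ++ flatten [seq [:: s gx.1; gx.2; iota (a gx.1 gx.2);
                                  s (gx.1 * p gx.2)%g] | gx <- PL].
pose AA := M :: [seq a gx.1 gx.2 | gx <- PL].
have [zeta [d [pi [zetaE d0 pi_u piM pi_iota]]]] := reps _ _ N0 zN KK AA _ del0.
pose sd := Num.sqrt d%:R : R.
have sd0 : 0 <= sd by exact: sqrtr_ge0.
have zetan : nrm zeta = 1 by case: zetaE => ->; rewrite ?nrm_conj.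
have zetaz : nrm (zeta - 1) <= da / (2 * (B%:R + 1)).
  case: zetaE => ->; first exact: z1.
  by rewrite -(rmorph1 Num.conj) -rmorphB nrm_conj.
have zetaM : nrm (exprz zeta M - 1) = etaM.
  case: zetaE => ->; first by [].
  by rewrite -fmorphXz /= -(rmorph1 Num.conj) -rmorphB nrm_conj.
have cocycle g x : (g, x) \in PL ->
    fnorm (pi (s g) *m pi x - (exprz zeta (a g x)) *: pi (s (g * p x)%g)) <= 3 * del * sd.
  move=> gxP.
  have inKK y : y \in [:: s g; x; iota (a g x); s (g * p x)%g] -> y \in KK.
    move=> yP; rewrite mem_cat; apply/orP; right.
    by apply/flatten_mapP; exists (g, x).
  have i1 : s g \in KK by apply: inKK; rewrite !inE eqxx.
  have i2 : x \in KK by apply: inKK; rewrite !inE eqxx !orbT.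
  have i3 : iota (a g x) \in KK by apply: inKK; rewrite !inE eqxx !orbT.
  have i4 : s (g * p x)%g \in KK by apply: inKK; rewrite !inE eqxx !orbT.
  have H1 := piM _ _ i1 i2; have H2 := piM _ _ i3 i4; rewrite -aP in H2.
  have H3 : fnorm (pi (iota (a g x)) - (exprz zeta (a g x))%:M) <= del * sd.
    by apply: pi_iota; rewrite inE; apply/orP; right; apply/mapP; exists (g, x).
  have [U1 _] := uniP (pi_u (s (g * p x)%g)).
  rewrite -(fnorm_mulr _ U1) mulmxBl mul_scalar_mx in H3.
  set X := pi (s g) *m pi x in H1 *; set Y := _ *: _ in H3 *.
  set Z := pi (iota _) *m _ in H2 H3.
  have := fnorm_dist (pi (s g * x)%g) X Y; have := fnorm_dist Z (pi (s g * x)%g) Y.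
  rewrite (fnormBC X (pi _)); rewrite -/sd in H1 H2 H3 *; clear -H1 H2 H3.
  by lra.
have PLa g h : g \in Ka -> h \in Ka -> (g, s h) \in PL.
  move=> gK hK; rewrite mem_cat; apply/orP; left.
  exact: (allpairs_f (fun g h => (g, s h)) gK hK).
have PLb g h : g \in Kb -> h \in Kb -> (g, s h) \in PL.
  move=> gK hK; rewrite !mem_cat; apply/orP; right; apply/orP; left.
  exact: (allpairs_f (fun g h => (g, s h)) gK hK).
have PLl x y : x \in l -> y \in Ft -> (x.2, y) \in PL.
  move=> xl yF; rewrite !mem_cat; apply/orP; right; apply/orP; right.
  exact: (allpairs_f (fun (x : R * G) y => (x.2, y)) xl yF).
(* Here the phases count: they contribute da / 2, and the error of [pi] adds 3 del <= 3 da / 8. *)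
have [D [rho [j [rho_r jj rho_near]]]] : exists D (rho : G -> 'M[C]_D)
    (j : 'M[C]_(d, D)), [/\ urep rho, j *m j^t* = 1%:M &
      forall g, g \in 1%g :: S -> fnorm (j *m rho g - pi (s g) *m j) <= e0 * sd].
  apply: Pa => // g h gK hK; have := cocycle _ _ (PLa _ _ gK hK); rewrite sP.
  set X := pi (s g) *m _; set Y := _ *: _ => H.
  apply: le_trans (fnorm_dist Y _ _) _; rewrite (fnormBC Y).
  have -> : pi (s (g * h)%g) - Y = - ((exprz zeta (a g (s h)) - 1) *: pi (s (g * h)%g)).
    by rewrite scalerBl scale1r opprB.
  have [U1 _] := uniP (pi_u (s (g * h)%g)).
  rewrite fnormN fnormZ (fnorm_coiso U1) -/sd.
  have H1 : nrm (exprz zeta (a g (s h)) - 1) <= da / 2.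
    apply: le_trans (nrm_expz_sub1 _ zetan) _.
    apply: (@le_trans _ _ ((B%:R + 1) * nrm (zeta - 1))).
      by rewrite ler_wpM2r ?nrm_ge0 // ler_wpDr // ler_nat BP.
    rewrite mulrC; move: zetaz; rewrite invfM mulrA ler_pdivlMr //.
    by rewrite ltr_wpDl.
  move: (fnorm (X - Y)) (nrm _) H (ler_wpM2r sd0 H1)
    (ler_wpM2r sd0 del4) (mulr_ge0 (ltW da0) sd0) => u v.
  by clearbody del sd; lra.
have dd0 : (0 < d * d)%N by rewrite muln_gt0 d0.
have sdd : Num.sqrt (d * d)%:R = d%:R :> R.
  by rewrite natrM -expr2 sqrtr_sqr ger0_norm ?ler0n.
have sd2 : sd * sd = d%:R by rewrite -expr2 sqr_sqrtr ?ler0n.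
have fpi x : fnorm (pi x) = sd by apply: fnorm_coiso; have [] := uniP (pi_u x).
(* Now the phases drop out, and the only error is 3 del, doubled by the tensor square. Hence the
   precision db, which was chosen after zeta, is attained. *)
have [D' [tau [j2 [tau_r jj2 tau_near]]]] : exists D' (tau : G -> 'M[C]_D')
    (j2 : 'M[C]_(d * d, D')), [/\ urep tau, j2 *m j2^t* = 1%:M &
      forall g, g \in Q ->
        fnorm (j2 *m tau g - tsq (pi (s g)) *m j2) <= e1 * d%:R].
  rewrite -sdd; apply: Pb => // [g|g h gK hK]; first exact: tsq_unitary.
  have := cocycle _ _ (PLb _ _ gK hK); rewrite sP fnormBC => H.
  rewrite -tsqM sdd -sd2.
  have -> : tsq (pi (s (g * h)%g)) =
      tsq (exprz zeta (a g (s h)) *: pi (s (g * h)%g)).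
    by rewrite tsqZ nrm_expz // expr1n rmorph1 scale1r.
  have [U1 _] := uniP (pi_u (s g)); have [U2 _] := uniP (pi_u (s h)).
  apply: le_trans (fnorm_tsqB _ _) _.
  rewrite fnormZ nrm_expz // mul1r (fnorm_mulr _ U2) !fpi.
  apply: (@le_trans _ _ (3 * del * sd * (sd + sd))).
    by rewrite ler_wpM2r // addr_ge0.
  move: (ler_wpM2r (mulr_ge0 sd0 sd0) del5) (mulr_ge0 (ltW db0) (mulr_ge0 sd0 sd0)).
  by clearbody del sd; lra.
have Q1 g : g \in 1%g :: S -> g \in Q by move=> gS; rewrite mem_cat gS.
have Q2 x : x \in l -> x.2 \in Q.
  by move=> xl; rewrite !mem_cat (map_f snd xl) orbT.
have Q3 x y : x \in l -> y \in Ft -> (x.2 * p y)%g \in Q.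
  move=> xl yF; rewrite !mem_cat; apply/orP; right; apply/orP; right.
  exact: (allpairs_f (fun (x : R * G) y => (x.2 * p y)%g) xl yF).
have tau_near' g : g \in 1%g :: S \/ (exists2 x, x \in l & g = x.2 \/
      exists2 y, y \in Ft & g = (x.2 * p y)%g) ->
    fnorm (j2 *m tau g - tsq (pi (s g)) *m j2) <= e1 * d%:R.
  move=> H; apply: tau_near; case: H => [/Q1 //|[x xl [->|[y yF ->]]]].
    exact: Q2.
  exact: Q3.
have cocycle' x y : x \in l -> y \in Ft -> exists2 c : C, nrm c = 1 &
    fnorm (pi (s x.2) *m pi y - c *: pi (s (x.2 * p y)%g)) <= (3 * del) * sd.
  move=> xl yF; exists (exprz zeta (a x.2 y)); first exact: nrm_expz.
  exact: cocycle (PLl x y xl yF).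
have piM' x y : x \in Ft -> y \in Ft ->
    fnorm (pi (x * y)%g - pi x *m pi y) <= del * sd.
  by move=> xF yF; apply: piM; rewrite mem_cat ?xF ?yF.
have small : K0 * (size S)%:R * (2 * e1 + 4 * e0) + 2 * e1 <= 20^-1.
  rewrite -/k0; have := ler_wpM2l k00 e1e0.
  by move: e0E e1e0 k00; clearbody e1 e0 k0; lra.
have kapE : kap / 4 + 2 * e1 + 2 * (3 * del) <= kap.
  by move: e1k del3 kap0; clearbody del e1 kap; lra.
have Ft_F y : y \in Ft -> p y \in map p Ft by move=> yF; apply: map_f.
have near := comb_orb_near d0 pi_u rho_r tau_r jj jj2 l_ge0 l_sum l_near K00
  rho_near tau_near' small.
have flat y (yF : y \in Ft) := comb_orb_flat d0 pi_u rho_r tau_r jj jj2 l_ge0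
  l_sum l_flat Ft_F tau_near' cocycle' kapE yF.
have pi_z : fnorm (pi (iota M) - (exprz zeta M)%:M) <= del * sd.
  by apply: pi_iota; rewrite mem_head.
have p_z : p (iota M) = 1%g by apply/(ext_exact E); exists M.
have [chi [chiP chiM]] := eigencharacter pM d0 pi_u rho_r l_ge0 l_sum
  (fun x A => fnorm_mul_orb s pi_u rho_r jj A x.2) (fnorm_orb s pi_u rho_r jj 1%g)
  near flat piM' pi_z p_z kap1.
have small2 : 2 * del + 2 * kap <= et.
  by move: del1 kap2 et0; clearbody del kap; lra.
(* etaM is the distance from the conjugate of zeta^M to 1, but going through chi it is at most etaM
   / 2 + 2 del <= 3 etaM / 4. *)
have := Pt chi (approx_charW (fun x xF => xF) small2 chiP).
have := nrmD (chi (iota M) - 1) (- (chi (iota M) - (exprz zeta M)^*)).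
rewrite nrmN opprB addrC addrA subrK -(rmorph1 Num.conj) -rmorphB nrm_conj zetaM.
move: chiM del2 etaM0; rewrite rmorph1; clearbody del etaM.
by move: (nrm _) (nrm _) => u v; lra.
Qed.
End Contradiction.

(** * Approximate isotypic components *)

Section Compression.
Variables (R : realType) (C : complexes R).

(** Finitary hyperlinearity. For unitaries with [sg 1] close to the identity, distance about sqrt 2
    from [sg 1] amounts to a small real part of the normalized trace. *)
Definition trace_separated (H : groupType) : Prop :=
  forall (K : seq H) (del : R), 0 < del -> exists d (sg : H -> 'M[C]_d),
    [/\ (0 < d)%N, forall x, sg x \is unitarymx,
        forall x y, x \in K -> y \in K ->
          fnorm (sg (x * y)%g - sg x *m sg y) <= del * Num.sqrt d%:R &
        forall x, x \in K -> x != 1%g -> `|re (\tr (sg x))| <= del * d%:R].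

Lemma sum_shift (V : zmodType) N (X : int -> V) (a : int) :
  (forall b, X (b + N%:Z) = X b) -> \sum_(k < N) X (a + k%:Z) = \sum_(k < N) X k%:Z.
Proof.
move=> per.
have step b : \sum_(k < N) X (b + 1 + k%:Z) = \sum_(k < N) X (b + k%:Z).
  case: N per => [|N] per; first by rewrite !big_ord0.
  rewrite big_ord_recr [RHS]big_ord_recl /= addrC addr0; congr (_ + _).
    by rewrite -addrA -[1 + _]intS per.
  by apply: eq_bigr => i _; rewrite /bump leq0n add1n intS addrA.
have pos n b : \sum_(k < N) X (b + n%:Z + k%:Z) = \sum_(k < N) X (b + k%:Z).
  elim: n => [|n IH]; first by rewrite addr0.
  by rewrite -{1}addn1 PoszD addrA step.
have zero b : \sum_(k < N) X (b + k%:Z) = \sum_(k < N) X (0 + k%:Z).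
  case: b => n; first by rewrite -(pos n 0) add0r.
  by rewrite NegzE -(pos n.+1 (- n.+1%:Z)) addNr.
by rewrite zero; apply: eq_bigr => k _; rewrite add0r.
Qed.

Section Isotypic.
Variables (Gt : groupType) (iota : int -> Gt) (N d : nat).
Variables (sg : Gt -> 'M[C]_d) (K : seq Gt) (zeta : C) (del : R).
Hypotheses (N_gt0 : (0 < N)%N) (sg_u : forall x, sg x \is unitarymx).
Hypothesis iotaD : forall a b, iota (a + b) = (iota a * iota b)%g.
Hypothesis iotaC : forall a x, commute (iota a) x.
Hypothesis sg_per : forall a, sg (iota (a + N%:Z)) = sg (iota a).
Hypothesis zetaN : zeta ^+ N = 1.

Let sd : R := Num.sqrt d%:R.

Hypothesis mulz : forall x (k : 'I_N), x \in K ->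
  fnorm (sg (iota k * x)%g - sg (iota k) *m sg x) <= del * sd /\
  fnorm (sg (x * iota k)%g - sg x *m sg (iota k)) <= del * sd.
Hypothesis mulI : forall k l : 'I_N,
  fnorm (sg (iota k * iota l)%g - sg (iota k) *m sg (iota l)) <= del * sd.

Let zn : nrm zeta = 1.
Proof.
apply/eqP; rewrite -(pexpr_eq1 N_gt0) ?nrm_ge0 //.
by rewrite -nrmXn zetaN nrm1.
Qed.
Let z0 : zeta != 0.
Proof.
by apply/eqP => z0; have := zn; rewrite z0 nrm0 => /eqP; rewrite eq_sym oner_eq0.
Qed.
Let zzn a : nrm (exprz zeta a) = 1. Proof. exact: nrm_expz. Qed.
Let zconj a : (exprz zeta a)^* = exprz zeta (- a).
Proof.
rewrite -exprz_inv -(expr1z zeta^-1); apply: (mulfI (expfz_neq0 a z0)).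
rewrite mulconj zzn expr1n rmorph1 expr1z exprz_inv -expfzDr //.
by rewrite subrr expr0z.
Qed.
Let zper a : exprz zeta (- (a + N%:Z)) = exprz zeta (- a).
Proof.
by rewrite opprD expfzDr // -[exprz zeta (- N%:Z)]exprz_inv -exprnP exprVn zetaN
  invr1 mulr1.
Qed.

Let mean m n (X : 'I_N -> 'M[C]_(m, n)) : 'M[C]_(m, n) :=
  \sum_(k < N) (N%:R^-1)%:K *: X k.

Let mean_le m n (X : 'I_N -> 'M[C]_(m, n)) e :
  (forall k, fnorm (X k) <= e) -> fnorm (mean X) <= e.
Proof.
move=> H; apply: (@fnorm_convex R C _ _ (fun=> N%:R^-1)) => //.
  by move=> i _; rewrite invr_ge0 ler0n.
rewrite sumr_const card_ord -[LHS]mulr_natr mulVf //.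
by rewrite pnatr_eq0 -lt0n.
Qed.

Let meanB m n (X Y : 'I_N -> 'M[C]_(m, n)) :
  mean X - mean Y = mean (fun k => X k - Y k).
Proof. by rewrite /mean -sumrB; apply: eq_bigr => k _; rewrite scalerBr. Qed.
Let mean_cst m n (X : 'M[C]_(m, n)) : mean (fun=> X) = X.
Proof.
rewrite /mean sumr_const card_ord fmorphV rmorph_nat -scaler_nat scalerA divff.
  by rewrite scale1r.
by rewrite pnatr_eq0 -lt0n.
Qed.
Let mulmx_mean m n q (B : 'M[C]_(q, m)) (X : 'I_N -> 'M[C]_(m, n)) :
  B *m mean X = mean (fun k => B *m X k).
Proof. by rewrite /mean mulmx_sumr; apply: eq_bigr => k _; rewrite -scalemxAr. Qed.
Let mean_mulmx m n q (B : 'M[C]_(n, q)) (X : 'I_N -> 'M[C]_(m, n)) :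
  mean X *m B = mean (fun k => X k *m B).
Proof. by rewrite /mean mulmx_suml; apply: eq_bigr => k _; rewrite -scalemxAl. Qed.
Let mean_tr m n (X : 'I_N -> 'M[C]_(m, n)) : (mean X)^t* = mean (fun k => (X k)^t*).
Proof.
by rewrite /mean trmxC_sum; apply: eq_bigr => k _; rewrite trmxCZ conj_toC.
Qed.

(* Approximately the spectral projection of [sg (iota 1)] at [zeta]. *)
Definition isotypic : 'M[C]_d :=
  mean (fun k => exprz zeta (- k%:Z) *: sg (iota k)).

Let uR x : sg x *m (sg x)^t* = 1%:M. Proof. by have [] := uniP (sg_u x). Qed.
Let uL x : (sg x)^t* *m sg x = 1%:M. Proof. by have [] := uniP (sg_u x). Qed.

Lemma isotypic_contr n (B : 'M[C]_(d, n)) : fnorm (isotypic *m B) <= fnorm B.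
Proof.
rewrite mean_mulmx; apply: mean_le => k.
by rewrite -scalemxAl fnormZ zzn mul1r fnorm_mull.
Qed.
Lemma isotypic_tr_contr n (B : 'M[C]_(d, n)) : fnorm (isotypic^t* *m B) <= fnorm B.
Proof.
rewrite mean_tr mean_mulmx; apply: mean_le => k.
by rewrite trmxCZ -scalemxAl fnormZ nrm_conj zzn mul1r fnorm_mull // trmxCK.
Qed.

Lemma isotypic_comm x : x \in K ->
  fnorm (sg x *m isotypic - isotypic *m sg x) <= 2 * del * sd.
Proof.
move=> xK; rewrite mulmx_mean mean_mulmx meanB; apply: mean_le => k.
rewrite -scalemxAr -scalemxAl -scalerBr fnormZ zzn mul1r.
have [H1 H2] := mulz k xK; rewrite iotaC in H1.
have := fnorm_dist (sg (x * iota k)%g) (sg x *m sg (iota k)) (sg (iota k) *m sg x).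
by rewrite (fnormBC (sg x *m _) (sg _)); move: H1 H2; lra.
Qed.

(** Multiplication by [sg (iota a)] shifts the summation index, and the summands are N-periodic
    because both zeta^(-k) and [sg (iota k)] are. *)
Lemma isotypic_eigen a (e : R) :
  (forall k : 'I_N, fnorm (sg (iota a * iota k)%g - sg (iota a) *m sg (iota k)) <= e) ->
  fnorm (sg (iota a) *m isotypic - exprz zeta a *: isotypic) <= e.
Proof.
move=> H.
have -> : exprz zeta a *: isotypic =
    mean (fun k => exprz zeta (- k%:Z) *: sg (iota a * iota k)%g).
  pose X b := exprz zeta (- b) *: sg (iota b).
  have Xper b : X (b + N%:Z) = X b by rewrite /X zper sg_per.
  rewrite /isotypic /mean -!scaler_sumr -(sum_shift a Xper) scalerA mulrC -scalerA.
  congr (_ *: _); rewrite scaler_sumr; apply: eq_bigr => k _.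
  by rewrite /X scalerA -expfzDr // -iotaD opprD addrA subrr add0r.
rewrite mulmx_mean meanB; apply: mean_le => k.
by rewrite -scalemxAr -scalerBr fnormZ zzn mul1r fnormBC.
Qed.

(** The eigenvalue relation at a = k, multiplied by zeta^(-k) and averaged over k. *)
Lemma isotypic_idem : fnorm (isotypic *m isotypic - isotypic) <= del * sd.
Proof.
rewrite -{3}[isotypic]mean_cst {1}/isotypic mean_mulmx meanB.
apply: mean_le => k; have := isotypic_eigen (mulI k).
rewrite -[X in X <= _ -> _]mul1r -(zzn (- k%:Z)) -fnormZ scalerBr scalerA -scalemxAl.
by rewrite -expfzDr // addNr expr0z scale1r.
Qed.

(** [isotypic] is self-adjoint only approximately; [h] is an exactly self-adjoint substitute, as
    spectral rounding requires. *)
Let h := isotypic^t* *m isotypic.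

Lemma isotypic_sa : fnorm (h - isotypic) <= del * sd.
Proof.
rewrite /h -{3}[isotypic]mean_cst {1}/isotypic mean_tr mean_mulmx meanB.
apply: mean_le => k; have := isotypic_eigen (mulI k).
rewrite fnormBC -(fnorm_mull _ (U := (sg (iota k))^t*)) ?trmxCK // mulmxBr mulmxA uL mul1mx.
by rewrite trmxCZ zconj opprK -scalemxAl -scalemxAr.
Qed.

Lemma isotypic_corner : exists r (e : 'M[C]_(r, d)),
  e *m e^t* = 1%:M /\ fnorm (e^t* *m e - isotypic) <= 5 * del * sd.
Proof.
have hh : h^t* = h by rewrite /h trmxCM trmxCK.
have [r [e [ee H]]] := near_projection hh; exists r, e; split=> //.
have H1 := isotypic_sa; have H2 := isotypic_idem.
(* Rounding doubles this to 4 del, and the distance from [h] to [isotypic] adds the fifth. *)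
have H3 : fnorm (h *m h - h) <= 2 * del * sd.
  have -> : h *m h - h = isotypic^t* *m (isotypic *m (h - isotypic)) +
      isotypic^t* *m (isotypic *m isotypic - isotypic).
    by rewrite -mulmxDr mulmxBr addrA subrK mulmxBr /h !mulmxA.
  have := fnormD (isotypic^t* *m (isotypic *m (h - isotypic)))
    (isotypic^t* *m (isotypic *m isotypic - isotypic)).
  have := isotypic_tr_contr (isotypic *m (h - isotypic)).
  have := isotypic_tr_contr (isotypic *m isotypic - isotypic).
  by have := isotypic_contr (h - isotypic); lra.
by have := fnorm_dist h (e^t* *m e) isotypic; lra.
Qed.

End Isotypic.
End Compression.

Lemma sub_swap (V : zmodType) (a b c d : V) : a - b = (a - c) - (b - d) + (c - d).
Proof.
by rewrite opprD opprK [a - c + _]addrACA -[- c + d]opprK opprD opprK subrK.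
Qed.

(** * Almost representations with scalar centre from hyperlinear quotients *)

Section ScalarReps.
Variables (R : realType) (C : complexes R) (Gt H : groupType) (q : Gt -> H).
Variables (iota : int -> Gt) (N : nat) (zeta : C).
Hypothesis qM : forall x y, q (x * y)%g = (q x * q y)%g.
Hypothesis iotaD : forall a b, iota (a + b) = (iota a * iota b)%g.
Hypothesis iotaC : forall a x, commute (iota a) x.
Hypothesis N_gt0 : (0 < N)%N.
Hypothesis q_per : forall a, q (iota (a + N%:Z)) = q (iota a).
Hypothesis q_inj : forall k, (0 < k < N)%N -> q (iota k%:Z) != 1%g.
Hypothesis zetaN : zeta ^+ N = 1.
Hypothesis sep : trace_separated C H.

Lemma re_tr_le n (X : 'M[C]_n) : `|re (\tr X)| <= fnorm X * Num.sqrt n%:R.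
Proof.
rewrite -(fnorm1 C n); apply: le_trans (cauchy_ip X 1%:M).
by rewrite ipT trmxC1 mulmx1 re_le_nrm.
Qed.

(** The projections at [zeta] and its conjugate together have a trace whose real part involves only
    real parts of traces of [sg]. It is about 2d/N, so one of the two carries at least half of
    it. *)
Lemma isotypic_trace d (sg : Gt -> 'M[C]_d) (del : R) : 0 <= del ->
  (forall k : 'I_N, (0 < k)%N -> `|re (\tr (sg (iota k%:Z)))| <= del * d%:R) ->
  (1 - del) * d%:R <= re (\tr (sg (iota 0))) ->
  exists zeta', (zeta' = zeta \/ zeta' = zeta^* ) /\
    (N%:R^-1 - del) * d%:R <= re (\tr (isotypic iota N sg zeta')).
Proof.
move=> del0 small one.
have zn : nrm zeta = 1.
  apply/eqP; rewrite -(pexpr_eq1 N_gt0) ?nrm_ge0 //.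
  by rewrite -nrmXn zetaN nrm1.
have trE z : re (\tr (isotypic iota N sg z)) =
    N%:R^-1 * \sum_(k < N) re (exprz z (- k%:Z) * \tr (sg (iota k%:Z))).
  rewrite /isotypic raddf_sum re_sum mulr_sumr; apply: eq_bigr => k _.
  by rewrite /= !mxtraceZ reZ.
have N0 : 0 < N%:R :> R by rewrite ltr0n.
suff H2 : 2 * (N%:R^-1 - del) * d%:R <= re (\tr (isotypic iota N sg zeta)) +
    re (\tr (isotypic iota N sg zeta^*)).
  case: (leP ((N%:R^-1 - del) * d%:R) (re (\tr (isotypic iota N sg zeta)))) => H3.
    by exists zeta; split; [left|].
  by exists (zeta^*); split; [right | move: H2 H3; lra].
rewrite !trE -mulrDr -big_split /=.
have termE k : re (exprz zeta (- k%:Z) * \tr (sg (iota k%:Z))) +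
    re (exprz zeta^* (- k%:Z) * \tr (sg (iota k%:Z))) =
    2 * re (exprz zeta (- k%:Z)) * re (\tr (sg (iota k%:Z))).
  have e : exprz zeta (- k%:Z) + (exprz zeta (- k%:Z))^* =
      (2 * re (exprz zeta (- k%:Z)))%:K.
    rewrite -[LHS]re_real; last by rewrite CrealE rmorphD /= conjCK addrC.
    by rewrite reD re_conj -mulr2n mulr_natl.
  by rewrite -reD -mulrDl -fmorphXz /= e reZ.
under eq_bigr do rewrite termE.
case: N N_gt0 small N0 trE termE => // n _ small N0 _ _.
rewrite big_ord_recl /= oppr0 expr0z re1 mulr1.
have tail : - (2 * del * d%:R) * n%:R <= \sum_(i < n)
    2 * re (exprz zeta (- (bump 0 i)%:Z)) * re (\tr (sg (iota (bump 0 i)%:Z))).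
  rewrite mulr_natr -{1}(card_ord n) -sumr_const; apply: ler_sum => i _.
  have lt : (0 < lift ord0 i)%N by [].
  have := small (lift ord0 i) lt; rewrite /= => H1.
  have := re_le_nrm (exprz zeta (- (bump 0 i)%:Z)).
  rewrite nrm_expz // => H2.
  set x := re _ in H2 *; set y := re _ in H1 *.
  have : `|x * y| <= del * d%:R.
    by rewrite normrM -[leRHS]mul1r; apply: ler_pM.
  by rewrite ler_norml => /andP[? _]; rewrite -mulrA; lra.
rewrite [leRHS]mulrC ler_pdivlMr //.
have -> : 2 * (n.+1%:R^-1 - del) * d%:R * n.+1%:R =
    2 * d%:R - 2 * del * d%:R - 2 * del * d%:R * n%:R.
  have m0 := lt0r_neq0 N0; have -> : n%:R = n.+1%:R - 1 :> R by rewrite -natr1 addrK.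
  by move: (n.+1%:R) m0 => m m0; field.
by move: tail one; lra.
Qed.

Lemma scalar_reps_quotient : scalar_reps iota zeta.
Proof.
move=> K A del del0.
have N0 : 0 < N%:R :> R by rewrite ltr0n.
have N1 : 1 <= N%:R :> R by rewrite ler1n.
(* The 12 keeps the rank of the corner at least d/(2N). In 104 = 2 * 52, the 52 counts the errors of
   the final estimate, and 2N is the loss in passing from sqrt d to sqrt r. *)
pose dl := Num.min ((12 * N%:R)^-1) (del / (104 * N%:R)).
have dl0 : 0 < dl by rewrite lt_min invr_gt0 divr_gt0 ?mulr_gt0.
have dl0' := ltW dl0.
have dl1 : dl * (12 * N%:R) <= 1.
  by rewrite -ler_pdivlMr ?mulr_gt0 // mul1r ge_min lexx.
have dl2 : dl * (104 * N%:R) <= del.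
  by rewrite -ler_pdivlMr ?mulr_gt0 // ge_min lexx orbT.
pose Z := [seq iota k%:Z | k <- index_iota 0 N].
(* Products are included because the unitary correction has to be controlled at x y too. *)
pose K1 := K ++ [seq (x * y)%g | x <- K, y <- K] ++ [seq iota a | a <- A].
have [d [sg0 [d0 sg0_u sg0_mul sg0_tr]]] := sep (map q (K1 ++ Z)) dl0.
pose sd := Num.sqrt d%:R : R.
have sd0 : 0 <= sd by exact: sqrtr_ge0.
have sd2 : sd * sd = d%:R by rewrite -expr2 sqr_sqrtr ?ler0n.
pose sg x := sg0 (q x).
have sg_u x : sg x \is unitarymx by exact: sg0_u.
have sg_mul x y : x \in K1 ++ Z -> y \in K1 ++ Z ->
    fnorm (sg (x * y)%g - sg x *m sg y) <= dl * sd.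
  by move=> xK yK; rewrite /sg qM; apply: sg0_mul; apply: map_f.
have kZ (k : 'I_N) : iota k%:Z \in K1 ++ Z.
  by rewrite mem_cat; apply/orP; right; apply: map_f; rewrite mem_index_iota ltn_ord.
have K1Z x : x \in K1 -> x \in K1 ++ Z by move=> xK; rewrite mem_cat xK.
have aZ a : a \in A -> iota a \in K1 by move=> aA; rewrite !mem_cat map_f ?orbT.
have KK1 x : x \in K -> x \in K1 by move=> xK; rewrite mem_cat xK.
have KKK1 x y : x \in K -> y \in K -> (x * y)%g \in K1.
  move=> xK yK; rewrite !mem_cat; apply/orP; right; apply/orP; left.
  exact: (allpairs_f (fun x y : Gt => (x * y)%g) xK yK).
have sg_per a : sg (iota (a + N%:Z)) = sg (iota a) by rewrite /sg q_per.
(* [iota 0] is its own square, so the unitary [sg (iota 0)] is close to its square, hence to the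
   identity. *)
have one : (1 - dl) * d%:R <= re (\tr (sg (iota 0))).
  have := kZ (Ordinal N_gt0); rewrite /= => z0.
  have := sg_mul _ _ z0 z0; rewrite -iotaD addr0.
  have [U1 U2] := uniP (sg_u (iota 0)).
  rewrite -{1}[sg (iota 0)]mulmx1 -mulmxBr fnorm_mull // => H1.
  have := re_tr_le (1%:M - sg (iota 0)).
  rewrite raddfB /= reB mxtrace1 -(rmorph_nat (toC C)) re_toC ler_norml -/sd.
  by have := ler_wpM2r sd0 H1; rewrite -mulrA sd2 => H2 /andP[_ H3]; lra.
have small (k : 'I_N) : (0 < k)%N -> `|re (\tr (sg (iota k%:Z)))| <= dl * d%:R.
  move=> k0; apply: sg0_tr; first by apply: map_f.
  by apply: q_inj; rewrite k0 ltn_ord.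
have [zeta' [zetaE trz]] := isotypic_trace dl0' small one.
have zN : zeta' ^+ N = 1.
  by case: zetaE => ->; rewrite -?rmorphXn zetaN ?rmorph1.
have mulZ x (k : 'I_N) : x \in K1 ->
   fnorm (sg (iota k%:Z * x)%g - sg (iota k%:Z) *m sg x) <= dl * sd /\
   fnorm (sg (x * iota k%:Z)%g - sg x *m sg (iota k%:Z)) <= dl * sd.
  by move=> xK; split; apply: sg_mul; first [exact: kZ | exact: K1Z].
have mulI (k m : 'I_N) : fnorm (sg (iota k%:Z * iota m%:Z)%g -
    sg (iota k%:Z) *m sg (iota m%:Z)) <= dl * sd by apply: sg_mul; exact: kZ.
have [r [e [ee HQ]]] := isotypic_corner N_gt0 sg_u iotaD sg_per zN mulI.
set Q := isotypic iota N sg zeta' in trz HQ; rewrite -/sd in HQ.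
pose sr := Num.sqrt r%:R : R.
have sr0 : 0 <= sr by exact: sqrtr_ge0.
have sr2 : sr * sr = r%:R by rewrite -expr2 sqr_sqrtr ?ler0n.
have rank : d%:R <= 2 * N%:R * r%:R :> R.
  have := re_tr_le (e^t* *m e - Q); rewrite raddfB /= reB.
  rewrite mxtrace_mulC ee mxtrace1 -(rmorph_nat (toC C)) re_toC ler_norml -/sd.
  move=> /andP[H1 _]; have := ler_wpM2r sd0 HQ; rewrite -!mulrA sd2 => H2.
  (* One [dl] comes from the trace estimate and five from the corner. *)
  have H3 : (N%:R^-1 - 6 * dl) * d%:R <= r%:R by lra.
  have H4 : (2 * N%:R)^-1 <= N%:R^-1 - 6 * dl.
    rewrite -(ler_pM2r (x := 2 * N%:R)) ?mulr_gt0 // mulVf; last first.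
      by rewrite mulf_neq0 ?lt0r_neq0.
    rewrite mulrBl mulrCA mulVf ?lt0r_neq0 //.
    by move: dl1; lra.
  rewrite mulrA -ler_pdivrMl ?mulr_gt0 //. apply: le_trans _ H3.
  by rewrite ler_wpM2r ?ler0n.
have r0 : (0 < r)%N.
  rewrite lt0n; apply/eqP => r0; move: rank; rewrite r0 mulr0 leNgt ltr0n.
  by rewrite d0.
have sdr : sd <= 2 * N%:R * sr.
  rewrite -(ler_pXn2r (n := 2)) ?nnegrE ?mulr_ge0 ?ler0n //.
  rewrite exprMn ![_ ^+ 2]expr2 sd2 sr2; apply: le_trans rank _.
  rewrite ler_wpM2r ?ler0n // ler_peMr ?mulr_ge0 ?ler0n //.
  by lra.
have comm x : x \in K1 ->
    fnorm (sg x *m (e^t* *m e) - (e^t* *m e) *m sg x) <= 12 * dl * sd.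
  move=> xK; have H1 := isotypic_comm N_gt0 iotaC zN mulZ xK.
  rewrite -/Q -/sd in H1; have [U1 U2] := uniP (sg_u x).
  have -> : sg x *m (e^t* *m e) - (e^t* *m e) *m sg x =
      sg x *m (e^t* *m e - Q) - (e^t* *m e - Q) *m sg x +
      (sg x *m Q - Q *m sg x).
    by rewrite mulmxBr mulmxBl; exact: sub_swap.
  apply: le_trans (fnormD _ _) _.
  have := fnormB (sg x *m (e^t* *m e - Q)) ((e^t* *m e - Q) *m sg x).
  rewrite fnorm_mull // fnorm_mulr //; move: HQ H1; lra.
pose P := e^t* *m e; pose p0 x := e *m sg x *m e^t*.
have eP : e *m P = e by rewrite /P mulmxA ee mul1mx.
have Pe : P *m e^t* = e^t* by rewrite /P -mulmxA ee mulmx1.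
have PE : P = e^t* *m e by [].
rewrite -/P in comm HQ; clearbody P.
have ee' : (e^t*)^t* *m e^t* = 1%:M by rewrite trmxCK.
have corner (X : 'M[C]_d) : fnorm (e *m X *m e^t*) <= fnorm X.
  by apply: le_trans (fnorm_compr _ ee) _; apply: fnorm_compl.
have contr x n (B : 'M[C]_(r, n)) : fnorm (p0 x *m B) <= fnorm B.
  rewrite /p0 -!mulmxA; apply: le_trans (fnorm_compl _ ee) _.
  by have [U1 U2] := uniP (sg_u x); rewrite fnorm_mull // fnorm_mull.
have p0_mul x y : x \in K -> y \in K ->
    fnorm (p0 (x * y)%g - p0 x *m p0 y) <= 13 * dl * sd.
  move=> xK yK.
  have -> : p0 (x * y)%g - p0 x *m p0 y =
      e *m (sg (x * y)%g - sg x *m sg y) *m e^t* -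
      e *m ((sg x *m P - P *m sg x) *m sg y) *m e^t*.
    rewrite mulmxBl !mulmxBr !mulmxBl !mulmxA eP opprB addrA subrK /p0 PE.
    by rewrite !mulmxA.
  apply: le_trans (fnormB _ _) _.
  have H1 := corner (sg (x * y)%g - sg x *m sg y).
  have H2 := corner ((sg x *m P - P *m sg x) *m sg y).
  have [U1 U2] := uniP (sg_u y); rewrite (fnorm_mulr _ U1) in H2.
  have H3 := comm _ (KK1 _ xK).
  have H4 := sg_mul _ _ (K1Z _ (KK1 _ xK)) (K1Z _ (KK1 _ yK)).
  by move: H1 H2 H3 H4; lra.
have p0_uni x : x \in K1 -> fnorm (p0 x *m (p0 x)^t* - 1%:M) <= 12 * dl * sd.
  move=> xK; have [U1 U2] := uniP (sg_u x).
  have -> : p0 x *m (p0 x)^t* - 1%:M =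
      e *m ((sg x *m P - P *m sg x) *m (sg x)^t*) *m e^t*.
    rewrite mulmxBl mulmxBr mulmxBl !mulmxA eP -[_ *m sg x *m (sg x)^t*]mulmxA.
    by rewrite U1 mulmx1 ee /p0 PE !trmxCM trmxCK !mulmxA.
  apply: le_trans (corner _) _; rewrite fnorm_mulr ?trmxCK //; exact: comm.
have p0_iota a : a \in A -> fnorm (p0 (iota a) - (exprz zeta' a)%:M) <= 11 * dl * sd.
  move=> aA.
  have zn : nrm (exprz zeta' a) = 1.
    apply: nrm_expz; apply/eqP; rewrite -(pexpr_eq1 N_gt0) ?nrm_ge0 //.
    by rewrite -nrmXn zN nrm1.
  have H1 : fnorm (sg (iota a) *m Q - exprz zeta' a *: Q) <= dl * sd.
    apply: isotypic_eigen => // k.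
    by apply: sg_mul; [exact: K1Z (aZ _ aA) | exact: kZ].
  have -> : p0 (iota a) - (exprz zeta' a)%:M =
      e *m (sg (iota a) *m (P - Q) - exprz zeta' a *: (P - Q) +
            (sg (iota a) *m Q - exprz zeta' a *: Q)) *m e^t*.
    have -> : sg (iota a) *m (P - Q) - exprz zeta' a *: (P - Q) +
        (sg (iota a) *m Q - exprz zeta' a *: Q) =
        sg (iota a) *m P - exprz zeta' a *: P.
      by rewrite mulmxBr scalerBr; apply/esym; exact: sub_swap.
    rewrite mulmxBr mulmxBl -scalemxAr eP -scalemxAl ee scalemx1.
    by rewrite -[in RHS]mulmxA -[sg _ *m P *m _]mulmxA Pe mulmxA.
  apply: le_trans (corner _) _; apply: le_trans (fnormD _ _) _.
  have := fnormB (sg (iota a) *m (P - Q)) (exprz zeta' a *: (P - Q)).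
  have [U1 U2] := uniP (sg_u (iota a)).
  by rewrite fnorm_mull // fnormZ zn mul1r; move: HQ H1; lra.
have sdp : 0 < sd by rewrite sqrtr_gt0 ltr0n.
have eta0 : 0 < dl * sd by rewrite mulr_gt0.
(* The compression to the corner is only nearly unitary on [K1]; polar decomposition makes it
   exactly unitary at every [x], at a cost of 12 + 1 there. *)
have polar x : exists V : 'M[C]_r, V \is unitarymx /\
    fnorm (V - p0 x) <= fnorm (p0 x *m (p0 x)^t* - 1%:M) + dl * sd.
  by have [V V1 V2] := polar_approx (p0 x) eta0; exists V.
have [U UP] := choice polar.
have Up x : x \in K1 -> fnorm (U x - p0 x) <= 13 * dl * sd.
  by move=> xK; have [_ H1] := UP x; have := p0_uni x xK; move: H1; lra.
(* 52 = 13 + 13 + 26: the unitary correction at x y, the failure of multiplicativity of [p0], and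
   the corrections at x and y. *)
have final : 52 * dl * sd <= del * sr.
  have H1 : dl * sd <= dl * (2 * N%:R * sr) by rewrite ler_wpM2l.
  by have := ler_wpM2r sr0 dl2; move: H1; lra.
exists zeta', r, U; split=> // [x|x y xK yK|a aA]; first by have [] := UP x.
  apply: le_trans _ final.
  have H1 := Up _ (KKK1 _ _ xK yK); have H2 := Up _ (KK1 _ xK).
  have H3 := Up _ (KK1 _ yK); have H4 := p0_mul _ _ xK yK.
  have H5 : fnorm (p0 x *m p0 y - U x *m U y) <= 26 * dl * sd.
    have -> : p0 x *m p0 y - U x *m U y =
        p0 x *m (p0 y - U y) + (p0 x - U x) *m U y.
      by rewrite mulmxBr mulmxBl addrA subrK.
    apply: le_trans (fnormD _ _) _; have := contr x _ (p0 y - U y).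
    have [U1 U2] := uniP (UP y).1; rewrite (fnorm_mulr _ U1).
    by rewrite (fnormBC (p0 x) (U x)) (fnormBC (p0 y) (U y)); move: H2 H3; lra.
  have := fnorm_dist (p0 (x * y)%g) (U (x * y)%g) (U x *m U y).
  have := fnorm_dist (p0 x *m p0 y) (p0 (x * y)%g) (U x *m U y).
  by move: H1 H4 H5; lra.
apply: le_trans _ final.
have := fnorm_dist (p0 (iota a)) (U (iota a)) (exprz zeta' a)%:M.
have := Up _ (aZ _ aA); have := p0_iota _ aA; have := eta0; lra.
Qed.

End ScalarReps.

Local Open Scope classical_set_scope.
Local Open Scope ring_scope.

(** * The case of complex matrices *)

Section Concrete.
Variable R : realType.

Lemma std_reD : {morph (@complex.Re R) : x y / x + y}.
Proof. by case=> [a b] [c e]. Qed.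
Lemma std_reZ (a : R) (x : R[i]) : complex.Re (real_complex R a * x) = a * complex.Re x.
Proof. by case: x => [b c] /=; rewrite mul0r subr0. Qed.
Lemma std_re_conj (x : R[i]) : complex.Re x^* = complex.Re x.
Proof. by case: x. Qed.
Lemma std_mulconj (x : R[i]) :
  complex.Re (x * x^*) = complex.Re x ^+ 2 + complex.Im x ^+ 2.
Proof. by case: x => [a b] /=; ring. Qed.
Lemma std_mulconj_ge0 (x : R[i]) : 0 <= complex.Re (x * x^*).
Proof. by rewrite std_mulconj addr_ge0 ?sqr_ge0. Qed.
Lemma std_sqr_re_le (x : R[i]) : complex.Re x ^+ 2 <= complex.Re (x * x^*).
Proof. by rewrite std_mulconj lerDl sqr_ge0. Qed.

Definition std_complexes : complexes R :=
  @Complexes R R[i] (@complex.Re R) (real_complex R) std_reD std_reZ erefl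
    std_re_conj (@conjc_real R) (@RRe_real R) std_mulconj_ge0 std_sqr_re_le.

Lemma hsnormE m (x : 'M[R[i]]_m) :
  hsnorm x = fnorm (x : 'M[std_complexes]_m) / Num.sqrt m%:R.
Proof.
have -> : hsnorm x = Num.sqrt (m%:R^-1 * re (\tr ((x : 'M[std_complexes]_m)^t* *m x))) by [].
rewrite mxtrace_mulC -(ipT (x : 'M[std_complexes]_m) x) mulrC sqrtrM ?re_ip_ge0 //.
by rewrite fnorm.unlock sqrtrV.
Qed.

Lemma fnorm_hsnorm m (x : 'M[R[i]]_m) : (0 < m)%N ->
  fnorm (x : 'M[std_complexes]_m) = hsnorm x * Num.sqrt m%:R.
Proof.
by move=> m0; rewrite hsnormE divfK // lt0r_neq0 // sqrtr_gt0 ltr0n.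
Qed.

Lemma TFD_averaging (G : groupType) : property_TFD R G -> averaging std_complexes G.
Proof.
move=> [S [lambda [Ssym Sgen l0 Sgap]]].
apply: (@gap_averaging R std_complexes G (enum_fset S) lambda) => //.
- exact: fset_uniq.
- move=> P P1 PM PV PS g.
  have : [set: G]%classic g by [].
  rewrite -Sgen => /(_ P); apply; split; first by split.
  by move=> x /PS.
Qed.

Lemma near_all_seq (T : eqType) (s : seq T) (P : T -> nat -> Prop) :
  (forall x, x \in s -> \forall n \near \oo, P x n) ->
  \forall n \near \oo, forall x, x \in s -> P x n.
Proof.
elim: s => [|x s IH] H; first by near=> n => x.
have H1 : \forall n \near \oo, P x n by apply: H; rewrite mem_head.
have H2 : \forall n \near \oo, forall y, y \in s -> P y n.
  by apply: IH => y ys; apply: H; rewrite inE ys orbT.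
near=> n => y; rewrite inE => /orP[/eqP ->|ys].
  by near: n.
by apply: (near H2 n).
Unshelve. all: by end_near.
Qed.

Lemma countable_exhaustion (T : choiceType) : countable [set: T]%classic ->
  exists K : nat -> seq T, forall x, exists n, forall m, (n <= m)%N -> x \in K m.
Proof.
move=> /countable_injP [f finj].
pose e i : option T := if pselect (exists x, f x = i) is left H
  then Some (projT1 (cid H)) else None.
have eK x : e (f x) = Some x.
  rewrite /e; case: pselect => [H|[]]; last by exists x.
  by congr Some; apply: finj (projT2 (cid H)); apply: mem_set.
exists (fun n => pmap e (iota 0 n)) => x; exists (f x).+1 => m fm.
by rewrite mem_pmap -(eK x); apply: map_f; rewrite mem_iota.
Qed.

(** The last k rows of [y] are orthonormal and are compared with zero, so sqrt k <= e sqrt (d + k).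
    With e <= 1/2 this gives k <= d: the added dimension is under control, and norms relative to d +
    k can be replaced by norms relative to d. *)
Lemma intertwiner_near d k (x : 'M[std_complexes]_d) (y : 'M[std_complexes]_(d + k)) (e : R) :
  y *m y^t* = 1%:M -> (0 < d)%N -> 0 <= e -> e <= 2^-1 ->
  hsnorm (block_mx x 0 0 0 - y : 'M[R[i]]_(d + k)) <= e ->
  fnorm (row_mx 1%:M 0 *m y - x *m row_mx 1%:M 0) <= 2 * e * Num.sqrt d%:R.
Proof.
move=> yy d0 e0 e2 H.
have dk0 : (0 < d + k)%N by rewrite addn_gt0 d0.
set B := block_mx x 0 0 0 - y in H.
pose sdk := Num.sqrt (d + k)%:R : R.
have sdk2 : sdk ^+ 2 = (d + k)%:R by rewrite sqr_sqrtr ?ler0n.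
have fB : fnorm (B : 'M[std_complexes]_(d + k)) <= e * sdk.
  by rewrite fnorm_hsnorm // ler_wpM2r // sqrtr_ge0.
pose j1 : 'M[std_complexes]_(d, d + k) := row_mx 1%:M 0.
pose j2 : 'M[std_complexes]_(k, d + k) := row_mx 0 1%:M.
have j11 : j1 *m j1^t* = 1%:M.
  rewrite /j1 tr_row_mx map_col_mx mul_row_col trmxC1 mulmx1.
  by rewrite mul0mx addr0.
have j22 : j2 *m j2^t* = 1%:M.
  rewrite /j2 tr_row_mx map_col_mx mul_row_col trmxC1 mulmx1.
  by rewrite mul0mx add0r.
have j1B : j1 *m B = x *m j1 - j1 *m y.
  rewrite /B mulmxBr /j1 mul_row_block mul_mx_row !mul1mx !mul0mx.
  by rewrite !addr0 mulmx1 mulmx0.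
have j2B : j2 *m B = - (j2 *m y).
  rewrite /B mulmxBr /j2 mul_row_block !mul1mx !mul0mx !addr0 row_mx0.
  by rewrite sub0r.
have f2 : Num.sqrt k%:R <= e * sdk.
  have <- : fnorm (j2 *m B) = Num.sqrt k%:R.
    by rewrite j2B fnormN fnorm_mulr // fnorm_coiso.
  by apply: le_trans fB; exact: fnorm_compl.
have kd : (k <= d)%N.
  have : Num.sqrt k%:R ^+ 2 <= (2^-1 * sdk) ^+ 2.
    rewrite ler_pXn2r ?nnegrE ?sqrtr_ge0 ?mulr_ge0 ?sqrtr_ge0 ?invr_ge0 //.
    by apply: le_trans f2 _; rewrite ler_wpM2r ?sqrtr_ge0.
  rewrite exprMn sdk2 sqr_sqrtr ?ler0n // natrD -(ler_nat R).
  by have := ler0n R d; lra.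
rewrite fnormBC -j1B; apply: le_trans (fnorm_compl _ j11) _; apply: le_trans fB _.
rewrite [leRHS](_ : _ = e * (2 * Num.sqrt d%:R)); last by ring.
rewrite ler_wpM2l //.
rewrite -(ler_pXn2r (n := 2)) ?nnegrE ?mulr_ge0 ?sqrtr_ge0 // sdk2 exprMn.
rewrite sqr_sqrtr ?ler0n // natrD.
have kd2 : k%:R <= d%:R :> R by rewrite ler_nat.
by move: kd2 (ler0n R d); lra.
Qed.

(** If no test set and tolerance suffice, choose a counterexample for the n-th set of an exhaustion
    and tolerance 1/(n + 1). These form an asymptotic representation, and stability contradicts the
    choice for large n. *)
Lemma hs_stable_flex (G : groupType) : countable [set: G] -> hs_stable R G ->
  flex_stable std_complexes G.
Proof.
move=> Gc stab F e e0; have [Kn KnP] := countable_exhaustion Gc.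
apply: contrapT => no.
pose del n : R := n.+1%:R^-1.
have del0 n : 0 < del n by rewrite invr_gt0 ltr0n.
pose bad (n : nat) (p : {d : nat & G -> 'M[std_complexes]_d}) : Prop :=
  [/\ (0 < projT1 p)%N, forall g, projT2 p g \is unitarymx,
      forall g h, g \in Kn n -> h \in Kn n ->
        fnorm (projT2 p (g * h)%g - projT2 p g *m projT2 p h) <=
          del n * Num.sqrt (projT1 p)%:R &
      ~ exists D (rho : G -> 'M[std_complexes]_D) (j : 'M[std_complexes]_(projT1 p, D)),
        [/\ urep rho, j *m j^t* = 1%:M &
            forall g, g \in F ->
              fnorm (j *m rho g - projT2 p g *m j) <= e * Num.sqrt (projT1 p)%:R]].
have ex n : exists p, bad n p.
  apply: contrapT => nobad; apply: no; exists (Kn n), (del n); split=> //.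
  move=> d pi d0 pi_u piM; apply: contrapT => nox; apply: nobad.
  by exists (existT _ d pi); split.
have [P PP] := choice ex.
pose d n := projT1 (P n).
pose pi n : G -> 'M[R[i]]_(d n) := projT2 (P n).
have del_cvg : (del n @[n --> \oo] --> (0 : R))%classic by exact: cvg_harmonic.
have asym : asymptotic_rep pi.
  split=> [n|n g|g h]; first by have [] := PP n.
    by have [_ + _ _] := PP n; apply.
  apply: (@squeeze_cvgr _ _ _ _ (fun=> 0) del); last exact: del_cvg.
    have [n1 H1] := KnP g; have [n2 H2] := KnP h.
    exists (maxn n1 n2) => // n /=; rewrite geq_max => /andP[n1n n2n].
    rewrite sqrtr_ge0 /= hsnormE.
    have [d0 _ + _] := PP n; move=> /(_ g h (H1 n n1n) (H2 n n2n)) H.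
    by rewrite ler_pdivrMr // sqrtr_gt0 ltr0n.
  exact: cvg_cst.
have [k [rho [rho_r rho_near]]] := stab d pi asym.
(* 1/2 bounds the added dimension, and e / 2 compensates the factor 2 of [intertwiner_near]. *)
pose eta := Num.min (2^-1) (e / 2).
have eta0 : 0 < eta by rewrite lt_min invr_gt0 divr_gt0 ?ltr0n.
have eta1 : eta <= 2^-1 by rewrite ge_min lexx.
have eta2 : 2 * eta <= e.
  by rewrite mulrC -ler_pdivlMr ?ltr0n // ge_min lexx orbT.
have : \forall n \near \oo, forall g, g \in F -> d2 (pi n g) (rho n g) <= eta.
  apply: near_all_seq => g _.
  have [n0 _ H] := (cvgrPdist_le _ _).1 (rho_near g) eta eta0.
  exists n0 => // n nn; have := H n nn; rewrite sub0r normrN; apply: le_trans.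
  exact: ler_norm.
case=> n _ /(_ n (leqnn n)) near.
have [d0 pu _ nox] := PP n; apply: nox.
have [ru rM] := rho_r n.
exists (d n + k n)%N, (rho n), (row_mx 1%:M 0); split.
- by split=> // g h; exact: rM.
- rewrite tr_row_mx map_col_mx mul_row_col trmxC1 mulmx1.
  by rewrite mul0mx addr0.
move=> g gF; have /unitarymxP rr := ru g.
have := @intertwiner_near (d n) (k n) (pi n g) (rho n g) eta rr d0 (ltW eta0) eta1
  (near g gF).
move/le_trans; apply; rewrite ler_wpM2r ?sqrtr_ge0 //.
Qed.

(** For unitaries the squared distance to the value at 1 is 2 - 2 Re of the normalized inner
    product. That value is close to the identity because it is close to its square. Each of the two
    errors takes del / 2. *)
Lemma hyperlinear_separated (H : groupType) : hyperlinear R H ->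
  trace_separated std_complexes H.
Proof.
move=> [d [pi [[d0 pi_u piM] pi_sep]]] K del del0.
pose dl := del / 2.
have dl0 : 0 < dl by rewrite divr_gt0.
have ev1 : \forall n \near \oo, forall x, x \in 1%g :: K -> forall y, y \in 1%g :: K ->
    hsnorm (pi n (x * y)%g - pi n x *m pi n y) <= dl.
  apply: near_all_seq => x _; apply: near_all_seq => y _.
  have [n0 _ Hn] := (cvgrPdist_le _ _).1 (piM x y) dl dl0.
  exists n0 => // n nn; have := Hn n nn; rewrite sub0r normrN; apply: le_trans.
  exact: ler_norm.
have ev2 : \forall n \near \oo, forall x, x \in K -> x != 1%g ->
    `|2 - hsnorm (pi n x - pi n 1%g) ^+ 2| <= del.
  apply: near_all_seq => x _; case: (eqVneq x 1%g) => [_|x1].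
    by near=> n.
  have /cvgM := pi_sep x 1%g (elimN eqP x1).
  move=> /(_ _ _ (pi_sep x 1%g (elimN eqP x1))).
  rewrite -expr2 sqr_sqrtr // => lim.
  have [n0 _ Hn] := (cvgrPdist_le _ _).1 lim del del0.
  by exists n0 => // n nn _; have := Hn n nn; rewrite /= -expr2.
have [n0 _ both] := filterI ev1 ev2.
have {both} [Hmul Hsep] := both n0 (leqnn n0).
pose sg : H -> 'M[std_complexes]_(d n0) := pi n0.
have sg_u x : sg x \is unitarymx by exact: pi_u.
pose sd := Num.sqrt (d n0)%:R : R.
have sd0 : 0 <= sd by exact: sqrtr_ge0.
have sd2 : sd * sd = (d n0)%:R by rewrite -expr2 sqr_sqrtr ?ler0n.
have mul x y : x \in 1%g :: K -> y \in 1%g :: K ->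
    fnorm (sg (x * y)%g - sg x *m sg y) <= dl * sd.
  move=> xK yK; rewrite (@fnorm_hsnorm (d n0) (sg (x * y)%g - sg x *m sg y)) //.
  by rewrite ler_wpM2r //; exact: Hmul.
exists (d n0), sg; split=> // [x y xK yK|x xK x1].
  apply: le_trans (mul x y _ _) _; rewrite ?inE ?xK ?yK ?orbT //.
  by rewrite ler_wpM2r // /dl; lra.
have one : fnorm (1%:M - sg 1%g) <= dl * sd.
  have := mul 1%g 1%g (mem_head _ _) (mem_head _ _); rewrite mulg1.
  have [U1 U2] := uniP (sg_u 1%g).
  by rewrite -{1}[sg 1%g]mulmx1 -mulmxBr fnorm_mull.
have fsg y : fnorm (sg y) = sd by apply: fnorm_coiso; have [] := uniP (sg_u y).
have := Hsep x xK x1.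
have hsE : hsnorm (pi n0 x - pi n0 1%g) ^+ 2 * (d n0)%:R = fnorm (sg x - sg 1%g) ^+ 2.
  rewrite (@fnorm_hsnorm (d n0) (sg x - sg 1%g)) // exprMn.
  by rewrite (sqr_sqrtr (ler0n R (d n0))).
move=> Hx.
have Hx' : `|2 * (d n0)%:R - fnorm (sg x - sg 1%g) ^+ 2| <= del * (d n0)%:R.
  rewrite -hsE -mulrBl normrM (ger0_norm (ler0n R (d n0))).
  by rewrite ler_wpM2r ?ler0n.
have ipE' : 2 * (d n0)%:R - fnorm (sg x - sg 1%g) ^+ 2 = 2 * re (ip (sg x) (sg 1%g)).
  by rewrite fnormD_sqr fnormN ipNr reN !fsg -sd2; ring.
rewrite ipE' in Hx'.
have -> : \tr (sg x) = ip (sg x) (sg 1%g) + ip (sg x) (1%:M - sg 1%g).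
  by rewrite -ipDr addrC subrK ipT trmxC1 mulmx1.
rewrite reD; apply: le_trans (ler_normD _ _) _.
have : `|re (ip (sg x) (1%:M - sg 1%g))| <= sd * (dl * sd).
  apply: le_trans (re_le_nrm _) _; apply: le_trans (cauchy_ip _ _) _.
  by rewrite fsg ler_wpM2l.
move: Hx'; rewrite normrM (ger0_norm (ler0n R 2)).
have -> : sd * (dl * sd) = del / 2 * (d n0)%:R by rewrite -sd2 /dl; ring.
lra.
Unshelve. all: by end_near.
Qed.

Lemma expi_pow (t : R) n :
  ((cos t +i* sin t)%C : R[i]) ^+ n = (cos (n%:R * t) +i* sin (n%:R * t))%C.
Proof.
elim: n => [|n IH]; first by rewrite expr0 mul0r cos0 sin0.
rewrite exprS IH -natr1 mulrDl mul1r addrC cosD sinD.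
by apply/eqP; rewrite eq_complex /=; apply/andP; split; apply/eqP; ring.
Qed.

Lemma small_roots (M : nat) (del : R) : (0 < M)%N -> 0 < del ->
  exists (N : nat) (zeta : std_complexes),
    [/\ (0 < N)%N, zeta ^+ N = 1, exprz zeta M%:Z != 1 & nrm (zeta - 1) <= del].
Proof.
move=> M0 del0.
have d20 : 0 < del ^+ 2 / 2 by rewrite divr_gt0 ?exprn_gt0.
have cos_cvg : (cos x @[x --> (0 : R)] --> cos 0)%classic by exact: continuous_cos.
rewrite cos0 in cos_cvg.
have [r /= r0 Hr] := (nbhs_ballP _ _).1 ((cvgrPdist_le _ _).1 cos_cvg _ d20).
(* The root is exp(i t) with t = 2 pi / N. The first summand makes t small enough for the bound on
   |exp(i t) - 1|^2 = 2 (1 - cos t). The second gives 0 < M t < pi, so that sin (M t) > 0 and the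
   M-th power is not 1. *)
pose N := (Num.Def.archi_bound (2 * pi / r) + 2 * M).+1.
have N0 : 0 < N%:R :> R by rewrite ltr0n.
pose t : R := 2 * pi / N%:R.
have pi0 := pi_gt0 R.
have t0 : 0 < t by rewrite divr_gt0 ?mulr_gt0.
have tr : t < r.
  rewrite ltr_pdivrMr // [ltRHS]mulrC -ltr_pdivrMr //.
  apply: lt_le_trans (archi_boundP _) _; first by rewrite divr_ge0 ?mulr_ge0 ?ltW.
  by rewrite ler_nat /N -addSn leqW ?leq_addr.
have tM : M%:R * t < pi.
  rewrite /t mulrA ltr_pdivrMr // mulrA mulrC ltr_pM2l // mulrC -natrM ltr_nat.
  by rewrite /N ltnS leq_addl.
exists N, (cos t +i* sin t)%C; split=> //.
- have -> : ((cos t +i* sin t)%C : std_complexes) ^+ N = (cos (N%:R * t) +i* sin (N%:R * t))%C.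
    exact: expi_pow.
  have -> : N%:R * t = pi *+ 2.
    by rewrite /t mulrC divfK ?lt0r_neq0 // mulr_natl.
  by rewrite cos2pi sin2pi.
- have -> : exprz ((cos t +i* sin t)%C : std_complexes) M%:Z =
      (cos (M%:R * t) +i* sin (M%:R * t))%C by exact: expi_pow.
  apply/eqP => /(congr1 (@complex.Im R)) /= sin0.
  have := @sin_gt0_pi R (M%:R * t); rewrite sin0 ltxx => H.
  by have : false by apply: H; rewrite mulr_gt0 ?ltr0n.
rewrite -(ler_pXn2r (n := 2)) ?nnegrE ?nrm_ge0 ?(ltW del0) // nrm_sqr.
have -> : re (((cos t +i* sin t)%C - 1 : std_complexes) * ((cos t +i* sin t)%C - 1 : std_complexes)^*) =
    2 * (1 - cos t).
  transitivity ((cos t - 1) ^+ 2 + (sin t) ^+ 2).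
    by rewrite [LHS]std_mulconj /= subr0.
  by rewrite sin2cos2; ring.
have := Hr t; rewrite /ball /= sub0r normrN gtr0_norm // => /(_ tr).
by rewrite ler_norml => /andP[_]; lra.
Qed.

End Concrete.

(** * A central power in the commutator subgroup, and the conclusion *)

Lemma power_in_commutator (Gt G : groupType) (E : central_Z_extension Gt G) :
  finite_set [set: abelianization Gt] ->
  exists M : nat, (0 < M)%N /\ commutator_set (ext_inj E M%:Z).
Proof.
move=> fin.
pose f (k : nat) : abelianization Gt := \pi_(abelianization Gt)%qT (ext_inj E k%:Z).
(* Pigeonhole: infinitely many powers of the central generator fall into a finite abelianization. A
   coincidence at k < l puts the power l - k into the commutator subgroup. *)
have [k [l [kl fkl]]] : exists k l, (k < l)%N /\ f k = f l.
  apply: contrapT => noinj; apply: infinite_nat.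
  have finj : {in [set: nat] &, injective f}.
    move=> k l _ _ fkl; case: (ltngtP k l) => [kl|lk|->]; last exact: erefl.
      by case: noinj; exists k, l; split; [exact: kl | exact: fkl].
    by case: noinj; exists l, k; split; [exact: lk | exact: esym fkl].
  rewrite -(eq_finite_set (inj_card_eq finj)); exact: sub_finite_set fin.
exists (l - k)%N; rewrite subn_gt0; split=> //.
have := (coset_eqP (commutator_subgroup Gt) _ _).2 fkl.
suff -> : ((ext_inj E k%:Z)^-1 * ext_inj E l%:Z)%g = ext_inj E (l - k)%N%:Z by [].
apply: (mulgI (ext_inj E k%:Z)); rewrite mulVKg -ext_injD -PoszD subnKC //.
exact: ltnW.
Qed.

Theorem theorem1p3 (R : realType) (Gamma Gammat : groupType)
    (Gamma_countable : countable [set: Gamma]%classic)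
    (Gammat_countable : countable [set: Gammat]%classic)
    (E : central_Z_extension Gammat Gamma) :
  property_TFD R Gamma ->
  finite_set [set: abelianization Gammat]%classic ->
  hs_stable R Gamma ->
  exists N : nat, (0 < N)%N /\ ~ hyperlinear R (quotient_group (multiples E N)).
Proof.
move=> TFD fin stab; apply: contrapT => none.
have hyp N : (0 < N)%N -> hyperlinear R (quotient_group (multiples E N)).
  by move=> N0; apply: contrapT => H; apply: none; exists N.
have [M [M0 Mcomm]] := power_in_commutator E fin.
apply: (@scalar_reps_contradiction R (std_complexes R) Gammat Gamma E M%:Z).
- exact: TFD_averaging.
- exact: hs_stable_flex.
- exact: Mcomm.
- by move=> del del0; exact: small_roots.
move=> N zeta N0 zN.
pose Q := quotient_group (multiples E N).
pose q (x : Gammat) : Q := \pi_Q%qT x.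
have qM x y : q (x * y)%g = (q x * q y)%g by exact: pi_quotientM.
have q1 : q 1%g = 1%g by apply: (mulgI (q 1%g)); rewrite -qM !mulg1.
apply: (@scalar_reps_quotient R (std_complexes R) Gammat Q q (ext_inj E) N zeta).
- exact: qM.
- exact: ext_injD.
- exact: ext_inj_central.
- exact: N0.
- move=> a; apply/esym; apply/coset_eqP; exists 1.
  by apply: (mulgI (ext_inj E a)); rewrite mulVKg -ext_injD mulr1.
(* A central power that dies in the quotient has an exponent divisible by N, which is impossible for
   0 < k < N. *)
- move=> k /andP[k0 kN]; apply/eqP; rewrite -q1 => /esym /coset_eqP [m].
  rewrite invg1 mul1g => /ext_inj_injective /(congr1 absz).
  rewrite abszM !absz_nat => kE.
  have : (N %| k)%N by rewrite kE dvdn_mulr.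
  by move=> /(dvdn_leq k0); rewrite leqNgt kN.
- exact: zN.
exact: hyperlinear_separated (hyp N N0).
Qed.
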